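(* Let $Q$ be a probability distribution on $\mathbb{R}$ with $\int x\,Q(dx)=0$, $\int x^2\,Q(dx)=1/2$ and $b:=\int x^4\,Q(dx)<\infty$. For each $N\ge 1$ let $X_N$ be the $N\times N$ Hermitian Wigner matrix associated with $Q$, let $D_N(\lambda):=\det(X_N-\lambda)$, and let $f_N(\mu,\nu):=\mathbb{E}\big(D_N(\mu)D_N(\nu)\big)$ for $\mu,\nu\in\mathbb{R}$. Then for all $\mu,\nu\in\mathbb{R}$, $$\lim_{N\to\infty} c_N''\, f_N\!\left(2\sqrt N+\mu/N^{1/6},\,2\sqrt N+\nu/N^{1/6}\right)=\exp\!\left(b-\tfrac34\right)\,\mathbb{A}(\mu,\nu),$$ where $$c_N'':=\left(\sqrt{2\pi}\,N!\,N^{1/6}\,\exp\!\big(2N+(\mu+\nu)N^{1/3}\big)\right)^{-1}$$ and $$\mathbb{A}(\mu,\nu):=\frac{\mathrm{Ai}(\mu)\,\mathrm{Ai}'(\nu)-\mathrm{Ai}'(\mu)\,\mathrm{Ai}(\nu)}{\mu-\nu},$$ understood by continuous extension when $\mu=\nu$.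
   Context: The $N\times N$ Hermitian Wigner matrix $X_N=(X_{ij})_{i,j=1,\dots,N}$ associated with $Q$ is defined by $X_{ij}:=X^{\mathrm{Re}}_{ij}+\mathrm{i}X^{\mathrm{Im}}_{ij}$ for $i<j$, $X_{ii}:=\sqrt2\,X^{\mathrm{Re}}_{ii}$, and $X_{ij}:=X^{\mathrm{Re}}_{ji}-\mathrm{i}X^{\mathrm{Im}}_{ji}$ for $i>j$, where $\{X^{\mathrm{Re}}_{ij}: i\le j\}\cup\{X^{\mathrm{Im}}_{ij}: i<j\}$ is a collection of i.i.d. real random variables with distribution $Q$. Here $\det(X_N-\lambda)$ means $\det(X_N-\lambda I_N)$, $\mathbb{E}$ denotes expectation, and $\mathrm{Ai}$ denotes the Airy function. *)

(* Defs.v *)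
From mathcomp Require Import all_boot all_order all_algebra.
From mathcomp Require Export complex.
From mathcomp Require Import all_classical all_reals all_analysis.

Set Implicit Arguments.
Unset Strict Implicit.
Unset Printing Implicit Defensive.

Import Order.TTheory GRing.Theory Num.Theory.
Import numFieldNormedType.Exports.

Local Open Scope classical_set_scope.
Local Open Scope ring_scope.
Local Open Scope complex_scope.

(* Only the variables with index in [D] are constrained. *)
Definition mutually_independent (d : measure_display) (T : measurableType d)
    (R : realType) (P : probability T R) (I : finType) (D : {set I})
    (X : I -> {RV P >-> R}) : Prop :=
  forall (J : {set I}) (A : I -> set R), J \subset D ->
    (forall k, measurable (A k)) ->
    P (\bigcap_(k in [set` J]) (X k @^-1` A k)) =
    (\prod_(k in J) P (X k @^-1` A k))%E.

Section Wigner.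
Context (d : measure_display) (T : measurableType d) (R : realType).
Context (P : probability T R) (N : nat).

(* [(true, i, j)] stands for the real part and [(false, i, j)] for the
   imaginary part of the entry [(i, j)]; variables outside this index set are
   junk values which the Wigner matrix does not use. *)
Definition wigner_index : {set bool * 'I_N * 'I_N} :=
  [set k : bool * 'I_N * 'I_N | if k.1.1 then (k.1.2 <= k.2)%N else (k.1.2 < k.2)%N].

Definition iid_wigner_entries (Q : probability (measurableTypeR R) R)
    (XRe XIm : 'I_N -> 'I_N -> {RV P >-> R}) : Prop :=
  let X (k : bool * 'I_N * 'I_N) :=
    if k.1.1 then XRe k.1.2 k.2 else XIm k.1.2 k.2 in
  (forall k, k \in wigner_index ->
    forall A : set R, measurable A -> distribution P (X k) A = Q A) /\
  mutually_independent wigner_index X.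

Definition wigner_mx (XRe XIm : 'I_N -> 'I_N -> {RV P >-> R}) (w : T) :
    'M[R[i]]_N :=
  \matrix_(i < N, j < N)
    if (i < j)%N then XRe i j w +i* XIm i j w
    else if i == j then (Num.sqrt 2 * XRe i i w)%:C
    else XRe j i w -i* XIm j i w.

Definition wigner_charpoly (XRe XIm : 'I_N -> 'I_N -> {RV P >-> R})
    (lambda : R) (w : T) : R[i] :=
  \det (wigner_mx XRe XIm w - lambda%:C%:M).

Definition cexpectation (Z : T -> R[i]) : R[i] :=
  fine ('E_P[fun w => complex.Re (Z w)])%E +i*
  fine ('E_P[fun w => complex.Im (Z w)])%E.

Definition wigner_corr (XRe XIm : 'I_N -> 'I_N -> {RV P >-> R})
    (mu nu : R) : R[i] :=
  cexpectation (fun w =>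
    wigner_charpoly XRe XIm mu w * wigner_charpoly XRe XIm nu w).

End Wigner.

Section Airy.
Context (R : realType).

(* Ai(x) is the conditionally convergent integral
   (1/pi) * int_0^oo cos (t^3/3 + x t) dt. *)
Definition airy (x : R) : R :=
  pi^-1 * lim ((\int[lebesgue_measure]_(t in `[0, B])
                  cos (t ^+ 3 / 3 + x * t)) @[B --> +oo]).

Definition airy_quotient (mu nu : R) : R :=
  (airy mu * derive1 airy nu - derive1 airy mu * airy nu) / (mu - nu).

(* The diagonal values are those of the continuous extension. *)
Definition airy_kernel (mu nu : R) : R :=
  if mu == nu then
    lim (airy_quotient p.1 p.2
           @[p --> within [set p : R * R | p.1 != p.2] (nbhs (mu, nu))])
  else airy_quotient mu nu.

End Airy.

Definition edge_scaling (R : realType) (N : nat) (x : R) : R :=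
  2 * Num.sqrt N%:R + x / N%:R `^ 6^-1.

Definition edge_norm (R : realType) (N : nat) (mu nu : R) : R :=
  (Num.sqrt (2 * pi) * N`!%:R * N%:R `^ 6^-1
   * expR (2 * N%:R + (mu + nu) * N%:R `^ 3^-1))^-1.

(* Main.v *)
(* Border the N x N Hermitian matrix by one row and one column.  Expanding the determinant and
   averaging over the new row and column, the two-point correlation f_N of the (monic)
   characteristic polynomials satisfies
     f_{N+1} = ((mu - d_mu) (nu - d_nu) + 1 + (d_nu - d_mu) / (mu - nu)) f_N
               + 2 (b - 3/4) N f_{N-1},
   where the resolvent identity produces the difference quotient and the fourth cumulant of the
   entries the last term.  By Christoffel-Darboux the solution is
     f_N = N! sum_k (b - 3/4)^k / k! K_{N-2k},    K_m = sum_{j <= m} He_j(mu) He_j(nu) / j!,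
   so it remains to see that each K_{N-2k}, suitably scaled, tends to the Airy kernel: the sum
   over k then gives the factor exp (b - 3/4).  As the entries enter f_N through moments of
   order at most four only, f_N is computed for a finitely supported signed measure with the
   same moments, obtained by interpolation at five nodes.

   At the edge x = 2 sqrt N + s / N^(1/6), with w = 1 + i t, He_N(x) is up to an explicit factor
   the integral over t of (1 + eps w)^N exp (- w N^(2/3) + w^2 N^(1/3) / 2 - s w), eps = N^(-1/3),
   whose integrand tends to exp (w^3 / 3 - s w).  Shifting the contour of the Airy integral by i
   identifies the limit with Ai(s); He_{N+1} - sqrt N He_N gives Ai'(s) in the same way. *)
From HB Require Import structures.
Require Import Defs.
From mathcomp Require Import all_boot all_order all_algebra.
From mathcomp Require Import perm complex.
From mathcomp Require Import ring lra zify.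
From Stdlib Require Import FunctionalExtensionality.

Set Implicit Arguments.
Unset Strict Implicit.
Unset Printing Implicit Defensive.

Import Order.TTheory GRing.Theory Num.Theory.

Local Open Scope ring_scope.

(** * Determinants, Hermite polynomials and the recursion *)

(** The difference quotient in the recursion has denominator mu - nu, yet the diagonal mu = nu is
    wanted too. Hence the recursion is solved among polynomials in two variables, multiplied by mu -
    nu throughout; this regular element is cancelled there, and numbers are substituted afterwards.

    Each real variable sits in at most two rows, so the product of two determinants has degree at
    most four in it: this is why moments up to order four determine f_N and why five nodes suffice.
    The node weights may be negative, so independence is treated as an algebraic property of finite
    products of weights with total mass one.

    With m = N^(1/6) all edge quantities are rational in m, apart from exponentials and three
    integrals, one of which yields Stirling's formula with its constant. For fixed k, K_N and
    K_{N-2k} differ by a fixed number of summands, each negligible at the edge. A bound uniform in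
    k, needed to sum over k, comes from AM-GM and the diagonal kernels, whose summands are
    nonnegative. *)

Lemma det_bordered (D : idomainType) m (a : D) (r : 'rV[D]_m) (c : 'cV[D]_m)
    (M : 'M[D]_m) : \det M != 0 ->
  \det (block_mx a%:M r c M : 'M[D]_(1 + m)) =
    a * \det M - \sum_i \sum_j r 0 i * c j 0 * \adj M i j.
Proof.
move=> M0; apply: (mulIf M0).
pose q := (r *m (\adj M *m c)) 0 0.
have -> : \sum_i \sum_j r 0 i * c j 0 * \adj M i j = q.
  rewrite /q mxE; apply: eq_bigr => i _; rewrite mxE big_distrr /=.
  by apply: eq_bigr => j _; ring.
(* Right multiplication by this triangular block matrix, of determinant [\det M], clears the lower
   left block because M times its adjugate is [\det M]; the identity is therefore proved after
   multiplication by [\det M]. *)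
have E : \det (block_mx (\det M)%:M 0 (- (\adj M *m c)) 1%:M : 'M[D]_(1 + m)) =
    \det M by rewrite det_lblock det1 mulr1 det_scalar1.
rewrite -[X in _ * X = _]E -det_mulmx mulmx_block !mulmx0 !mulmx1 !add0r !mulmxN.
rewrite (mulmxA M) mul_mx_adj !mul_scalar_mx !mul_mx_scalar subrr.
rewrite det_ublock [RHS]mulrC mulrC; congr (_ * _).
by rewrite det_mx11 !mxE mulr1n /q mxE.
Qed.

Lemma deriv_prod (A : comNzRingType) (I : finType) (p : I -> {poly A}) :
  (\prod_i p i)^`() = \sum_i (p i)^`() * \prod_(j | i != j) p j.
Proof.
elim: (index_enum I) (index_enum_uniq I) => [|x s IH] /=.
  by rewrite !big_nil derivC.
case/andP => xs us; rewrite !big_cons derivM IH // eqxx /=; congr (_ * _ + _).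
  rewrite [RHS]big_seq_cond [LHS]big_seq; apply: eq_bigl => j.
  by case: (boolP (j \in s)) => //= js; apply/esym; apply: contraNneq xs => ->.
rewrite big_distrr /= !big_seq; apply: eq_bigr => i si.
rewrite big_cons ifT; first by rewrite mulrCA.
by apply: contraNneq xs => <-.
Qed.

(** Jacobi's formula. In the Leibniz expansion only the diagonal entries involve the variable, so
    differentiating the factor of row [i] keeps the permutations fixing [i], and these make up the
    cofactor. *)
Lemma deriv_char_poly (A : comNzRingType) m (M : 'M[A]_m) :
  (char_poly M)^`() = \sum_i \adj (char_poly_mx M) i i.
Proof.
rewrite /char_poly /determinant raddf_sum /=.
under eq_bigr => s _ do rewrite mulr_sign -scaler_sign derivZ deriv_prod scaler_sumr.
rewrite exchange_big /=; apply: eq_bigr => i _.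
rewrite mxE expand_cofactor [RHS]big_mkcond /=; apply: eq_bigr => s _.
rewrite {1}/char_poly_mx !mxE derivB derivMn derivX derivC subr0 eq_sym.
case: eqP => _; last by rewrite mul0r scaler0.
by rewrite mul1r scaler_sign mulr_sign.
Qed.

(** The resolvent identity S^-1 - T^-1 = S^-1 (T - S) T^-1 multiplied by both determinants: T - S is
    inserted between the two adjugates and traces are taken. *)
Lemma adj_resolvent (A : comNzRingType) m (S T : 'M[A]_m) (d : A) :
  T - S = d%:M ->
  d * \tr (\adj S *m \adj T) = \tr (\adj S) * \det T - \det S * \tr (\adj T).
Proof.
move=> dE; rewrite -mxtraceZ scalemxAr -mul_scalar_mx -dE.
rewrite mulmxBl mulmxBr mul_mx_adj mulmxA mul_adj_mx linearB /=.
by rewrite mul_mx_scalar mul_scalar_mx !mxtraceZ; ring.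
Qed.

Section Hermite.
Variable R : comNzRingType.

(** Consecutive polynomials are carried as a pair because the three-term recurrence looks back two
    steps. These are the monic (probabilists') Hermite polynomials. *)
Fixpoint hermite_pair (j : nat) : {poly R} * {poly R} :=
  if j is j'.+1 then
    let: (p, q) := hermite_pair j' in (q, 'X * q - (j'.+1)%:R *: p)
  else (1, 'X).

Definition hermite (j : nat) : {poly R} := (hermite_pair j).1.

Lemma hermite0 : hermite 0 = 1. Proof. by []. Qed.
Lemma hermite1 : hermite 1 = 'X. Proof. by []. Qed.

Lemma hermiteSS j : hermite j.+2 = 'X * hermite j.+1 - (j.+1)%:R *: hermite j.
Proof. by rewrite /hermite /=; case: (hermite_pair j). Qed.

Lemma deriv_hermite j : (hermite j.+1)^`() = (j.+1)%:R *: hermite j.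
Proof.
suff: (hermite j.+1)^`() = (j.+1)%:R *: hermite j /\
      (hermite j.+2)^`() = (j.+2)%:R *: hermite j.+1 by case.
elim: j => [|j [IH1 IH2]].
  rewrite hermiteSS hermite1 hermite0 derivX derivB derivM derivX derivZ derivC.
  by split; [rewrite scale1r | rewrite scaler0 subr0 mul1r mulr1 -mulr2n scaler_nat].
split=> //; rewrite hermiteSS derivB derivM derivX derivZ IH1 IH2.
move: (hermiteSS j); move: (hermite j) (hermite j.+1) (hermite j.+2) => p q r ->.
rewrite -!mul_polyC !polyC_natr -(natr1 j.+2) -(natr1 j.+1).
by move: (j.+1%:R) => a; ring.
Qed.

Lemma deriv_hermite_mul j :
  'X * hermite j - (hermite j)^`() = hermite j.+1.
Proof.
case: j => [|j]; first by rewrite hermite0 derivC mulr1 subr0.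
by rewrite deriv_hermite hermiteSS.
Qed.
End Hermite.

(** * Hermite kernels in two variables and the algebraic solution of the recursion *)

Section Bivariate.
Variables (C : numFieldType) (B : comNzRingType).
Variables (polyl polyr : {rmorphism {poly C} -> B}) (polyc : {rmorphism C -> B}).
Hypothesis polylC : forall a, polyl a%:P = polyc a.
Hypothesis polyrC : forall a, polyr a%:P = polyc a.
Variables derl derr : {additive B -> B}.
Hypothesis derrE : forall p q, derr (polyl p * polyr q) = polyl p * polyr q^`().
Hypothesis derlE : forall p q, derl (polyl p * polyr q) = polyl p^`() * polyr q.
Hypothesis derrZ : forall a f, derr (polyc a * f) = polyc a * derr f.
Hypothesis derlZ : forall a f, derl (polyc a * f) = polyc a * derl f.

Let mu := polyl 'X.
Let nu := polyr 'X.

(* [mu - nu] times the operator [(mu - d_mu) (nu - d_nu) + 1 + (d_nu - d_mu) / (mu - nu)]. *)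
Definition stepop (f : B) : B :=
  (polyl 'X - polyr 'X) * (polyl 'X * polyr 'X * f - polyl 'X * derr f
     - polyr 'X * derl f + derl (derr f) + f) + (derr f - derl f).

Lemma stepop_is_zmod : zmod_morphism stepop.
Proof. by move=> p q; rewrite /stepop !raddfB /=; ring. Qed.
HB.instance Definition _ := GRing.isZmodMorphism.Build _ _ stepop stepop_is_zmod.

Lemma stepopZ a f : stepop (polyc a * f) = polyc a * stepop f.
Proof. by rewrite /stepop !(derrZ, derlZ); ring. Qed.

Definition herm2 j : B :=
  polyc (j`!%:R^-1) * (polyl (hermite C j) * polyr (hermite C j)).

Definition hkernel m : B := \sum_(j < m.+1) herm2 j.

Lemma polyc_factS m : polyc (m.+1)%:R * polyc (m.+1)`!%:R^-1 = polyc m`!%:R^-1.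
Proof.
by rewrite -rmorphM /= factS natrM invfM mulrA divff ?mul1r ?pnatr_eq0.
Qed.

(** By induction: the three-term recurrence in each variable makes two consecutive right-hand sides
    differ by mu - nu times the new summand. The factor mu - nu stays on the left since [B] is only
    a ring. *)
Lemma christoffel_darboux m : (mu - nu) * hkernel m = polyc (m`!%:R^-1) *
  (polyl (hermite C m.+1) * polyr (hermite C m)
   - polyl (hermite C m) * polyr (hermite C m.+1)).
Proof.
elim: m => [|m IH].
  rewrite /hkernel big_ord1 /herm2 hermite0 hermite1 !rmorph1; ring.
rewrite /hkernel big_ord_recr /= mulrDr IH /herm2 -polyc_factS.
rewrite hermiteSS -!mul_polyC !(rmorphB polyl, rmorphB polyr, rmorphM polyl, rmorphM polyr) /=.
rewrite polyrC polylC.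
by rewrite -/mu -/nu; ring.
Qed.

(** In each variable, multiplication minus differentiation raises the degree by one
    ([deriv_hermite_mul]), so the product part of [stepop] sends the j-th summand to j + 1 times the
    next one. *)
Lemma stepop_herm2 j : stepop (herm2 j) =
  (mu - nu) * (j.+1%:R * herm2 j.+1 + herm2 j)
  + (derr (herm2 j) - derl (herm2 j)).
Proof.
rewrite /herm2 stepopZ /stepop !derrZ !derlZ !derrE !derlE.
have -> : (j.+1%:R : B) = polyc j.+1%:R by rewrite rmorph_nat.
rewrite (mulrA (polyc j.+1%:R)) polyc_factS -!(deriv_hermite_mul _ j).
rewrite !(rmorphB polyl, rmorphB polyr, rmorphM polyl, rmorphM polyr) /=.
by ring.
Qed.

(** Since differentiation lowers the degree, Christoffel-Darboux turns the difference of derivatives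
    of summand m + 1 into mu - nu times [hkernel m]. Together with [herm2 m.+1] this rebuilds
    [hkernel m.+1], which raises its coefficient from m + 1 to m + 2. *)
Lemma stepop_hkernel m :
  stepop (hkernel m) = (mu - nu) * (m.+1%:R * hkernel m.+1).
Proof.
elim: m => [|m IH].
  rewrite /hkernel big_ord1 stepop_herm2 big_ord_recr big_ord1 /=.
  have -> : derr (herm2 0) - derl (herm2 0) = 0.
    rewrite /herm2 derrZ derlZ derrE derlE hermite0 derivC.
    by rewrite (rmorph0 polyl) (rmorph0 polyr); ring.
  by ring.
rewrite /hkernel big_ord_recr /= raddfD /= -/(hkernel m) IH stepop_herm2.
have -> : derr (herm2 m.+1) - derl (herm2 m.+1) = (mu - nu) * hkernel m.
  rewrite christoffel_darboux /herm2 !derrZ derlZ derrE derlE !deriv_hermite.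
  rewrite -!mul_polyC !(rmorphM polyl, rmorphM polyr) /= polyrC.
  by rewrite polylC -(polyc_factS m); ring.
rewrite [in RHS]big_ord_recr /= -/(hkernel m.+1).
rewrite (_ : hkernel m.+1 = hkernel m + herm2 m.+1); last by rewrite /hkernel big_ord_recr.
by rewrite -(natr1 m.+1); ring.
Qed.

Variable beta : C.

(** The test guards the truncated subtraction: otherwise [m - k.*2] would be 0 for all large [k] and
    spurious multiples of [hkernel 0] would appear. *)
Definition corr_term m k : B :=
  if (k.*2 <= m)%N then polyc (beta ^+ k / k`!%:R) * hkernel (m - k.*2) else 0.

Definition corr_sum m : B := \sum_(k < m.+1) corr_term m k.

Lemma corr_sumE m n : (m < n)%N -> corr_sum m = \sum_(k < n) corr_term m k.
Proof.
move=> mn; rewrite /corr_sum (big_ord_widen n (corr_term m)) //.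
rewrite big_mkcond /=; apply: eq_bigr => k _; case: ifP => // /negbT.
by rewrite /corr_term; case: ifP => //; lia.
Qed.

Lemma stepop_corr_term m k : stepop (corr_term m k) =
  (mu - nu) * ((m.+1%:R - k.*2%:R) * corr_term m.+1 k).
Proof.
rewrite /corr_term; case: (leqP k.*2 m) => km.
  rewrite leqW // stepopZ stepop_hkernel subSn // -(natrB _ (leqW km)) subSn //.
  by ring.
(* For [k.*2 = m.+1] the term passes from the default 0 to a multiple of [hkernel 0] in the next
   size, but exactly there the coefficient [m.+1 - k.*2] vanishes. *)
rewrite raddf0; case: ifP; last by rewrite !mulr0.
by rewrite leq_eqVlt => /orP[/eqP ->|]; [rewrite subrr mul0r mulr0 | lia].
Qed.

Lemma corr_term_shift m k :
  k.+1.*2%:R * corr_term m.+2 k.+1 = polyc (2 * beta) * corr_term m k.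
Proof.
rewrite /corr_term doubleS !ltnS !subSS; case: ifP => _; last by rewrite !mulr0.
rewrite -[_%:R](rmorph_nat polyc) !mulrA -!rmorphM /=; congr (polyc _ * _).
rewrite -doubleS -mul2n natrM exprS factS natrM invfM.
have : (k.+1%:R : C) != 0 by rewrite pnatr_eq0.
have : (k`!%:R : C) != 0 by rewrite pnatr_eq0 -lt0n fact_gt0.
by move=> k0 k1; field; rewrite k0 addrC natr1.
Qed.

(** This is the recursion for f_m / m!. On the k-th term [stepop] produces the coefficient m + 2 -
    2k instead of m + 2; the missing 2k is supplied by the term of index k - 1 two sizes below
    ([corr_term_shift]). *)
Lemma corr_sum_rec m : (mu - nu) * (m.+2%:R * corr_sum m.+2) =
  stepop (corr_sum m.+1) + (mu - nu) * (polyc (2 * beta) * corr_sum m).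
Proof.
rewrite (@corr_sumE m.+1 m.+3) // raddf_sum /=.
under eq_bigr => k _ do rewrite stepop_corr_term.
rewrite -big_distrr -mulrDr /=; congr (_ * _).
rewrite (@corr_sumE m m.+2) // [X in _ = _ + X]big_distrr /=.
under [X in _ = _ + X]eq_bigr => k _ do rewrite -corr_term_shift.
rewrite /corr_sum big_distrr /= [X in _ = X + _]big_ord_recl /=.
rewrite [LHS]big_ord_recl /= subr0 -addrA; congr (_ + _).
rewrite -big_split /=; apply: eq_bigr => k _.
by rewrite /bump /= add1n; ring.
Qed.

Lemma corr_sum0 : corr_sum 0 = 1.
Proof.
by rewrite /corr_sum big_ord1 /corr_term /hkernel big_ord1 /herm2 hermite0
  !expr0 fact0 !divr1 invr1 !rmorph1 !mulr1.
Qed.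

Lemma corr_sum1 : corr_sum 1 = mu * nu + 1.
Proof.
rewrite /corr_sum !big_ord_recl big_ord0 /corr_term /hkernel /= !big_ord_recl big_ord0 /herm2 /=.
by rewrite hermite0 hermite1 !fact0 !expr0 !divr1 !invr1 !rmorph1 !mulr1 /= ; ring.
Qed.

End Bivariate.

(** * Independence for finite product weights *)

Section FiniteExpectation.
Variables (B : comNzRingType) (K A : finType) (w : K -> A -> B).
Hypothesis w1 : forall k, \sum_a w k a = 1.
Notation Om := {ffun K -> A}.
Implicit Types (F G : Om -> B) (J : {set K}).

(** Expectation under a product of weights, each of total mass one by [w1]. The weights take values
    in a ring, so signed ones are covered. *)
Definition fexp F : B := \sum_(c : Om) (\prod_k w k (c k)) * F c.

Lemma eq_fexp F G : F =1 G -> fexp F = fexp G.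
Proof. by move=> FG; apply: eq_bigr => c _; rewrite FG. Qed.

Lemma fexp_cst b : fexp (fun=> b) = b.
Proof.
rewrite /fexp -big_distrl /= -(bigA_distr_bigA (fun k a => w k a)).
by rewrite big1 ?mul1r // => k _; rewrite w1.
Qed.

Lemma fexpZ b F : fexp (fun c => b * F c) = b * fexp F.
Proof. by rewrite /fexp big_distrr; apply: eq_bigr => c _; rewrite mulrCA. Qed.

Lemma fexpD F G : fexp (fun c => F c + G c) = fexp F + fexp G.
Proof. by rewrite /fexp -big_split; apply: eq_bigr => c _; rewrite mulrDr. Qed.

Lemma fexpN F : fexp (fun c => - F c) = - fexp F.
Proof. by rewrite -mulN1r -fexpZ; apply: eq_fexp => c; rewrite mulN1r. Qed.

Lemma fexpB F G : fexp (fun c => F c - G c) = fexp F - fexp G.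
Proof. by rewrite -fexpN -fexpD. Qed.

Lemma fexp_sum (I : finType) (F : I -> Om -> B) :
  fexp (fun c => \sum_i F i c) = \sum_i fexp (F i).
Proof.
rewrite /fexp exchange_big; apply: eq_bigr => c _.
by rewrite big_distrr.
Qed.

Definition depends_on J F := forall c d : Om, {in J, c =1 d} -> F c = F d.

Lemma depends_sub J J' F : J \subset J' -> depends_on J F -> depends_on J' F.
Proof. by move=> /subsetP s dF c d cd; apply: dF => k /s; exact: cd. Qed.

Lemma dependsD J F G : depends_on J F -> depends_on J G ->
  depends_on J (fun c => F c + G c).
Proof. by move=> dF dG c d cd; rewrite (dF _ _ cd) (dG _ _ cd). Qed.

Lemma dependsN J F : depends_on J F -> depends_on J (fun c => - F c).
Proof. by move=> dF c d cd; rewrite (dF _ _ cd). Qed.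

Lemma dependsM J F G : depends_on J F -> depends_on J G ->
  depends_on J (fun c => F c * G c).
Proof. by move=> dF dG c d cd; rewrite (dF _ _ cd) (dG _ _ cd). Qed.

(* Exchanging the coordinates outside [J] of two independent copies preserves
   the product weight and turns [F c * G d] into [F c * G c]. *)
Lemma fexp_indep J F G : depends_on J F -> depends_on (~: J) G ->
  fexp (fun c => F c * G c) = fexp F * fexp G.
Proof.
move=> dF dG.
pose mix (u : Om * Om) : Om := [ffun k => if k \in J then u.1 k else u.2 k].
pose swp (u : Om * Om) := (mix u, mix (u.2, u.1)).
have swpK : involutive swp.
  move=> [c d]; rewrite /swp /mix /=; by congr pair; apply/ffunP => k;
    rewrite !ffunE /=; case: (k \in J).
rewrite {2 3}/fexp big_distrlr /= pair_big /=.
rewrite (reindex_inj (inv_inj swpK)) /=.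
under eq_bigr => u _.
  have -> : F (mix u) = F u.1 by apply: dF => k kJ; rewrite ffunE kJ.
  have -> : G (mix (u.2, u.1)) = G u.1.
    by apply: dG => k; rewrite inE ffunE => /negbTE -> .
  rewrite mulrACA.
  have -> : (\prod_k w k (mix u k)) * (\prod_k w k (mix (u.2, u.1) k)) =
            (\prod_k w k (u.1 k)) * (\prod_k w k (u.2 k)).
    rewrite -!big_split; apply: eq_bigr => k _; rewrite !ffunE /=.
    by case: ifP => // _; rewrite mulrC.
  rewrite mulrAC; over.
rewrite -(pair_big xpredT xpredT (fun c d : Om =>
  (\prod_k w k (c k)) * (F c * G c) * (\prod_k w k (d k)))) /=.
apply: eq_bigr => c _; rewrite -big_distrr /=.
have := fexp_cst 1; rewrite /fexp /=; under eq_bigr => d _ do rewrite mulr1.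
by move=> ->; rewrite mulr1.
Qed.

Lemma fexp_coord k (h : A -> B) : fexp (fun c => h (c k)) = \sum_a w k a * h a.
Proof.
rewrite /fexp.
under eq_bigr => c _.
  rewrite (_ : h (c k) = \prod_l (if l == k then h (c l) else 1)); last first.
    by rewrite -big_mkcond big_pred1_eq.
  rewrite -big_split /=; over.
rewrite -(bigA_distr_bigA (fun l a => w l a * (if l == k then h a else 1))) /=.
rewrite (bigD1 k) //= eqxx [X in _ * X]big1 ?mulr1 // => l /negbTE lk.
by rewrite lk; under eq_bigr do rewrite mulr1.
Qed.

End FiniteExpectation.

(** * Correlation of characteristic polynomials *)

Lemma char_poly_bordered (D : idomainType) m (a : D) (r : 'rV[D]_m) (c : 'cV[D]_m)
    (M : 'M[D]_m) :
  char_poly (block_mx a%:M r c M : 'M[D]_(1 + m)) =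
    ('X - a%:P) * char_poly M
    - \sum_i \sum_j (r 0 i * c j 0)%:P * \adj (char_poly_mx M) i j.
Proof.
rewrite /char_poly.
have -> : char_poly_mx (block_mx a%:M r c M : 'M[D]_(1 + m)) =
    block_mx ('X - a%:P)%:M (map_mx polyC (- r)) (map_mx polyC (- c)) (char_poly_mx M).
  rewrite /char_poly_mx map_block_mx (scalar_mx_block 1 m) opp_block_mx add_block_mx.
  rewrite !add0r !map_mxN map_scalar_mx; congr block_mx.
  by apply/matrixP => i j; rewrite !mxE -mulrnBl.
(* The characteristic polynomial is monic, hence nonzero, so [det_bordered] applies for every [M],
   singular ones included. *)
rewrite det_bordered; last exact/monic_neq0/char_poly_monic.
congr (_ - _); apply: eq_bigr => i _; apply: eq_bigr => j _.
by rewrite !mxE -polyCM mulrNN.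
Qed.

(** * The recursion for a matrix with independent entries of Hermitian type *)

Section HermitianModel.
Variables (C : numFieldType) (K A : finType) (w : K -> A -> C) (n : nat).
Variable B : comNzRingType.
Variables (polyl polyr : {rmorphism {poly C} -> B}) (polyc : {rmorphism C -> B}).
Hypothesis polylC : forall a, polyl a%:P = polyc a.
Hypothesis polyrC : forall a, polyr a%:P = polyc a.
Variables derl derr : {additive B -> B}.
Hypothesis derrE : forall p q, derr (polyl p * polyr q) = polyl p * polyr q^`().
Hypothesis derlE : forall p q, derl (polyl p * polyr q) = polyl p^`() * polyr q.
Hypothesis derrZ : forall a f, derr (polyc a * f) = polyc a * derr f.
Hypothesis derlZ : forall a f, derl (polyc a * f) = polyc a * derl f.
Hypothesis lreg_diff : GRing.lreg (polyl 'X - polyr 'X).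
Hypothesis w1 : forall k, \sum_a w k a = 1.
Notation Om := {ffun K -> A}.
Variables (S : 'I_n -> 'I_n -> {set K}) (Z : 'I_n -> 'I_n -> Om -> C) (kappa : C).
Hypothesis SC : forall i j, S i j = S j i.
Hypothesis S_disj : forall i j k l, ~~ ((i == k) && (j == l) || (i == l) && (j == k)) ->
  [disjoint S i j & S k l].
Hypothesis Z_dep : forall i j, depends_on (S i j) (Z i j).
Hypothesis Z1 : forall i j, fexp w (Z i j) = 0.
Hypothesis Zd2 : forall i, fexp w (fun c => Z i i c ^+ 2) = 1.
Hypothesis Zo2 : forall i j, i != j -> fexp w (fun c => Z i j c ^+ 2) = 0.
Hypothesis Zo11 : forall i j, i != j -> fexp w (fun c => Z i j c * Z j i c) = 1.
Hypothesis Zo22 : forall i j, i != j ->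
  fexp w (fun c => (Z i j c * Z j i c) ^+ 2) = 2 + kappa.

Let indep := fexp_indep w1.

Lemma disjoint_depends (J J' : {set K}) (F : Om -> C) :
  [disjoint J & J'] -> depends_on J' F -> depends_on (~: J) F.
Proof.
by move=> dJ; apply: depends_sub; rewrite -disjoints_subset disjoint_sym.
Qed.

Let indepS i j k l F G :
  ~~ ((i == k) && (j == l) || (i == l) && (j == k)) ->
  depends_on (S i j) F -> depends_on (S k l) G ->
  fexp w (fun c => F c * G c) = fexp w F * fexp w G.
Proof.
move=> ne dF dG; apply: indep dF _.
exact: disjoint_depends (S_disj ne) dG.
Qed.

Lemma fexp_row2 o i j : o != i -> o != j ->
  fexp w (fun c => Z o i c * Z j o c) = (i == j)%:R.
Proof.
move=> oi oj; case: (eqVneq i j) => [<-|ij] /=; first exact: Zo11.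
rewrite (@indepS o i j o) ?Z1 ?mul0r //.
by rewrite negb_or !negb_and oj ij orbT.
Qed.

Lemma fexp_single o i (F : Om -> C) (J : {set K}) : depends_on J F ->
  [disjoint S o i & J] ->
  (fexp w (fun c => Z o i c * F c) = 0) * (fexp w (fun c => Z i o c * F c) = 0).
Proof.
move=> dF dJ; split.
  by rewrite (indep (@Z_dep o i) (disjoint_depends dJ dF)) Z1 mul0r.
have := @Z_dep i o; rewrite SC => dZ.
by rewrite (indep dZ (disjoint_depends dJ dF)) Z1 mul0r.
Qed.

Lemma depends_pair o i j : depends_on (S o i :|: S o j) (Z o i) /\
  depends_on (S o i :|: S o j) (Z j o).
Proof.
split; first exact: depends_sub (subsetUl _ _) (@Z_dep _ _).
by apply: depends_sub (subsetUr _ _) _; rewrite SC.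
Qed.

(** Wick's rule for one row, corrected by the fourth cumulant [kappa]: [Z j o] acts as the conjugate
    of [Z o j], and 2 is the Gaussian value of the mean of |Z|^4. A column index that matches no
    other belongs to an entry independent of the rest, which averages to zero. *)
Lemma fexp_row4 o i j k l : o != i -> o != j -> o != k -> o != l ->
  fexp w (fun c => (Z o i c * Z j o c) * (Z o k c * Z l o c)) =
  ((i == j) && (k == l))%:R + ((i == l) && (j == k))%:R
  + kappa * ((i == j) && (k == l) && (i == l))%:R.
Proof.
move=> oi oj ok ol.
have dj a b : o != a -> a != b -> [disjoint S o a & S o b].
  by move=> oa ab; apply: S_disj; rewrite negb_or !negb_and ab orbT (eq_sym a) oa orbT.
have djU a b c d : o != a -> a != b -> a != c -> a != d ->
    [disjoint S o a & S o b :|: (S o c :|: S o d)].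
  move=> oa ab ac ad; rewrite -setI_eq0 !setIUr.
  by rewrite !(disjoint_setI0 (dj _ _ _ _)) // !setU0.
have dUl a b (c d : 'I_n) : depends_on (S o a :|: (S o b :|: S o c)) (Z o a) /\
                  depends_on (S o a :|: (S o b :|: S o c)) (Z a o).
  have sub := subsetUl (S o a) (S o b :|: S o c).
  by split; apply: depends_sub sub _ => //; rewrite SC.
have dUr a b c : depends_on (S o a :|: (S o b :|: S o c)) (Z o b) /\
                 depends_on (S o a :|: (S o b :|: S o c)) (Z b o).
  have sub : S o b \subset S o a :|: (S o b :|: S o c).
    by apply/subsetP => x xb; rewrite !inE xb orbT.
  by split; apply: depends_sub sub _ => //; rewrite SC.
have dUrr a b c : depends_on (S o a :|: (S o b :|: S o c)) (Z o c) /\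
                 depends_on (S o a :|: (S o b :|: S o c)) (Z c o).
  have sub : S o c \subset S o a :|: (S o b :|: S o c).
    by apply/subsetP => x xb; rewrite !inE xb !orbT.
  by split; apply: depends_sub sub _ => //; rewrite SC.
(* a factor whose column index occurs only once averages to zero *)
have uniq_i : i != j -> i != k -> i != l ->
    fexp w (fun c => (Z o i c * Z j o c) * (Z o k c * Z l o c)) = 0.
  move=> ij ik il.
  rewrite -(fexp_single (F := fun c => Z j o c * (Z o k c * Z l o c)) _ (djU i j k l oi ij ik il)).1.
    by apply: eq_fexp => c; ring.
  by apply: dependsM (dUl _ _ _ j).2 _; apply: dependsM (dUr _ _ _).1 (dUrr _ _ _).2.
have uniq_j : j != i -> j != k -> j != l ->
    fexp w (fun c => (Z o i c * Z j o c) * (Z o k c * Z l o c)) = 0.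
  move=> ij ik il.
  rewrite -(fexp_single (F := fun c => Z o i c * (Z o k c * Z l o c)) _ (djU j i k l oj ij ik il)).2.
    by apply: eq_fexp => c; ring.
  by apply: dependsM (dUl _ _ _ j).1 _; apply: dependsM (dUr _ _ _).1 (dUrr _ _ _).2.
have uniq_k : k != i -> k != j -> k != l ->
    fexp w (fun c => (Z o i c * Z j o c) * (Z o k c * Z l o c)) = 0.
  move=> ij ik il.
  rewrite -(fexp_single (F := fun c => Z o i c * (Z j o c * Z l o c)) _ (djU k i j l ok ij ik il)).1.
    by apply: eq_fexp => c; ring.
  by apply: dependsM (dUl _ _ _ j).1 _; apply: dependsM (dUr _ _ _).2 (dUrr _ _ _).2.
have pairs F G a b : a != b -> o != a -> depends_on (S o a) F -> depends_on (S o b) G ->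
    fexp w (fun c => F c * G c) = fexp w F * fexp w G.
  by move=> ab oa; apply: indepS; rewrite negb_or !negb_and ab orbT (eq_sym a) oa orbT.
have dd a b c : depends_on (S o a) b -> depends_on (S o a) c -> depends_on (S o a) (fun x => b x * c x).
  exact: dependsM.
have ds a b : depends_on (S o a) b -> depends_on (S o a) (fun x => b x ^+ 2).
  by move=> db x y xy; rewrite (db _ _ xy).
have d1 a : depends_on (S o a) (Z o a) by [].
have d2 a : depends_on (S o a) (Z a o) by rewrite SC.
case: (eqVneq i j) => [eij|ij] /=.
  subst j; case: (eqVneq k l) => [ekl|kl] /=.
    subst l; rewrite andbb; case: (eqVneq i k) => [eik|ik] /=.
      subst k; rewrite mulr1 -(Zo22 oi); apply: eq_fexp => c; ring.
    by rewrite (pairs _ _ i k) ?Zo11 //; [ring | exact: dd | exact: dd].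
  rewrite mulr0 addr0 add0r.
  case: (eqVneq i l) => [eil|il] /=; last first.
    case: (eqVneq k i) => [eki|ki]; last by rewrite uniq_k.
    subst k; rewrite mulr0n -(fexp_single (o := o) (i := l) (F := fun c => Z o i c * (Z i o c * Z o i c)) (J := S o i) _ _).2.
    - by apply: eq_fexp => c; ring.
    - by apply: (dd); [| apply: dd].
    - by apply: dj => //; rewrite eq_sym.
  subst l; rewrite eq_sym (negbTE kl) mulr0n -(fexp_single (o := o) (i := k) (F := fun c => Z o i c * (Z i o c * Z i o c)) (J := S o i) _ _).1.
  - by apply: eq_fexp => c; ring.
  - by apply: (dd); [| apply: dd].
  - exact: dj.
rewrite mulr0 addr0 add0r; case: (eqVneq i l) => [eil|il] /=; last first.
  case: (eqVneq i k) => [eik|ik]; last by rewrite uniq_i.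
  subst k; case: (eqVneq j l) => [ejl|jl]; last by rewrite uniq_j // eq_sym.
  (* Matching i = k and j = l pairs entries of the same orientation, whose mean square is 0 by
     [Zo2]; hence only two of the three pairings survive. *)
  subst l; transitivity (fexp w (fun c => Z o i c ^+ 2 * Z j o c ^+ 2)).
    by apply: eq_fexp => c; ring.
  have jo : j != o by rewrite eq_sym.
  by rewrite (pairs _ _ i j) ?Zo2 ?mul0r //; exact: ds.
subst l; case: (eqVneq j k) => [ejk|jk].
  subst k; transitivity (fexp w (fun c => (Z o i c * Z i o c) * (Z o j c * Z j o c))).
    by apply: eq_fexp => c; ring.
  by rewrite (pairs _ _ i j) ?Zo11 ?mul1r //; exact: dd.
case: (eqVneq k i) => [eki|ki]; last by rewrite uniq_k // eq_sym.
by subst k; rewrite uniq_j // eq_sym.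
Qed.

(** Rows and columns are selected by a map [g] rather than by truncation, because the recursion
    strikes out first one index and then, in the cumulant term, an arbitrary second one. *)
Definition submodel m (g : 'I_m -> 'I_n) (c : Om) : 'M[C]_m :=
  \matrix_(i, j) Z (g i) (g j) c.

Let wB (k : K) (a : A) : B := polyc (w k a).

Let wB1 k : \sum_a wB k a = 1.
Proof. by rewrite -raddf_sum /= w1 rmorph1. Qed.

Let indepB := fexp_indep wB1.

Lemma fexp_polyc (F : Om -> C) : fexp wB (fun c => polyc (F c)) = polyc (fexp w F).
Proof.
rewrite /fexp raddf_sum /=; apply: eq_bigr => c _.
by rewrite rmorphM rmorph_prod.
Qed.

Definition corr2 m (g : 'I_m -> 'I_n) : B := fexp wB (fun c =>
  polyl (char_poly (submodel g c)) * polyr (char_poly (submodel g c))).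

Lemma submodel_bordered m (g : 'I_m.+1 -> 'I_n) c :
  submodel g c = block_mx (Z (g ord0) (g ord0) c)%:M
    (\row_j Z (g ord0) (g (lift ord0 j)) c) (\col_i Z (g (lift ord0 i)) (g ord0) c)
    (submodel (g \o lift ord0) c) :> 'M[C]_(1 + m).
Proof.
have l0 (i : 'I_1) : lshift m i = ord0 by apply: val_inj; rewrite ord1.
have r0 (i : 'I_m) : rshift 1 i = lift ord0 i by apply: val_inj.
rewrite -[LHS](@submxK _ 1 m 1 m); congr block_mx; apply/matrixP => i j;
  by rewrite !mxE ?l0 ?r0 // (ord1 i) (ord1 j) eqxx mulr1n.
Qed.

Lemma sum_delta (T : finType) (f : T -> B) i : \sum_j (i == j)%:R * f j = f i.
Proof.
rewrite (bigD1 i) //= eqxx mul1r big1 ?addr0 // => j /negbTE ji.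
by rewrite eq_sym ji mul0r.
Qed.

Lemma sum_delta2 (T : finType) (f : T -> T -> B) :
  \sum_i \sum_j (i == j)%:R * f i j = \sum_i f i i.
Proof. by apply: eq_bigr => i _; rewrite sum_delta. Qed.

Lemma sum_delta_pairs (T : finType) (f : T -> T -> T -> T -> B) (k : B) :
  \sum_i \sum_j \sum_p \sum_q
    (((i == j) && (p == q))%:R + ((i == q) && (j == p))%:R
     + k * ((i == j) && (p == q) && (i == q))%:R) * f i j p q =
  \sum_i \sum_p f i i p p + \sum_i \sum_j f i j j i + k * \sum_i f i i i i.
Proof.
rewrite mulr_sumr -!big_split; apply: eq_bigr => i _ /=.
transitivity (\sum_j (i == j)%:R * (\sum_p f i j p p + k * f i j i i) + \sum_j f i j j i);
  last by rewrite sum_delta; ring.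
rewrite -big_split; apply: eq_bigr => j _ /=.
transitivity (\sum_p ((i == j)%:R * (f i j p p + k * ((i == p)%:R * f i j p p)) + (j == p)%:R * f i j p i));
  last by rewrite big_split /= -big_distrr sum_delta big_split /= -big_distrr /= sum_delta.
apply: eq_bigr => p _.
rewrite -(sum_delta (fun q => f i j p q + k * ((i == q)%:R * f i j p q)) p).
rewrite -(sum_delta (f i j p) i) !big_distrr -big_split /=.
apply: eq_bigr => q _.
by rewrite -!mulnb !natrM; ring.
Qed.

Lemma rmorph_bordered (I : finType) (f : {rmorphism {poly C} -> B})
    (fC : forall a, f a%:P = polyc a) (z : C) (x : {poly C})
    (r : I -> I -> C) (a : I -> I -> {poly C}) :
  f (('X - z%:P) * x - \sum_i \sum_j (r i j)%:P * a i j) =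
  (f 'X - polyc z) * f x - \sum_i \sum_j polyc (r i j) * f (a i j).
Proof.
rewrite rmorphB rmorphM rmorphB fC rmorph_sum; congr (_ - _).
apply: eq_bigr => i _; rewrite rmorph_sum; apply: eq_bigr => j _.
by rewrite rmorphM fC.
Qed.

Section Recursion.
Variables (m : nat) (g : 'I_m.+1 -> 'I_n).
Hypothesis g_inj : injective g.
Let o := g ord0.
Let h := g \o lift ord0.
Let J : {set K} := \bigcup_j S o (g j).

Let oh i : o != h i.
Proof. by rewrite (inj_eq g_inj) neq_lift. Qed.

(** [J] collects all coordinates of the bordering row and column, and those of the minor are
    disjoint from it; this makes the minor independent of the border. *)
Let dep_sub : forall c d : Om, {in ~: J, c =1 d} -> submodel h c = submodel h d.
Proof.
move=> c d cd; apply/matrixP => i j; rewrite !mxE; apply: Z_dep => k kS.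
apply: cd; rewrite inE; apply/bigcupP => -[l _ kl].
have : [disjoint S (h i) (h j) & S o (g l)].
  by apply: S_disj; rewrite ![_ == o]eq_sym !(negbTE (oh _)) andbF.
by move=> /disjoint_setI0/setP/(_ k); rewrite !inE kS kl.
Qed.

Let dep_fun (T : Type) (F : 'M[C]_m -> T) (c d : Om) : {in ~: J, c =1 d} ->
  F (submodel h c) = F (submodel h d).
Proof. by move=> cd; rewrite (dep_sub cd). Qed.

Let dep_row j : depends_on J (Z o (g j)) /\ depends_on J (Z (g j) o).
Proof.
by split; apply: depends_sub (bigcup_sup j isT) _; rewrite // SC.
Qed.

Let rho i j c := Z o (h i) c * Z (h j) o c.
Let z c := Z o o c.
Let adj i j c := \adj (char_poly_mx (submodel h c)) i j.
Let chi c := char_poly (submodel h c).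

Let dep_rho i j : depends_on J (fun c => polyc (rho i j c)).
Proof.
move=> c d cd; congr (polyc _); apply: dependsM cd; first exact: (dep_row _).1.
exact: (dep_row _).2.
Qed.

Let dep_z : depends_on J (fun c => polyc (z c)).
Proof. by move=> c d cd; congr (polyc _); apply: (dep_row ord0).1. Qed.

Let E_z : fexp wB (fun c => polyc (z c)) = 0.
Proof. by rewrite fexp_polyc Z1 rmorph0. Qed.

Let E_rho i j : fexp wB (fun c => polyc (rho i j c)) = (i == j)%:R.
Proof.
rewrite fexp_polyc fexp_row2 ?oh // rmorph_nat.
by rewrite (inj_eq (inj_comp g_inj lift_inj)).
Qed.

Let E_zrho i j : fexp wB (fun c => polyc (z c) * polyc (rho i j c)) = 0.
Proof.
have -> : fexp wB (fun c => polyc (z c) * polyc (rho i j c)) =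
    polyc (fexp w (fun c => z c * rho i j c)).
  by rewrite -fexp_polyc; apply: eq_fexp => c; rewrite [RHS]rmorphM.
rewrite (@fexp_single o o (rho i j) (S o (h i) :|: S o (h j)) _ _).1 ?rmorph0 //.
  by apply: dependsM; have [] := depends_pair o (h i) (h j).
rewrite -setI_eq0 setIUr !(disjoint_setI0 (S_disj _)) ?setU0 //.
  by rewrite eqxx (negbTE (oh _)) andbF.
by rewrite eqxx (negbTE (oh _)) andbF.
Qed.

Let E_rho2 i j p q : fexp wB (fun c => polyc (rho i j c) * polyc (rho p q c)) =
  ((i == j) && (p == q))%:R + ((i == q) && (j == p))%:R
   + polyc kappa * ((i == j) && (p == q) && (i == q))%:R.
Proof.
have -> : fexp wB (fun c => polyc (rho i j c) * polyc (rho p q c)) =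
    polyc (fexp w (fun c => rho i j c * rho p q c)).
  by rewrite -fexp_polyc; apply: eq_fexp => c; rewrite [RHS]rmorphM.
rewrite fexp_row4 ?oh // !rmorphD rmorphM !rmorph_nat.
by rewrite !(inj_eq (inj_comp g_inj lift_inj)).
Qed.

Let mu : B := polyl 'X.
Let nu : B := polyr 'X.

Let E_zz : fexp wB (fun c => (mu - polyc (z c)) * (nu - polyc (z c))) = mu * nu + 1.
Proof.
transitivity (fexp wB (fun c => mu * nu + (polyc (z c ^+ 2) - (mu + nu) * polyc (z c)))).
  by apply: eq_fexp => c; rewrite rmorphXn /=; ring.
by rewrite fexpD fexp_cst // fexpB fexpZ E_z fexp_polyc Zd2 rmorph1; ring.
Qed.

Let E_tz (t : B) i j :
  fexp wB (fun c => (t - polyc (z c)) * polyc (rho i j c)) = (i == j)%:R * t.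
Proof.
transitivity (fexp wB (fun c => t * polyc (rho i j c) - polyc (z c) * polyc (rho i j c))).
  by apply: eq_fexp => c; ring.
by rewrite fexpB fexpZ E_rho E_zrho; ring.
Qed.

(** Both characteristic polynomials are expanded along the border and averaged over it, the minor
    being independent. One border product leaves the trace of an adjugate; two of them leave, by
    Wick's rule, a product of traces, the trace of a product, and a diagonal sum weighted by
    [kappa]. *)
Lemma corr2_expand : corr2 g =
  (mu * nu + 1) * fexp wB (fun c => polyl (chi c) * polyr (chi c))
  - mu * fexp wB (fun c => polyl (chi c) * polyr (\sum_i adj i i c))
  - nu * fexp wB (fun c => polyl (\sum_i adj i i c) * polyr (chi c))
  + fexp wB (fun c => polyl (\sum_i adj i i c) * polyr (\sum_i adj i i c))
  + fexp wB (fun c => \sum_i \sum_j polyl (adj i j c) * polyr (adj j i c))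
  + polyc kappa * \sum_i fexp wB (fun c => polyl (adj i i c) * polyr (adj i i c)).
Proof.
transitivity (fexp wB (fun c =>
  ((mu - polyc (z c)) * (nu - polyc (z c))) * (polyl (chi c) * polyr (chi c))
  - \sum_i \sum_j ((mu - polyc (z c)) * polyc (rho i j c)) * (polyl (chi c) * polyr (adj i j c))
  - \sum_i \sum_j ((nu - polyc (z c)) * polyc (rho i j c)) * (polyl (adj i j c) * polyr (chi c))
  + \sum_i \sum_j \sum_p \sum_q (polyc (rho i j c) * polyc (rho p q c)) *
      (polyl (adj i j c) * polyr (adj p q c)))).
  apply: eq_fexp => c.
  have pl : char_poly (submodel g c) = ('X - (z c)%:P) * chi c
      - \sum_i \sum_j (rho i j c)%:P * adj i j c.
    rewrite submodel_bordered char_poly_bordered; congr (_ - _).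
    by apply: eq_bigr => i _; apply: eq_bigr => j _; congr (_%:P * _); rewrite !mxE.
  have -> : polyl (char_poly (submodel g c)) = (mu - polyc (z c)) * polyl (chi c)
      - \sum_i \sum_j polyc (rho i j c) * polyl (adj i j c).
    by rewrite pl (rmorph_bordered polylC (z c) (chi c) (fun i j => rho i j c) (fun i j => adj i j c)).
  have -> : polyr (char_poly (submodel g c)) = (nu - polyc (z c)) * polyr (chi c)
      - \sum_i \sum_j polyc (rho i j c) * polyr (adj i j c).
    by rewrite pl (rmorph_bordered polyrC (z c) (chi c) (fun i j => rho i j c) (fun i j => adj i j c)).
  set P := \sum_i \sum_j polyc (rho i j c) * polyl _.
  set Q := \sum_i \sum_j polyc (rho i j c) * polyr _.
  have -> : \sum_i \sum_j ((mu - polyc (z c)) * polyc (rho i j c)) * (polyl (chi c) * polyr (adj i j c))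
      = (mu - polyc (z c)) * polyl (chi c) * Q.
    rewrite /Q big_distrr; apply: eq_bigr => i _; rewrite big_distrr; apply: eq_bigr => j _ /=; ring.
  have -> : \sum_i \sum_j ((nu - polyc (z c)) * polyc (rho i j c)) * (polyl (adj i j c) * polyr (chi c))
      = (nu - polyc (z c)) * polyr (chi c) * P.
    rewrite /P big_distrr; apply: eq_bigr => i _; rewrite big_distrr; apply: eq_bigr => j _ /=; ring.
  have -> : \sum_i \sum_j \sum_p \sum_q (polyc (rho i j c) * polyc (rho p q c)) *
      (polyl (adj i j c) * polyr (adj p q c)) = P * Q.
    rewrite /P big_distrl; apply: eq_bigr => i _; rewrite big_distrl; apply: eq_bigr => j _.
    rewrite /Q big_distrr; apply: eq_bigr => p _; rewrite big_distrr; apply: eq_bigr => q _ /=; ring.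
  ring.
rewrite fexpD fexpB fexpB.
have dz (t : B) : depends_on J (fun c => t - polyc (z c)).
  by apply: dependsD; [|apply: dependsN].
have -> : fexp wB (fun c => ((mu - polyc (z c)) * (nu - polyc (z c))) *
    (polyl (chi c) * polyr (chi c))) =
    (mu * nu + 1) * fexp wB (fun c => polyl (chi c) * polyr (chi c)).
  have dG := dep_fun (fun M => polyl (char_poly M) * polyr (char_poly M)).
  by rewrite (indepB (dependsM (dz mu) (dz nu)) dG) E_zz.
have -> : fexp wB (fun c => \sum_i \sum_j ((mu - polyc (z c)) * polyc (rho i j c)) *
    (polyl (chi c) * polyr (adj i j c))) =
    mu * fexp wB (fun c => polyl (chi c) * polyr (\sum_i adj i i c)).
  transitivity (\sum_i \sum_j (i == j)%:R *
      (mu * fexp wB (fun c => polyl (chi c) * polyr (adj i j c)))).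
    rewrite fexp_sum; apply: eq_bigr => i _; rewrite fexp_sum; apply: eq_bigr => j _.
    have dG := dep_fun (fun M => polyl (char_poly M) * polyr (\adj (char_poly_mx M) i j)).
    by rewrite (indepB (dependsM (dz mu) (@dep_rho i j)) dG) E_tz mulrA.
  rewrite sum_delta2 -big_distrr -fexp_sum /=; congr (_ * _).
  by apply: eq_fexp => c; rewrite (raddf_sum polyr) big_distrr.
have -> : fexp wB (fun c => \sum_i \sum_j ((nu - polyc (z c)) * polyc (rho i j c)) *
    (polyl (adj i j c) * polyr (chi c))) =
    nu * fexp wB (fun c => polyl (\sum_i adj i i c) * polyr (chi c)).
  transitivity (\sum_i \sum_j (i == j)%:R *
      (nu * fexp wB (fun c => polyl (adj i j c) * polyr (chi c)))).
    rewrite fexp_sum; apply: eq_bigr => i _; rewrite fexp_sum; apply: eq_bigr => j _.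
    have dG := dep_fun (fun M => polyl (\adj (char_poly_mx M) i j) * polyr (char_poly M)).
    by rewrite (indepB (dependsM (dz nu) (@dep_rho i j)) dG) E_tz mulrA.
  rewrite sum_delta2 -big_distrr -fexp_sum /=; congr (_ * _).
  by apply: eq_fexp => c; rewrite (raddf_sum polyl) big_distrl.
(* What is left is the fourfold sum over two border products, which splits into the last three
   terms. *)
rewrite -!addrA; congr (_ + (_ + (_ + _))); rewrite addrA.
pose X i j p q := fexp wB (fun c => polyl (adj i j c) * polyr (adj p q c)).
transitivity (\sum_i \sum_j \sum_p \sum_q
    (((i == j) && (p == q))%:R + ((i == q) && (j == p))%:R
     + polyc kappa * ((i == j) && (p == q) && (i == q))%:R) * X i j p q).
  rewrite fexp_sum; apply: eq_bigr => i _; rewrite fexp_sum; apply: eq_bigr => j _.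
  rewrite fexp_sum; apply: eq_bigr => p _; rewrite fexp_sum; apply: eq_bigr => q _.
  have dG := dep_fun (fun M =>
    polyl (\adj (char_poly_mx M) i j) * polyr (\adj (char_poly_mx M) p q)).
  by rewrite (indepB (dependsM (@dep_rho i j) (@dep_rho p q)) dG) E_rho2.
rewrite sum_delta_pairs; congr (_ + _ + _).
  transitivity (fexp wB (fun c => \sum_i \sum_j polyl (adj i i c) * polyr (adj j j c))).
    by rewrite fexp_sum; apply: eq_bigr => i _; rewrite fexp_sum.
  apply: eq_fexp => c; rewrite (raddf_sum polyl) (raddf_sum polyr) big_distrl.
  by apply: eq_bigr => i _; rewrite big_distrr.
by rewrite fexp_sum; apply: eq_bigr => i _; rewrite fexp_sum.
Qed.

(** Jacobi's formula under the expectation: it identifies the traces of adjugates in [corr2_expand]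
    with derivatives of the correlation one size below. *)
Lemma derr_corr2 : derr (corr2 h) =
  fexp wB (fun c => polyl (chi c) * polyr (\sum_i adj i i c)).
Proof.
rewrite /corr2 /fexp raddf_sum; apply: eq_bigr => c _ /=.
by rewrite -rmorph_prod derrZ derrE deriv_char_poly.
Qed.

Lemma derl_corr2 : derl (corr2 h) =
  fexp wB (fun c => polyl (\sum_i adj i i c) * polyr (chi c)).
Proof.
rewrite /corr2 /fexp raddf_sum; apply: eq_bigr => c _ /=.
by rewrite -rmorph_prod derlZ derlE deriv_char_poly.
Qed.

Lemma derlr_corr2 : derl (derr (corr2 h)) =
  fexp wB (fun c => polyl (\sum_i adj i i c) * polyr (\sum_i adj i i c)).
Proof.
rewrite derr_corr2 /fexp raddf_sum; apply: eq_bigr => c _ /=.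
by rewrite -rmorph_prod derlZ derlE deriv_char_poly.
Qed.

(* The resolvent identity turns the trace of the product of the two adjugates
   into a difference of derivatives. *)
Lemma fexp_adj_prod : (mu - nu) *
  fexp wB (fun c => \sum_i \sum_j polyl (adj i j c) * polyr (adj j i c)) =
  derr (corr2 h) - derl (corr2 h).
Proof.
rewrite derr_corr2 derl_corr2 -fexpZ -fexpB; apply: eq_fexp => c.
pose U := map_mx polyr (char_poly_mx (submodel h c)).
pose V := map_mx polyl (char_poly_mx (submodel h c)).
have UV : V - U = (mu - nu)%:M.
  apply/matrixP => i j; rewrite !mxE !(rmorphB polyl) !(rmorphB polyr) !rmorphMn /=.
  by rewrite polyrC polylC mulrnBl; ring.
have := adj_resolvent UV.
have adjU : \adj U = map_mx polyr (\adj (char_poly_mx (submodel h c))).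
  by rewrite map_mx_adj.
have adjV : \adj V = map_mx polyl (\adj (char_poly_mx (submodel h c))).
  by rewrite map_mx_adj.
rewrite adjU adjV !det_map_mx.
have tr_map (f : {rmorphism {poly C} -> B}) :
    \tr (map_mx f (\adj (char_poly_mx (submodel h c)))) = f (\sum_i adj i i c).
  by rewrite /mxtrace raddf_sum; apply: eq_bigr => i _; rewrite mxE.
rewrite !tr_map => E.
transitivity ((mu - nu) * \tr (map_mx polyr (\adj (char_poly_mx (submodel h c))) *m
   map_mx polyl (\adj (char_poly_mx (submodel h c))))).
  congr (_ * _); rewrite exchange_big; apply: eq_bigr => i _; rewrite !mxE.
  by apply: eq_bigr => j _; rewrite [X in _ = X * _]mxE [X in _ = _ * X]mxE mulrC.
by rewrite E; ring.
Qed.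

Lemma corr2_rec : (mu - nu) * corr2 g = stepop polyl polyr derl derr (corr2 h)
  + (mu - nu) * (polyc kappa *
      \sum_i fexp wB (fun c => polyl (adj i i c) * polyr (adj i i c))).
Proof.
rewrite corr2_expand -derr_corr2 -derl_corr2 -derlr_corr2 -/(corr2 h) /stepop.
by rewrite -fexp_adj_prod; ring.
Qed.

End Recursion.

Lemma corr2_0 (g : 'I_0 -> 'I_n) : corr2 g = 1.
Proof.
rewrite /corr2 -[RHS](fexp_cst wB1); apply: eq_fexp => c.
by rewrite /char_poly det_mx00 (rmorph1 polyl) (rmorph1 polyr) mulr1.
Qed.

(** Diagonal cofactors of a characteristic matrix belong to principal submatrices; this closes the
    recursion, the cumulant term becoming a sum of correlations two sizes below. *)
Lemma adj_char_poly_mx m (g : 'I_m.+1 -> 'I_n) i c :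
  \adj (char_poly_mx (submodel g c)) i i = char_poly (submodel (g \o lift i) c).
Proof.
rewrite mxE /cofactor addnn -signr_odd odd_double expr0 mul1r.
rewrite row'_col'_char_poly_mx; congr char_poly.
by apply/matrixP => a b; rewrite !mxE.
Qed.

(** Strong induction, with sizes 0 and 1 as base cases because the recursion is of second order.
    Since the value does not depend on [g], the cumulant term consists of m + 1 equal summands,
    which turn m! into (m + 1)!; matching [kappa] with [2 * beta] gives the parameter
    [kappa / 2]. *)
Lemma corr2E m (g : 'I_m -> 'I_n) : injective g ->
  corr2 g = m`!%:R * corr_sum polyl polyr polyc (kappa / 2) m.
Proof.
elim/ltn_ind: m g => -[|[|m]] IH g g_inj.
- by rewrite corr2_0 corr_sum0 mulr1.
- apply: lreg_diff; rewrite corr2_rec // big_ord0 !mulr0 addr0.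
  rewrite corr2_0 corr_sum1 mul1r /stepop.
  have -> : derr 1 = 0.
    by rewrite -[1]mulr1 -{1}(rmorph1 polyl) -(rmorph1 polyr) derrE derivC rmorph0 mulr0.
  have -> : derl 1 = 0.
    by rewrite -[1]mulr1 -{1}(rmorph1 polyl) -(rmorph1 polyr) derlE derivC rmorph0 mul0r.
  by rewrite raddf0; ring.
apply: lreg_diff; rewrite corr2_rec //.
have h_inj : injective (g \o lift ord0) by move=> a b /g_inj; apply: lift_inj.
rewrite IH // (eq_bigr (fun=> m`!%:R * corr_sum polyl polyr polyc (kappa / 2) m)); last first.
  move=> i _; rewrite -(IH m _ (g \o lift ord0 \o lift i)) //; last by move=> a b /h_inj; apply: lift_inj.
  by apply: eq_fexp => c; rewrite !adj_char_poly_mx.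
have rec := corr_sum_rec polylC polyrC derrE derlE derrZ derlZ (kappa / 2) m.
have -> : (m.+1`!%:R : B) = polyc m.+1`!%:R by rewrite rmorph_nat.
rewrite (stepopZ _ _ derrZ derlZ) rmorph_nat sumr_const card_ord.
have -> : (m`!%:R * corr_sum polyl polyr polyc (kappa / 2) m) *+ m.+1 =
    m.+1`!%:R * corr_sum polyl polyr polyc (kappa / 2) m.
  by rewrite -[LHS]mulr_natl factS natrM mulrA.
have -> : (m.+2`!%:R : B) = m.+1`!%:R * m.+2%:R by rewrite factS natrM mulrC.
rewrite -[in RHS]mulrA [RHS]mulrCA rec.
have -> : 2 * (kappa / 2) = kappa by rewrite mulrC divfK ?pnatr_eq0.
by ring.
Qed.

End HermitianModel.

Section EvalCorr.
Variable C : numFieldType.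
Notation B := {poly {poly C}}.

(** The abstract ring is realised by polynomials in nu whose coefficients are polynomials in mu:
    [polyl] lands in the coefficients, [polyr] in the outer variable. The derivation in the inner
    variable is obtained by swapping the two. *)
Definition polyl (p : {poly C}) : B := p%:P.
Definition polyr (p : {poly C}) : B := p^:P.
Definition polyc (a : C) : B := a%:P%:P.

HB.instance Definition _ := GRing.RMorphism.copy polyl (@polyC {poly C}).
HB.instance Definition _ := GRing.RMorphism.copy polyr (map_poly (@polyC C)).
HB.instance Definition _ := GRing.RMorphism.copy polyc
  (@polyC {poly C} \o @polyC C).

Definition derl (f : B) : B := swapXY (swapXY f)^`().
Definition derr (f : B) : B := f^`().

Lemma derr_is_zmod : zmod_morphism derr.
Proof. by move=> p q; rewrite /derr derivB. Qed.
HB.instance Definition _ := GRing.isZmodMorphism.Build _ _ derr derr_is_zmod.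

Lemma derl_is_zmod : zmod_morphism derl.
Proof. by move=> p q; rewrite /derl !(raddfB swapXY, derivB). Qed.
HB.instance Definition _ := GRing.isZmodMorphism.Build _ _ derl derl_is_zmod.

Lemma polylC a : polyl a%:P = polyc a. Proof. by []. Qed.

Lemma polyrC a : polyr a%:P = polyc a. Proof. by rewrite /polyr map_polyC. Qed.

Lemma derrE p q : derr (polyl p * polyr q) = polyl p * polyr q^`().
Proof. by rewrite /derr /polyl /polyr deriv_mulC deriv_map. Qed.

Lemma derlE p q : derl (polyl p * polyr q) = polyl p^`() * polyr q.
Proof.
rewrite /derl /polyl /polyr rmorphM /= swapXY_polyC swapXY_map_polyC.
by rewrite mulrC deriv_mulC deriv_map rmorphM /= swapXY_polyC swapXY_map_polyC mulrC.
Qed.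

Lemma derrZ a f : derr (polyc a * f) = polyc a * derr f.
Proof. by rewrite /derr /polyc deriv_mulC. Qed.

Lemma derlZ a f : derl (polyc a * f) = polyc a * derl f.
Proof.
rewrite /derl /polyc rmorphM /= swapXY_polyC map_polyC deriv_mulC rmorphM /=.
by rewrite swapXY_polyC map_polyC.
Qed.

Lemma lreg_diff : GRing.lreg (polyl 'X - polyr 'X).
Proof.
apply/mulfI; rewrite subr_eq0 /polyl /polyr map_polyX.
apply/eqP => /(congr1 (fun p : B => size p)).
by rewrite size_polyX size_polyC polyX_eq0.
Qed.

Variables x y : C.
Let ev (f : B) : C := f.[y%:P].[x].
HB.instance Definition _ := GRing.RMorphism.copy ev
  (horner_eval x \o horner_eval y%:P).

Let ev_polyl p : ev (polyl p) = p.[x].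
Proof. by rewrite /ev /polyl hornerC. Qed.

Let ev_polyr p : ev (polyr p) = p.[y].
Proof. by rewrite /ev /polyr horner_map hornerC. Qed.

Let ev_polyc a : ev (polyc a) = a.
Proof. by rewrite /ev /polyc !hornerC. Qed.

Definition hermite_kernel (m : nat) : C :=
  \sum_(j < m.+1) (hermite C j).[x] * (hermite C j).[y] / j`!%:R.

Let ev_hkernel m : ev (hkernel (@polyl) (@polyr) (@polyc) m) = hermite_kernel m.
Proof.
rewrite /hkernel rmorph_sum; apply: eq_bigr => j _.
by rewrite /herm2 !rmorphM /= ev_polyc ev_polyl ev_polyr mulrC.
Qed.

Let ev_corr_sum beta m : ev (corr_sum (@polyl) (@polyr) (@polyc) beta m) =
  \sum_(k < m.+1 | (k.*2 <= m)%N) beta ^+ k / k`!%:R * hermite_kernel (m - k.*2).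
Proof.
rewrite /corr_sum rmorph_sum [RHS]big_mkcond; apply: eq_bigr => k _.
rewrite /corr_term; case: ifP => _; last by rewrite rmorph0.
by rewrite [LHS]rmorphM /= ev_polyc ev_hkernel.
Qed.

(** The identity [corr2E] evaluated at numbers. This covers [x = y], since mu - nu was cancelled
    among polynomials. *)
Lemma fexp_char_poly2 (K A : finType) (w : K -> A -> C) (n : nat)
    (S : 'I_n -> 'I_n -> {set K}) (Z : 'I_n -> 'I_n -> {ffun K -> A} -> C) (kappa : C) :
  (forall k, \sum_a w k a = 1) ->
  (forall i j, S i j = S j i) ->
  (forall i j k l, ~~ ((i == k) && (j == l) || (i == l) && (j == k)) ->
    [disjoint S i j & S k l]) ->
  (forall i j, depends_on (S i j) (Z i j)) ->
  (forall i j, fexp w (Z i j) = 0) ->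
  (forall i, fexp w (fun c => Z i i c ^+ 2) = 1) ->
  (forall i j, i != j -> fexp w (fun c => Z i j c ^+ 2) = 0) ->
  (forall i j, i != j -> fexp w (fun c => Z i j c * Z j i c) = 1) ->
  (forall i j, i != j -> fexp w (fun c => (Z i j c * Z j i c) ^+ 2) = 2 + kappa) ->
  fexp w (fun c => (char_poly (\matrix_(i, j) Z i j c)).[x] *
                   (char_poly (\matrix_(i, j) Z i j c)).[y]) =
  n`!%:R * \sum_(k < n.+1 | (k.*2 <= n)%N)
    (kappa / 2) ^+ k / k`!%:R * hermite_kernel (n - k.*2).
Proof.
move=> w1 SC Sd Zd Z1 Zd2 Zo2 Zo11 Zo22.
have /(congr1 ev) := corr2E polylC polyrC derrE derlE derrZ derlZ lreg_diff w1 SC Sd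
  Zd Z1 Zd2 Zo2 Zo11 Zo22 (@inj_id 'I_n).
rewrite rmorphM rmorph_nat /= ev_corr_sum => <-.
rewrite /corr2 /fexp rmorph_sum; apply: eq_bigr => c _.
rewrite rmorphM rmorph_prod /=; congr (_ * _).
  by apply: eq_bigr => k _; rewrite ev_polyc.
by rewrite rmorphM /= ev_polyl ev_polyr.
Qed.

End EvalCorr.

(** * Interpolation at five nodes *)

(** Each Leibniz term takes exactly one entry from every row, so degree bounds for the rows add
    up. *)
Lemma size_det_le (A : comNzRingType) n (M : 'M[{poly A}]_n) (d : 'I_n -> nat) :
  (forall p q, (size (M p q) <= (d p).+1)%N) ->
  (size (\det M) <= (\sum_p d p).+1)%N.
Proof.
move=> sM; apply: leq_trans (size_sum _ _ _) _; apply/bigmax_leqP => s _.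
suff le_prod : (size (\prod_i M i (s i))%R <= (\sum_p d p).+1)%N.
  by rewrite mulr_sign; case: ifP; rewrite ?size_polyN.
apply: leq_trans (size_prod_leq _ _) _.
have le : (\sum_i size (M i (s i)) <= \sum_i (d i).+1)%N by apply: leq_sum.
have e : (\sum_i (d i).+1 = \sum_i d i + n)%N.
  under eq_bigr => i _ do rewrite -addn1.
  by rewrite big_split /= sum1_card card_ord.
by rewrite cardT size_enum_ord; lia.
Qed.

Lemma char_poly_horner (A : comNzRingType) n (M : 'M[A]_n) x :
  (char_poly M).[x] = \det (x%:M - M).
Proof.
rewrite /char_poly -horner_evalE -det_map_mx; congr (\det _).
by apply/matrixP => i j; rewrite !mxE /= horner_evalE !hornerE hornerMn hornerX.
Qed.

Definition upd (K : eqType) (T : Type) (x : K -> T) k t :=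
  fun l => if l == k then t else x l.

(** The nodes are 0, ..., 4. The explicit product makes the real and the complex basis correspond
    under base change ([map_lagr]). *)
Definition lagr (F : fieldType) (a : 'I_5) : {poly F} :=
  let q := \prod_(b < 5 | b != a) ('X - b%:R%:P) in (q.[a%:R]^-1)%:P * q.

Section Lagrange.
Variable F : numFieldType.

Let node (n : nat) : F := n%:R.

Let node_inj : injective node.
Proof. by move=> m n /eqP; rewrite eqr_nat => /eqP. Qed.

Lemma lagr_node (a b : 'I_5) : (lagr F a).[b%:R] = (a == b)%:R.
Proof. by rewrite -(@lagrange_sample F 5 node isT node_inj) lagrangeE. Qed.

Lemma size_lagr a : size (lagr F a) = 5%N.
Proof. by rewrite -(@size_lagrange_ F 5 node isT node_inj a) lagrangeE. Qed.

Lemma lagr_interp (p : {poly F}) : (size p <= 5)%N ->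
  p = \sum_(a < 5) p.[a%:R]%:P * lagr F a.
Proof.
move=> sp; rewrite {1}(@lagrange_gen F 5 node isT node_inj p sp).
by apply: eq_bigr => a _; rewrite lagrangeE.
Qed.
End Lagrange.

Section Interpolation.
Local Open Scope complex_scope.
Variables (R : rcfType) (K : finType).

Lemma map_lagr a : map_poly (real_complex R) (lagr R a) = lagr R[i] a.
Proof.
have e : map_poly (real_complex R) (\prod_(b < 5 | b != a) ('X - b%:R%:P)) =
    \prod_(b < 5 | b != a) ('X - b%:R%:P).
  rewrite rmorph_prod; apply: eq_bigr => b _.
  by rewrite rmorphB /= map_polyX map_polyC /= rmorph_nat.
rewrite /lagr rmorphM /= map_polyC e /= fmorphV; congr (_^-1%:P * _).
by rewrite -e -horner_map /= rmorph_nat.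
Qed.

(** Lagrange interpolation in one variable after another: degree at most 4 in each variable
    separately makes the grid of nodes sufficient. *)
Lemma interpolate (G : (K -> R) -> R[i]) :
  (forall x k, exists2 p : {poly R[i]}, (size p <= 5)%N &
     forall t, G (upd x k t) = p.[t%:C]) ->
  forall x, G x = \sum_(c : {ffun K -> 'I_5})
    (\prod_k (lagr R (c k)).[x k])%:C * G (fun k => (c k)%:R).
Proof.
move=> Gp.
have line x k t : G (upd x k t) = \sum_(a < 5) ((lagr R a).[t])%:C * G (upd x k a%:R).
  have [p sp Gt] := Gp x k; rewrite Gt {1}(lagr_interp sp) horner_sum.
  apply: eq_bigr => a _; rewrite hornerM hornerC Gt mulrC -map_lagr.
  by rewrite horner_map /= rmorph_nat.
(* [s] lists the variables that may lie off the nodes; the induction moves them to nodes one at a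
   time by [line]. *)
have main (s : seq K) x : (forall k, k \notin s -> exists a : 'I_5, x k = a%:R) ->
    G x = \sum_(c : {ffun K -> 'I_5})
      (\prod_k (lagr R (c k)).[x k])%:C * G (fun k => (c k)%:R).
  elim: s x => [|k s IH] x xs.
    (* All variables are at nodes here, so [pick] succeeds and the default [ord0] is never taken;
       only the grid point [c] contributes to the sum. *)
    pose c : {ffun K -> 'I_5} := [ffun k => odflt ord0 [pick a : 'I_5 | x k == a%:R]].
    have xc k : x k = (c k)%:R.
      rewrite ffunE; case: pickP => [a /eqP //|no].
      by have [a xa] := xs k isT; have := no a; rewrite xa eqxx.
    have -> : x = fun k => (c k)%:R by apply: functional_extensionality.
    rewrite (bigD1 c) //= [X in _ + X]big1 ?addr0; last first.
      move=> d dc; have [k dk] : exists k, d k != c k.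
        apply/existsP; rewrite -negb_forall; apply: contra dc => /forallP h.
        by apply/eqP/ffunP => k; apply/eqP.
      by rewrite (bigD1 k) //= lagr_node (negbTE dk) mul0r mul0r.
    by rewrite big1 ?mul1r // => k _; rewrite lagr_node eqxx.
  have xE : x = upd x k (x k).
    by apply: functional_extensionality => l; rewrite /upd; case: eqP => // ->.
  rewrite {1}xE line.
  under eq_bigr => a _.
    rewrite (IH (upd x k a%:R)); last first.
      move=> l ls; rewrite /upd; case: eqP => [_|/eqP lk]; first by exists a.
      by apply: xs; rewrite inE negb_or lk.
    rewrite big_distrr; over.
  rewrite exchange_big /=; apply: eq_bigr => c _.
  under eq_bigr => a _ do rewrite mulrA -rmorphM /=.
  rewrite -big_distrl /= -rmorph_sum /=; congr (_%:C * _).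
  (* After the update, variable [k] sits at node [a], so in the summand of [c] only [a = c k]
     survives. *)
  rewrite (bigD1 (c k)) //= [X in _ + X]big1 ?addr0; last first.
    move=> a ac; rewrite (bigD1 k) //= {1}/upd eqxx lagr_node.
    by rewrite eq_sym (negbTE ac) mul0r mulr0.
  rewrite [RHS](bigD1 k) //=; congr (_ * _).
  rewrite (bigD1 k) //= {1}/upd eqxx lagr_node eqxx mul1r.
  by apply: eq_bigr => l lk; rewrite /upd (negbTE lk).
by move=> x; apply: (main (enum K)) => k; rewrite mem_enum.
Qed.

End Interpolation.

Section WignerEntry.
Local Open Scope complex_scope.
Variable N : nat.
Notation K := (bool * 'I_N * 'I_N)%type.

(** Generic in the ring, with [s] standing for the square root of 2 and [i] for the imaginary unit,
    so that one formula serves for numbers and for polynomials in a single chosen variable. *)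
Definition wigner_entry (B : comNzRingType) (s i : B) (U : K -> B) (p q : 'I_N) : B :=
  if (p < q)%N then U (true, p, q) + i * U (false, p, q)
  else if p == q then s * U (true, p, p)
  else U (true, q, p) - i * U (false, q, p).

Lemma rmorph_wigner_entry (B B' : comNzRingType) (f : {rmorphism B -> B'}) s i U p q :
  f (wigner_entry s i U p q) = wigner_entry (f s) (f i) (fun k => f (U k)) p q.
Proof.
rewrite /wigner_entry; case: ifP => _; last case: ifP => _.
- by rewrite rmorphD rmorphM.
- by rewrite rmorphM.
- by rewrite rmorphB rmorphM.
Qed.

Variable R : rcfType.

Definition wigner_of (x : K -> R) : 'M[R[i]]_N :=
  \matrix_(p, q) wigner_entry (Num.sqrt 2)%:C 'i (fun k => (x k)%:C) p q.

Lemma wigner_of_upd_poly (l : R[i]) (x : K -> R) k : exists2 P : {poly R[i]},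
  (size P <= 3)%N & forall t, (char_poly (wigner_of (upd x k t))).[l] = P.[t%:C].
Proof.
pose U j : {poly R[i]} := if j == k then 'X else (x j)%:C%:P.
pose W : 'M[{poly R[i]}]_N :=
  \matrix_(p, q) wigner_entry (Num.sqrt 2)%:C%:P ('i%C)%:P U p q.
(* [d p] bounds the degree of row [p] in variable [k]; the bounds add up to 2 whether [k] is a
   diagonal index or not. *)
pose d p : nat := ((p == k.1.2) + (p == k.2))%N.
have sU j : (size (U j) <= (j == k).+1)%N.
  by rewrite /U; case: ifP => _; rewrite ?size_polyX ?size_polyC_leq1.
have kd b p q : ((((b, p, q) : K) == k) <= d p)%N /\ ((((b, p, q) : K) == k) <= d q)%N.
  rewrite /d; case: eqP => [<-|_] /=; last by [].
  by split; rewrite !eqxx ?addn1.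
have sC (c : R[i]) (r : {poly R[i]}) m : (size r <= m)%N -> (size (c%:P * r)%R <= m)%N.
  by move=> rm; rewrite mul_polyC; apply: leq_trans (size_scale_leq _ _) rm.
have sW p q : (size (W p q) <= (d p).+1)%N.
  rewrite mxE /wigner_entry; case: ifP => _; last case: ifP => _.
  - apply: leq_trans (size_polyD _ _) _; rewrite geq_max.
    rewrite (leq_trans (sU _)) ?ltnS ?(kd _ _ _).1 //=.
    by apply: sC; rewrite (leq_trans (sU _)) // ltnS (kd _ _ _).1.
  - by apply: sC; rewrite (leq_trans (sU _)) // ltnS (kd _ _ _).1.
  - apply: leq_trans (size_polyD _ _) _; rewrite geq_max size_polyN.
    rewrite (leq_trans (sU _)) ?ltnS ?(kd _ _ _).2 //=.
    by apply: sC; rewrite (leq_trans (sU _)) // ltnS (kd _ _ _).2.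
exists (\det (l%:P%:M - W)).
  have : (size (\det (l%:P%:M - W)) <= (\sum_p d p).+1)%N.
    apply: size_det_le => p q.
    have -> : (l%:P%:M - W) p q = l%:P *+ (p == q) - W p q by rewrite !mxE.
    apply: leq_trans (size_polyD _ _) _; rewrite geq_max size_polyN sW andbT.
    by rewrite -polyCMn; apply: leq_trans (size_polyC_leq1 _) _.
  move/leq_trans; apply; rewrite /d big_split /= ltnS.
  rewrite (bigD1 k.1.2) //= eqxx big1 ?addn0; last by move=> j /negbTE ->.
  by rewrite (bigD1 k.2) //= eqxx big1 // => j /negbTE ->.
move=> t; rewrite char_poly_horner -horner_evalE -det_map_mx; congr (\det _).
apply/matrixP => p q; rewrite !mxE rmorphB rmorphMn /= !horner_evalE hornerC.
congr (_ - _); rewrite -horner_evalE rmorph_wigner_entry /=.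
have -> : (fun j => horner_eval t%:C (U j)) = (fun j => (upd x k t j)%:C).
  apply: functional_extensionality => j; rewrite horner_evalE /U /upd.
  by case: ifP => _; rewrite ?hornerX ?hornerC.
by rewrite !horner_evalE !hornerC.
Qed.

Definition charpoly2 (l l' : R[i]) (x : K -> R) : R[i] :=
  (char_poly (wigner_of x)).[l] * (char_poly (wigner_of x)).[l'].

Lemma charpoly2_interp l l' x : charpoly2 l l' x = \sum_(c : {ffun K -> 'I_5})
    (\prod_k (lagr R (c k)).[x k])%:C * charpoly2 l l' (fun k => (c k)%:R).
Proof.
apply: interpolate => y k.
have [p sp py] := wigner_of_upd_poly l y k.
have [q sq qy] := wigner_of_upd_poly l' y k.
exists (p * q); first by apply: leq_trans (size_polyMleq _ _) _; lia.
by move=> t; rewrite /charpoly2 py qy hornerM.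
Qed.

End WignerEntry.

Lemma map_hermite (R : comNzRingType) (S : comNzRingType) (f : {rmorphism R -> S}) j :
  map_poly f (hermite R j) = hermite S j.
Proof.
suff: map_poly f (hermite R j) = hermite S j /\
      map_poly f (hermite R j.+1) = hermite S j.+1 by case.
elim: j => [|j [IH1 IH2]]; first by rewrite !hermite0 !hermite1 rmorph1 map_polyX.
split=> //; rewrite !hermiteSS rmorphB rmorphM /= map_polyX map_polyZ /= IH1 IH2.
by rewrite rmorph_nat.
Qed.

Lemma real_hermite_kernel (R : rcfType) (x y : R) m :
  hermite_kernel x%:C%C y%:C%C m = (hermite_kernel x y m)%:C%C.
Proof.
rewrite /hermite_kernel rmorph_sum; apply: eq_bigr => j _ /=.
rewrite -!(map_hermite (real_complex R)) !horner_map /=.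
by rewrite fmorph_div rmorphM /= rmorph_nat.
Qed.

Section WignerMoments.
Local Open Scope complex_scope.
Variables (R : rcfType) (N : nat).
Notation K := (bool * 'I_N * 'I_N)%type.
Variables (D : {pred K}) (w : K -> 'I_5 -> R) (Ev : {poly R} -> R) (b : R).
Hypothesis DE : forall k, (k \in D) =
  if k.1.1 then (k.1.2 <= k.2)%N else (k.1.2 < k.2)%N.
Hypothesis wD : forall k, k \in D -> forall p : {poly R}, (size p <= 5)%N ->
  \sum_a w k a * p.[a%:R] = Ev p.
Hypothesis wND : forall k, k \notin D -> \sum_a w k a = 1.
Hypothesis Ev0 : Ev 1 = 1.
Hypothesis Ev1 : Ev 'X = 0.
Hypothesis Ev2 : Ev 'X^2 = 2^-1.
Hypothesis Ev4 : Ev 'X^4 = b.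

Let wC k a : R[i] := (w k a)%:C.
Let U (k : K) (c : {ffun K -> 'I_5}) : R[i] := (c k)%:R.

Let wC1 k : \sum_a wC k a = 1.
Proof.
rewrite -raddf_sum /=; case: (boolP (k \in D)) => kD; last by rewrite wND // rmorph1.
rewrite (eq_bigr (fun a => w k a * (1 : {poly R}).[a%:R])).
  by rewrite wD ?size_poly1 // Ev0 rmorph1.
by move=> a _; rewrite hornerC mulr1.
Qed.

Let E1 k n : k \in D -> (n <= 4)%N ->
  fexp wC (fun c => U k c ^+ n) = (Ev 'X^n)%:C.
Proof.
move=> kD n4; rewrite (fexp_coord wC1 k (fun a : 'I_5 => a%:R ^+ n)).
rewrite -(wD kD) ?size_polyXn // raddf_sum /=; apply: eq_bigr => a _.
by rewrite rmorphM hornerXn rmorphXn /= rmorph_nat.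
Qed.

Let depU k n : depends_on [set k] (fun c => U k c ^+ n).
Proof. by move=> c d cd; rewrite /U cd ?inE. Qed.

Let E2 k l m n : k != l -> k \in D -> l \in D -> (m <= 4)%N -> (n <= 4)%N ->
  fexp wC (fun c => U k c ^+ m * U l c ^+ n) = (Ev 'X^m)%:C * (Ev 'X^n)%:C.
Proof.
move=> kl kD lD m4 n4; rewrite -(E1 kD m4) -(E1 lD n4).
have dl : depends_on (~: [set k]) (fun c => U l c ^+ n).
  by apply: (depends_sub _ (@depU l n)); rewrite sub1set !inE eq_sym.
exact: (fexp_indep wC1 (@depU k m) dl).
Qed.

Let Z i j (c : {ffun K -> 'I_5}) : R[i] :=
  wigner_entry (Num.sqrt 2)%:C 'i (fun k => U k c) i j.

Let keys (i j : 'I_N) : {set K} :=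
  [set k : K | (k.1.2 == i) && (k.2 == j) || (k.1.2 == j) && (k.2 == i)].

Let Z_lt (i j : 'I_N) c : (i < j)%N -> Z i j c = U (true, i, j) c + 'i * U (false, i, j) c
  /\ Z j i c = U (true, i, j) c - 'i * U (false, i, j) c.
Proof.
move=> ij; rewrite /Z /wigner_entry ij ltnNge (ltnW ij) /=; split=> //.
by case: eqP => // ji; rewrite ji ltnn in ij.
Qed.

Let Z_eq i c : Z i i c = (Num.sqrt 2)%:C * U (true, i, i) c.
Proof. by rewrite /Z /wigner_entry ltnn eqxx. Qed.

Let ii : 'i * 'i = -1 :> R[i]. Proof. by rewrite -expr2 sqr_i. Qed.

(** With real and imaginary parts of variance 1/2, |Z_ij|^2 has mean 1 and |Z_ij|^4 has mean 2 b +
    1/2 = 2 + (2 b - 3/2). So [kappa] is 2 b - 3/2, and half of it is the b - 3/4 of the exponent.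
    On the diagonal the factor sqrt 2 restores variance 1. *)
Lemma fexp_charpoly2 (x y : R) :
  fexp wC (fun c => charpoly2 x%:C y%:C (fun k => (c k)%:R)) =
  (N`!%:R * \sum_(k < N.+1 | (k.*2 <= N)%N)
    (b - 3 / 4) ^+ k / k`!%:R * hermite_kernel x y (N - k.*2))%:C.
Proof.
transitivity (fexp wC (fun c => (char_poly (\matrix_(i, j) Z i j c)).[x%:C] *
                   (char_poly (\matrix_(i, j) Z i j c)).[y%:C])).
  apply: eq_fexp => c; rewrite /charpoly2.
  have -> : wigner_of (fun k => (c k)%:R) = \matrix_(i, j) Z i j c; last by [].
  apply/matrixP => i j; rewrite !mxE /Z /wigner_entry /U.
  by rewrite !rmorph_nat.
have ltD (i j : 'I_N) : (i < j)%N -> ((true, i, j) : K) \in D /\ ((false, i, j) : K) \in D.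
  by move=> ij; rewrite !DE /= (ltnW ij) ij.
have eqD (i : 'I_N) : ((true, i, i) : K) \in D by rewrite DE /=.
rewrite (@fexp_char_poly2 _ _ _ _ _ wC N keys Z ((2 * b - 3 / 2)%:C) wC1).
- rewrite rmorphM rmorph_nat /= rmorph_sum; congr (_ * _).
  have kE : (2 * b - 3 / 2)%:C / 2 = (b - 3 / 4)%:C :> R[i].
    have -> : (2 : R[i]) = 2%:C by rewrite rmorph_nat.
    by rewrite -fmorph_div /=; congr (_%:C); field.
  apply: eq_bigr => k _; rewrite kE real_hermite_kernel.
  by rewrite [RHS]rmorphM /= fmorph_div /= rmorph_nat rmorphXn.
- by move=> i j; apply/setP => k; rewrite !inE orbC.
- move=> i j k l; apply: contraR => /pred0Pn[[[b0 p] q]] /=.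
  rewrite !inE /= => /andP[/orP[] /andP[/eqP -> /eqP ->] /orP[] /andP[/eqP -> /eqP ->]];
  by rewrite !eqxx ?orbT.
- move=> i j c d cd; rewrite /Z /wigner_entry /U.
  case: ifP => _; last case: ifP => [/eqP ij|_]; rewrite !cd // !inE /= ?ij ?eqxx ?orbT //.
- move=> i j.
  have half (i' j' : 'I_N) (s : R[i]) : (i' < j')%N ->
      fexp wC (fun c => U (true, i', j') c + s * U (false, i', j') c) = 0.
    move=> ij; have [d1 d2] := ltD _ _ ij.
    rewrite fexpD fexpZ (@E1 (true, i', j') 1) // (@E1 (false, i', j') 1) //.
    by rewrite expr1 Ev1 mulr0 addr0.
  case: (ltngtP i j) => [ij|ji|/val_inj <-].
  + by rewrite -(half i j 'i ij); apply: eq_fexp => c; rewrite (Z_lt c ij).1.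
  + rewrite -(half j i (- 'i) ji); apply: eq_fexp => c.
    by rewrite (Z_lt c ji).2 mulNr.
  + rewrite (eq_fexp _ (G := fun c => (Num.sqrt 2)%:C * U (true, i, i) c ^+ 1)).
      by rewrite fexpZ E1 // expr1 Ev1 mulr0.
    by move=> c; rewrite Z_eq expr1.
- move=> i; rewrite (eq_fexp _ (G := fun c => 2 * U (true, i, i) c ^+ 2)).
    rewrite fexpZ E1 // Ev2.
    have -> : (2 : R[i]) = 2%:C by rewrite rmorph_nat.
    by rewrite -rmorphM /= divff ?rmorph1 // pnatr_eq0.
  move=> c; rewrite Z_eq exprMn -rmorphXn /= sqr_sqrtr //.
  by rewrite rmorph_nat.
- have sq (i' j' : 'I_N) (s : R[i]) : (i' < j')%N -> s * s = -1 ->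
      fexp wC (fun c => (U (true, i', j') c + s * U (false, i', j') c) ^+ 2) = 0.
    move=> ij ss; have [d1 d2] := ltD _ _ ij.
    rewrite (eq_fexp _ (G := fun c => U (true, i', j') c ^+ 2 +
      ((-1) * U (false, i', j') c ^+ 2 +
      2 * s * (U (true, i', j') c ^+ 1 * U (false, i', j') c ^+ 1)))); last first.
      move=> c; rewrite -ss; ring.
    rewrite !fexpD !fexpZ !E1 // E2 // expr1 Ev1 Ev2; ring.
  move=> i j; rewrite neq_ltn => /orP[ij|ji].
  + by rewrite -(sq i j 'i ij ii); apply: eq_fexp => c; rewrite (Z_lt c ij).1.
  + rewrite -(sq j i (- 'i) ji); last by rewrite mulrNN ii.
    by apply: eq_fexp => c; rewrite (Z_lt c ji).2 mulNr.
- have p1 (i' j' : 'I_N) : (i' < j')%N ->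
      fexp wC (fun c => U (true, i', j') c ^+ 2 + U (false, i', j') c ^+ 2) = 1.
    move=> ij; have [d1 d2] := ltD _ _ ij.
    rewrite fexpD !E1 // Ev2 -rmorphD /= -[RHS](rmorph1 (real_complex R)) /=.
    by congr (_%:C); field.
  move=> i j; rewrite neq_ltn => /orP[ij|ji].
  + rewrite -(p1 i j ij); apply: eq_fexp => c; rewrite (Z_lt c ij).1 (Z_lt c ij).2.
    by rewrite mulrC -subr_sqr exprMn expr2 [X in _ - X * _]expr2 ii; ring.
  + rewrite -(p1 j i ji); apply: eq_fexp => c; rewrite (Z_lt c ji).1 (Z_lt c ji).2.
    by rewrite -subr_sqr exprMn expr2 [X in _ - X * _]expr2 ii; ring.
- have p2 (i' j' : 'I_N) : (i' < j')%N ->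
      fexp wC (fun c => (U (true, i', j') c ^+ 2 + U (false, i', j') c ^+ 2) ^+ 2)
      = 2 + (2 * b - 3 / 2)%:C.
    move=> ij; have [d1 d2] := ltD _ _ ij.
    rewrite (eq_fexp _ (G := fun c => U (true, i', j') c ^+ 4 +
      (U (false, i', j') c ^+ 4 +
      2 * (U (true, i', j') c ^+ 2 * U (false, i', j') c ^+ 2)))); last by move=> c; ring.
    rewrite !fexpD fexpZ !E1 // E2 // Ev4 Ev2.
    have -> : (2 : R[i]) = 2%:C by rewrite rmorph_nat.
    by rewrite -!rmorphM -!rmorphD /=; congr (_%:C); field.
  move=> i j; rewrite neq_ltn => /orP[ij|ji].
  + rewrite -(p2 i j ij); apply: eq_fexp => c; rewrite (Z_lt c ij).1 (Z_lt c ij).2; congr (_ ^+ 2).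
    by rewrite mulrC -subr_sqr exprMn [X in _ - X * _]expr2 ii; ring.
  + rewrite -(p2 j i ji); apply: eq_fexp => c; rewrite (Z_lt c ji).1 (Z_lt c ji).2; congr (_ ^+ 2).
    by rewrite -subr_sqr exprMn [X in _ - X * _]expr2 ii; ring.
Qed.

End WignerMoments.

(* Imported only here: the classical sets would shadow the finite set lemmas used above. *)
From mathcomp Require Import all_classical all_reals all_analysis.
From mathcomp Require Import measurable_realfun.

Import numFieldNormedType.Exports.

Local Open Scope classical_set_scope.
Local Open Scope ring_scope.

(** * Moments of independent random variables *)

Section IndepExtend.
Local Open Scope ereal_scope.
Context d (T : measurableType d) (R : realType) (P : {measure set T -> \bar R}).
Variables (Y : T -> R) (X : T -> R) (c : R).
Hypothesis mY : measurable_fun setT Y.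
Hypothesis mX : measurable_fun setT X.
Hypothesis Y0 : forall w, (0 <= Y w)%R.
Hypothesis c0 : (0 <= c)%R.
Hypothesis YX : forall A : set R, measurable A ->
  \int[P]_w (Y w * \1_A (X w))%:E = c%:E * P (X @^-1` A).

Import HBNNSimple.

(** [YX] is the case of indicators; linearity extends it to simple functions and monotone
    convergence to nonnegative measurable [h]. *)
Lemma integral_extend (h : R -> R) : measurable_fun setT h -> (forall x, 0 <= h x)%R ->
  \int[P]_w (Y w * h (X w))%:E = c%:E * \int[P]_w (h (X w))%:E.
Proof.
move=> mh h0.
have mEh : measurable_fun [set: R] (fun x : R => (h x)%:E) by exact/measurable_EFinP.
pose g := nnsfun_approx measurableT mEh.
have gcvg x : (EFin \o g^~ x) n @[n --> \oo] --> (h x)%:E.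
  by apply: cvg_nnsfun_approx => // y _; rewrite lee_fin.
have gnd : nondecreasing_seq (g : (R -> R)^nat) by exact: nd_nnsfun_approx.
have mgX n : measurable_fun setT (fun w => g n (X w)).
  exact: (measurableT_comp (@measurable_funPT _ _ _ _ (g n)) mX).
have mind (A : set R) : measurable A -> measurable_fun setT (fun w => \1_A (X w) : R).
  move=> mA; apply: (measurableT_comp (measurable_indic mA) mX).
have simple n : \int[P]_w (Y w * g n (X w))%:E = c%:E * \int[P]_w (g n (X w))%:E.
  have mgy y : measurable (g n @^-1` [set y]) by [].
  have gE w : (g n (X w))%:E = \sum_(y \in range (g n)) (y * \1_(g n @^-1` [set y]) (X w))%:E.
    by rewrite fsumEFin // -fimfunE.
  have gyE y : (y \in range (g n)) -> (0 <= y)%R.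
    by rewrite inE => -[x _ <-]; exact: fun_ge0.
  under eq_integral => w _.
    rewrite EFinM gE ge0_mule_fsumr; last first.
      by move=> y; rewrite nnfun_muleindic_ge0.
    over.
  under [in RHS]eq_integral => w _ do rewrite gE.
  rewrite ge0_integral_fsum //; last 2 first.
  - move=> y; under eq_fun do rewrite -EFinM; apply/measurable_EFinP.
    by apply: measurable_funM => //; apply: measurable_funM => //; exact: mind.
  - by move=> y w _; rewrite mule_ge0 ?lee_fin // -lee_fin nnfun_muleindic_ge0.
  rewrite ge0_integral_fsum //; last 2 first.
  - by move=> y; apply/measurable_EFinP; apply: measurable_funM => //; exact: mind.
  - by move=> y w _; rewrite nnfun_muleindic_ge0.
  rewrite ge0_mule_fsumr; last first.
    by move=> y; apply: integral_ge0 => w _; rewrite nnfun_muleindic_ge0.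
  apply: eq_fsbigr => y yr.
  have y0 := gyE y yr.
  under eq_integral => w _ do rewrite -EFinM mulrCA EFinM.
  rewrite ge0_integralZl_EFin //; last 2 first.
  - by move=> w _; rewrite lee_fin mulr_ge0.
  - by apply/measurable_EFinP; apply: measurable_funM => //; exact: mind.
  under [in RHS]eq_integral => w _ do rewrite EFinM.
  rewrite ge0_integralZl_EFin //; last by apply/measurable_EFinP; exact: mind.
  rewrite YX // muleCA; congr (_ * (_ * _)).
  rewrite -[RHS](_ : \int[P]_w (\1_(X @^-1` (g n @^-1` [set y])) w)%:E = _) //.
  rewrite integral_indic ?setIT //.
  by rewrite -[X in measurable X]setTI; exact: mX.
have cv1 : \int[P]_w (Y w * g n (X w))%:E @[n --> \oo] --> \int[P]_w (Y w * h (X w))%:E.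
  have -> : \int[P]_w (Y w * h (X w))%:E = \int[P]_w limn (fun n => (Y w * g n (X w))%:E).
    apply: eq_integral => w _; apply/esym/cvg_lim => //.
    rewrite EFinM; under eq_fun do rewrite EFinM.
    by apply: cvgeZl => //; exact: gcvg.
  apply: cvg_monotone_convergence => //.
  - by move=> n; apply/measurable_EFinP; exact: measurable_funM.
  - by move=> n w _; rewrite lee_fin mulr_ge0.
  - by move=> w _ a b ab; rewrite lee_fin ler_wpM2l //; exact/lefP/gnd.
have cv2 : \int[P]_w (g n (X w))%:E @[n --> \oo] --> \int[P]_w (h (X w))%:E.
  have -> : \int[P]_w (h (X w))%:E = \int[P]_w limn (fun n => (g n (X w))%:E).
    by apply: eq_integral => w _; apply/esym/cvg_lim => //; exact: gcvg.
  apply: cvg_monotone_convergence => //.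
  - by move=> n; apply/measurable_EFinP.
  - by move=> n w _; rewrite lee_fin.
  - by move=> w _ a b ab; rewrite lee_fin; exact/lefP/gnd.
apply: (cvg_unique _ cv1) => //.
by rewrite (funext simple); apply: cvgeZl.
Qed.

End IndepExtend.

Section IndepProd.
Context d (T : measurableType d) (R : realType) (P : probability T R).
Variables (I : finType) (D : {set I}) (X : I -> {RV P >-> R}).
Hypothesis indX : mutually_independent D X.
Variable J : {set I}.
Hypothesis JD : J \subset D.

Let mX k : measurable_fun [set: T] (X k : T -> R). Proof. exact: measurable_funPT. Qed.

Let mcomp (h : R -> R) k : measurable_fun [set: R] h ->
  measurable_fun [set: T] (fun w => h (X k w)).
Proof. by move=> mh; exact: (measurableT_comp mh (mX k)). Qed.

Lemma integral_prod_ge0 (f : I -> R -> R) (m : I -> R) :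
  (forall k, measurable_fun [set: R] (f k)) -> (forall k x, 0 <= f k x) ->
  (forall k, k \in J -> (\int[P]_w (f k (X k w))%:E = (m k)%:E)%E) ->
  (\int[P]_w (\prod_(k in J) f k (X k w))%:E = (\prod_(k in J) m k)%:E)%E.
Proof.
move=> mf f0 fm.
(* Hybrid factors: [f k] at the indices in [s], indicators elsewhere, with [q] the matching means.
   For empty [s] the claim is independence itself, and indices are moved into [s] one by one. *)
pose g (s : seq I) (A : I -> set R) k x := if k \in s then f k x else \1_(A k) x.
pose q (s : seq I) (A : I -> set R) k := if k \in s then m k else fine (P (X k @^-1` A k)).
have mg s A k : (forall k, measurable (A k)) -> measurable_fun [set: R] (g s A k).
  by move=> mA; rewrite /g; case: (k \in s) => //; exact: measurable_indic.
have g0 s A k x : 0 <= g s A k x.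
  by rewrite /g; case: (k \in s) => //; rewrite indicE.
have m0 k : k \in J -> 0 <= m k.
  by move=> kJ; rewrite -lee_fin -fm //; apply: integral_ge0 => w _; rewrite lee_fin.
have q0 s A k : k \in J -> 0 <= q s A k.
  by move=> kJ; rewrite /q; case: ifP => _; rewrite ?m0 ?fine_ge0.
have mpre k (A : set R) : measurable A -> measurable (X k @^-1` A).
  by move=> mA; rewrite -[X in measurable X]setTI; exact: mX.
have main s (A : I -> set R) : uniq s -> (forall k, measurable (A k)) ->
    (\int[P]_w (\prod_(k in J) g s A k (X k w))%:E = (\prod_(k in J) q s A k)%:E)%E.
  elim: s A => [|k0 s IH] A.
    move=> _ mA; have := indX JD mA => e.
    transitivity (\int[P]_w (\1_(\bigcap_(k in [set` J]) (X k @^-1` A k)) w)%:E)%E.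
      apply: eq_integral => w _; congr (_%:E); rewrite indicE.
      case: (boolP (w \in _)); rewrite (inE, notin_setE) /bigcap /= => wA.
        by rewrite big1 // => k kJ; rewrite /g /= indicE mem_set //; apply: wA.
      have /existsNP[k /not_implyP[kJ kA]] := wA.
      rewrite (bigD1 k) //= /g /= indicE memNset ?mul0r //.
    rewrite integral_indic ?setIT //; last first.
      by apply: fin_bigcap_measurable => // k _; exact: mpre.
    rewrite [LHS]e (big_morph EFin EFinM erefl); apply: eq_bigr => k kJ.
    by rewrite /q /= fineK // fin_num_measure //; exact: mpre.
  rewrite /= => /andP[k0s us] mA.
  case: (boolP (k0 \in J)) => k0J; last first.
    rewrite (eq_bigr (q s A)) -?IH //.
      apply: eq_integral => w _; congr (_%:E); apply: eq_bigr => k kJ.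
      by rewrite /g inE; case: eqP => // kk; rewrite -kk kJ in k0J.
    move=> k kJ; rewrite /q inE; case: eqP => // kk.
    by rewrite -kk kJ in k0J.
  pose Y w := \prod_(k in J | k != k0) g s A k (X k w).
  pose c := \prod_(k in J | k != k0) q s A k.
  have gne k : k != k0 -> g (k0 :: s) A k = g s A k.
    by move=> kk; rewrite /g inE (negbTE kk).
  have Ys w : \prod_(k in J) g (k0 :: s) A k (X k w) = Y w * f k0 (X k0 w).
    rewrite (bigD1 k0) //= mulrC /Y; congr (_ * _).
      by apply: eq_bigr => k /andP[_ kk]; rewrite gne.
    by rewrite /g inE eqxx.
  have cs : \prod_(k in J) q (k0 :: s) A k = c * m k0.
    rewrite (bigD1 k0) //= mulrC /c; congr (_ * _).
      by apply: eq_bigr => k /andP[_ kk]; rewrite /q inE (negbTE kk).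
    by rewrite /q inE eqxx.
  rewrite (eq_integral (fun w => (Y w * f k0 (X k0 w))%:E)); last by move=> w _; rewrite Ys.
  have c0 : 0 <= c by rewrite /c; apply: prodr_ge0 => k /andP[kJ _]; exact: q0.
  rewrite cs (@integral_extend _ _ _ P Y (X k0) c) ?fm //.
  - rewrite /Y; under eq_fun do rewrite -big_filter.
    by apply: measurable_prod => k _; apply: mcomp; exact: mg.
  - by move=> w; apply: prodr_ge0.
  (* Varying only the set at [k0] in the induction hypothesis yields the indicator case required by
     [integral_extend]. *)
  move=> B mB; pose A' k := if k == k0 then B else A k.
  have mA' k : measurable (A' k) by rewrite /A'; case: ifP.
  have := IH A' us mA'.
  rewrite [in X in _ = X -> _](bigD1 k0) //=.
  have -> : q s A' k0 = fine (P (X k0 @^-1` B)) by rewrite /q (negbTE k0s) /A' eqxx.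
  rewrite mulrC EFinM fineK ?fin_num_measure //; last exact: mpre.
  rewrite (eq_bigr (q s A)); last first.
    by move=> k /andP[_ kk]; rewrite /q /A' (negbTE kk).
  rewrite -/c => <-; apply: eq_integral => w _; congr (_%:E).
  rewrite [RHS](bigD1 k0) //= mulrC /g (negbTE k0s) /A' eqxx; congr (_ * _).
  by apply: eq_bigr => k /andP[_ kk]; rewrite (negbTE kk).
have := main (enum I) (fun=> setT) (enum_uniq _) (fun=> measurableT).
rewrite (eq_bigr m); last by move=> k _; rewrite /q mem_enum.
move=> <-; apply: eq_integral => w _; congr (_%:E); apply: eq_bigr => k _.
by rewrite /g mem_enum.
Qed.

Lemma integrable_prod (f : I -> R -> R) (m : I -> R) :
  (forall k, measurable_fun [set: R] (f k)) ->
  (forall k, k \in J -> P.-integrable setT (fun w => (f k (X k w))%:E)) ->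
  (forall k, k \in J -> (\int[P]_w (f k (X k w))%:E = (m k)%:E)%E) ->
  P.-integrable setT (fun w => (\prod_(k in J) f k (X k w))%:E) /\
  (\int[P]_w (\prod_(k in J) f k (X k w))%:E = (\prod_(k in J) m k)%:E)%E.
Proof.
(* [s] lists the indices whose factor may change sign. One such factor is split into positive and
   negative parts at a time, and linearity of the product in that factor reduces the claim to a
   shorter list. *)
suff main (s : seq I) (f' : I -> R -> R) (m' : I -> R) : uniq s ->
  (forall k, measurable_fun [set: R] (f' k)) ->
  (forall k, k \in J -> k \notin s -> forall x, 0 <= f' k x) ->
  (forall k, k \in J -> P.-integrable setT (fun w => (f' k (X k w))%:E)) ->
  (forall k, k \in J -> (\int[P]_w (f' k (X k w))%:E = (m' k)%:E)%E) ->
  P.-integrable setT (fun w => (\prod_(k in J) f' k (X k w))%:E) /\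
  (\int[P]_w (\prod_(k in J) f' k (X k w))%:E = (\prod_(k in J) m' k)%:E)%E.
  move=> mf ifm fm; apply: (main (enum I)) => //; first exact: enum_uniq.
  by move=> k _; rewrite mem_enum.
elim: s f' m' => [|k0 s IH] f' m' /=.
  move=> _ mf f0 ifm fm.
  (* [integral_prod_ge0] asks for nonnegative factors at all indices, so those outside [J] are
     replaced by 1. *)
  pose f1 k x := if k \in J then f' k x else 1.
  have mf1 k : measurable_fun [set: R] (f1 k).
    by rewrite /f1; case: (k \in J) => //.
  have f10 k x : 0 <= f1 k x by rewrite /f1; case: ifP => // kJ; exact: f0.
  have E : (\int[P]_w (\prod_(k in J) f' k (X k w))%:E = (\prod_(k in J) m' k)%:E)%E.
    rewrite -(integral_prod_ge0 mf1 f10); last first.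
      by move=> k kJ; rewrite -fm //; apply: eq_integral => w _; rewrite /f1 kJ.
    by apply: eq_integral => w _; congr (_%:E); apply: eq_bigr => k kJ; rewrite /f1 kJ.
  split=> //; apply/integrableP; split.
    apply/measurable_EFinP; under eq_fun do rewrite -big_filter.
    by apply: measurable_prod => k _; exact: mcomp.
  rewrite (eq_integral (fun w => (\prod_(k in J) f' k (X k w))%:E)) ?E ?ltry //.
  by move=> w _; rewrite gee0_abs // lee_fin; apply: prodr_ge0 => k kJ; exact: f0.
move=> /andP[k0s us] mf f0 ifm fm.
case: (boolP (k0 \in J)) => k0J; last first.
  apply: IH => // k kJ ks; apply: f0 => //; rewrite inE negb_or ks andbT.
  by apply: contraNneq k0J => <-.
pose fp k x := if k == k0 then Num.max (f' k x) 0 else f' k x.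
pose fn k x := if k == k0 then Num.max (- f' k x) 0 else f' k x.
pose mp k := fine (\int[P]_w (fp k (X k w))%:E)%E.
pose mn k := fine (\int[P]_w (fn k (X k w))%:E)%E.
have mfp k : measurable_fun [set: R] (fp k).
  by rewrite /fp; case: (k == k0) => //; apply: measurable_maxr.
have mfn k : measurable_fun [set: R] (fn k).
  rewrite /fn; case: (k == k0) => //; apply: measurable_maxr => //.
  exact: measurableT_comp.
have ifp k : k \in J -> P.-integrable setT (fun w => (fp k (X k w))%:E).
  move=> kJ; apply: (le_integrable measurableT _ _ (ifm k kJ)).
    by apply/measurable_EFinP; exact: mcomp.
  move=> w _; rewrite /fp lee_fin; case: ifP => // _.
  by rewrite ger0_norm ?le_max ?lexx ?orbT // ge_max ler_norm normr_ge0.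
have ifn k : k \in J -> P.-integrable setT (fun w => (fn k (X k w))%:E).
  move=> kJ; apply: (le_integrable measurableT _ _ (ifm k kJ)).
    by apply/measurable_EFinP; exact: mcomp.
  move=> w _; rewrite /fn lee_fin; case: ifP => // _.
  by rewrite ger0_norm ?le_max ?lexx ?orbT // ge_max -normrN ler_norm normr_ge0.
have fpm k : k \in J -> (\int[P]_w (fp k (X k w))%:E = (mp k)%:E)%E.
  by move=> kJ; rewrite fineK //; apply: integrable_fin_num => //; exact: ifp.
have fnm k : k \in J -> (\int[P]_w (fn k (X k w))%:E = (mn k)%:E)%E.
  by move=> kJ; rewrite fineK //; apply: integrable_fin_num => //; exact: ifn.
have fp0 k : k \in J -> k \notin s -> forall x, 0 <= fp k x.
  move=> kJ ks x; rewrite /fp; case: eqVneq => [|kk]; first by rewrite le_max lexx orbT.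
  by apply: f0; rewrite // inE negb_or kk.
have fn0 k : k \in J -> k \notin s -> forall x, 0 <= fn k x.
  move=> kJ ks x; rewrite /fn; case: eqVneq => [|kk]; first by rewrite le_max lexx orbT.
  by apply: f0; rewrite // inE negb_or kk.
have [ip Ep] := IH fp mp us mfp fp0 ifp fpm.
have [in_ En] := IH fn mn us mfn fn0 ifn fnm.
have e0 x : f' k0 x = fp k0 x - fn k0 x.
  rewrite /fp /fn eqxx /Num.max.
  by case: (ltP (f' k0 x) 0); case: (ltP (- f' k0 x) 0) => ? ?; lra.
have sub w : \prod_(k in J) f' k (X k w) =
    \prod_(k in J) fp k (X k w) - \prod_(k in J) fn k (X k w).
  rewrite !(bigD1 k0 k0J) /= e0 mulrBl; congr (_ * _ - _ * _); apply: eq_bigr.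
    by move=> k /andP[_ kk]; rewrite /fp (negbTE kk).
  by move=> k /andP[_ kk]; rewrite /fn (negbTE kk).
have msub : \prod_(k in J) m' k = \prod_(k in J) mp k - \prod_(k in J) mn k.
  have e k : k \in J -> k != k0 -> mp k = m' k /\ mn k = m' k.
    move=> kJ kk; split; apply: EFin_inj.
      by rewrite -fpm // -fm // /fp (negbTE kk).
    by rewrite -fnm // -fm // /fn (negbTE kk).
  rewrite !(bigD1 k0 k0J) /=.
  rewrite [X in _ = _ * X - _](eq_bigr m'); last by move=> k /andP[kJ kk]; have [] := e k kJ kk.
  rewrite [X in _ = _ - _ * X](eq_bigr m'); last by move=> k /andP[kJ kk]; have [] := e k kJ kk.
  rewrite -mulrBl; congr (_ * _); apply: EFin_inj.
  rewrite -fm // EFinB -fpm // -fnm // -integralB_EFin //; [|exact: ifp|exact: ifn].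
  by apply: eq_integral => w _; rewrite -EFinB e0.
split.
  rewrite [X in integrable _ _ X](_ : _ = (fun w => (\prod_(k in J) fp k (X k w))%:E - (\prod_(k in J) fn k (X k w))%:E)%E).
    exact: integrableB.
  by apply/funext => w; rewrite sub.
rewrite msub EFinB -Ep -En -integralB_EFin //.
by apply: eq_integral => w _; rewrite sub.
Qed.

End IndepProd.

Section EntryMoments.
Variables (R : realType) (Q : probability (measurableTypeR R) R) (b : R).
Hypothesis Q_mean : (\int[Q]_x x%:E = 0)%E.
Hypothesis Q_var : (\int[Q]_x (x ^+ 2)%:E = (2^-1)%:E)%E.
Hypothesis Q_fourth : (\int[Q]_x (x ^+ 4)%:E = b%:E)%E.

Lemma measurable_horner (p : {poly R}) : measurable_fun [set: R] (fun x => p.[x]).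
Proof. by apply: continuous_measurable_fun => x; exact: continuous_horner. Qed.

(** Powers of degree at most 4 are dominated by 1 + x^4, integrable by the fourth moment
    hypothesis. *)
Lemma integrable_horner (p : {poly R}) : (size p <= 5)%N ->
  Q.-integrable setT (fun x => (p.[x])%:E).
Proof.
move=> sp.
have mX n : measurable_fun [set: measurableTypeR R] (fun x : R => x ^+ n).
  exact: (measurable_funX n (@measurable_id _ _ setT)).
have i4 : Q.-integrable setT (fun x : R => (x ^+ 4)%:E).
  apply/integrableP; split; first exact/measurable_EFinP.
  under eq_integral => x _ do rewrite gee0_abs ?lee_fin ?exprn_even_ge0 //.
  by rewrite Q_fourth ltry.
have i0 : Q.-integrable setT (fun x : R => 1%:E) by apply: finite_measure_integrable_cst.
have iX i : (i <= 4)%N -> Q.-integrable setT (fun x : R => (x ^+ i)%:E).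
  move=> i_4; apply: (le_integrable measurableT _ _ (integrableD measurableT i0 i4)).
    exact/measurable_EFinP.
  move=> x _ /=; rewrite lee_fin [leRHS]ger0_norm ?addr_ge0 ?exprn_even_ge0 //.
  rewrite normrX -(normr_id x) -[x ^+ 4]ger0_norm ?exprn_even_ge0 // normrX normr_id.
  case: (leP `|x| 1) => x1.
    by rewrite (le_trans (exprn_ile1 i (normr_ge0 x) x1)) // lerDl exprn_ge0.
  by rewrite (le_trans (ler_weXn2l (ltW x1) i_4)) // lerDr.
have -> : (fun x => (p.[x])%:E) = (fun x => \sum_(i < 5) (p`_i)%:E * (x ^+ i)%:E)%E.
  apply/funext => x; rewrite (horner_coef_wide x sp) -sumEFin.
  by apply: eq_bigr => i _; rewrite EFinM.
apply: integrable_sum => // i _.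
by apply: integrableZl => //; apply: iX; rewrite -ltnS.
Qed.

Definition poly_moment (p : {poly R}) : R := fine (\int[Q]_x (p.[x])%:E)%E.

Lemma poly_momentE (p : {poly R}) : (size p <= 5)%N ->
  (\int[Q]_x (p.[x])%:E = (poly_moment p)%:E)%E.
Proof.
move=> sp; rewrite fineK //; apply: integrable_fin_num => //.
exact: integrable_horner.
Qed.

(** The numbers [poly_moment (lagr R a)] are the weights of a signed measure on the five nodes with
    the same moments as [Q] up to order 4. *)
Lemma poly_moment_lagr (p : {poly R}) : (size p <= 5)%N ->
  \sum_(a < 5) poly_moment (lagr R a) * p.[a%:R] = poly_moment p.
Proof.
move=> sp; apply: EFin_inj; rewrite -poly_momentE //.
have il a : Q.-integrable setT (fun x => ((lagr R a).[x])%:E).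
  by apply: integrable_horner; rewrite size_lagr.
transitivity (\int[Q]_x (\sum_(a < 5) (p.[a%:R])%:E * ((lagr R a).[x])%:E))%E; last first.
  apply: eq_integral => x _.
  have -> : p.[x] = \sum_(a < 5) p.[a%:R] * (lagr R a).[x].
    rewrite {1}(lagr_interp sp) horner_sum; apply: eq_bigr => a _.
    by rewrite hornerM hornerC.
  by rewrite -sumEFin; apply: eq_bigr => a _; rewrite EFinM.
rewrite integral_sum //; last by move=> a; apply: integrableZl.
rewrite -sumEFin; apply: eq_bigr => a _.
by rewrite integralZl // poly_momentE ?size_lagr // -EFinM mulrC.
Qed.

Lemma poly_moment0 : poly_moment 1 = 1.
Proof.
rewrite /poly_moment; under eq_integral => x _ do rewrite hornerC.
rewrite integral_cst //; have Q1 := @probability_setT _ _ _ Q.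
by transitivity (fine (1 * 1 : \bar R)%E); [congr (fine (_ * _)%E)|rewrite mule1].
Qed.

Lemma poly_moment1 : poly_moment 'X = 0.
Proof.
rewrite /poly_moment; under eq_integral => x _ do rewrite hornerX.
by rewrite Q_mean.
Qed.

Lemma poly_moment2 : poly_moment 'X^2 = 2^-1.
Proof.
rewrite /poly_moment; under eq_integral => x _ do rewrite hornerXn.
by rewrite Q_var.
Qed.

Lemma poly_moment4 : poly_moment 'X^4 = b.
Proof.
rewrite /poly_moment; under eq_integral => x _ do rewrite hornerXn.
by rewrite Q_fourth.
Qed.

(* [Q] lives on [measurableTypeR R] and the laws of the entries on [R]; the two
   have the same measurable sets but different displays. *)
Let idTR : measurableTypeR R -> R := idfun.

#[local] HB.instance Definition _ :=
  @isMeasurableFun.Build _ _ _ _ idTR (@measurable_id _ _ setT).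

Lemma integral_distributionQ d (T : measurableType d) (P : probability T R)
    (X : {RV P >-> R}) (f : R -> \bar R) :
  (forall A : set R, measurable A -> distribution P X A = Q A) ->
  (\int[distribution P X]_x f x = \int[distribution Q idTR]_x f x)%E.
Proof.
move=> XQ; apply: eq_measure_integral => A mA _.
exact: XQ.
Qed.

Lemma expectation_horner d (T : measurableType d) (P : probability T R)
    (X : {RV P >-> R}) (p : {poly R}) : (size p <= 5)%N ->
  (forall A : set R, measurable A -> distribution P X A = Q A) ->
  P.-integrable setT (fun w => (p.[X w])%:E) /\
  (\int[P]_w (p.[X w])%:E = (poly_moment p)%:E)%E.
Proof.
move=> sp XQ.
have mp : measurable_fun [set: R] (fun x => (p.[x])%:E).
  by apply/measurable_EFinP; exact: measurable_horner.
have ip : P.-integrable setT (fun w => (p.[X w])%:E).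
  have /integrableP[_ ioo] := integrable_horner sp.
  apply/integrableP; split; first exact: (measurableT_comp mp (@measurable_funPT _ _ _ _ X)).
  rewrite -(ge0_integral_distribution X (f := fun x => `|(p.[x])%:E|%E)) //; last first.
    exact: measurableT_comp.
  rewrite integral_distributionQ // ge0_integral_distribution //.
  exact: measurableT_comp.
split=> //.
rewrite -(integral_distribution mp ip) integral_distributionQ //.
have iq : Q.-integrable setT ((fun x : R => (p.[x])%:E) \o idTR).
  exact: integrable_horner.
by rewrite (integral_distribution mp iq) -poly_momentE.
Qed.

End EntryMoments.

Section WignerCorr.
Local Open Scope complex_scope.
Variables (R : realType) (Q : probability (measurableTypeR R) R) (b : R).
Hypothesis Q_mean : (\int[Q]_x x%:E = 0)%E.
Hypothesis Q_var : (\int[Q]_x (x ^+ 2)%:E = (2^-1)%:E)%E.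
Hypothesis Q_fourth : (\int[Q]_x (x ^+ 4)%:E = b%:E)%E.
Context d (T : measurableType d) (P : probability T R) (N : nat).
Variables XRe XIm : 'I_N -> 'I_N -> {RV P >-> R}.
Hypothesis X_iid : iid_wigner_entries Q XRe XIm.
Notation K := (bool * 'I_N * 'I_N)%type.

Let X (k : K) : {RV P >-> R} := if k.1.1 then XRe k.1.2 k.2 else XIm k.1.2 k.2.
Let D : {set K} := wigner_index N.
Let xw w (k : K) : R := if k \in D then X k w else 0.

Let DE k : (k \in D) = if k.1.1 then (k.1.2 <= k.2)%N else (k.1.2 < k.2)%N.
Proof. by rewrite inE. Qed.

Let wigner_mxE w : wigner_mx XRe XIm w = wigner_of (xw w).
Proof.
have ReIm (x y : R) : x +i* y = x%:C + 'i * y%:C.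
  by apply/eqP; rewrite eq_complex /=; apply/andP; split; apply/eqP; ring.
have ReNIm (x y : R) : x -i* y = x%:C - 'i * y%:C.
  by apply/eqP; rewrite eq_complex /=; apply/andP; split; apply/eqP; ring.
apply/matrixP => i j; rewrite !mxE /wigner_entry /xw !DE /=.
case: ltngtP => [ij|ji|/val_inj ij].
- by rewrite ReIm.
- have /negbTE -> : i != j by apply: contraTneq ji => ->; rewrite ltnn.
  by rewrite ReNIm.
- by rewrite ij eqxx leqnn rmorphM.
Qed.

Let charpoly2E mu nu w :
  wigner_charpoly XRe XIm mu w * wigner_charpoly XRe XIm nu w =
  charpoly2 mu%:C nu%:C (xw w).
Proof.
(* The sign (-1)^N between det (X - l) and the characteristic polynomial occurs twice in the product
   and cancels. *)
have e l : wigner_charpoly XRe XIm l w = (-1) ^+ N * (char_poly (wigner_of (xw w))).[l%:C].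
  by rewrite /wigner_charpoly wigner_mxE char_poly_horner -detZ scaleN1r opprB.
rewrite !e /charpoly2 mulrACA -exprMn mulrNN mulr1 expr1n mul1r //.
Qed.

(** Coordinates outside the index set are frozen at 0 in [xw]; their weights are the values of the
    Lagrange basis at 0, that is, the point mass at node 0. *)
Let W (k : K) (a : 'I_5) : R :=
  if k \in D then poly_moment Q (lagr R a) else (lagr R a).[0].

Let WD k : k \in D -> forall p : {poly R}, (size p <= 5)%N ->
  \sum_a W k a * p.[a%:R] = poly_moment Q p.
Proof.
move=> kD p sp; rewrite -(poly_moment_lagr Q_fourth sp).
by apply: eq_bigr => a _; rewrite /W kD.
Qed.

Let WND k : k \notin D -> \sum_a W k a = 1.
Proof.
have s1 : (size (1%R : {poly R}) <= 5)%N by rewrite size_poly1.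
move=> kD; have := congr1 (horner^~ 0) (lagr_interp s1).
have h1 t : (1 : {poly R}).[t] = 1 by rewrite hornerC.
rewrite /= h1 horner_sum => e; rewrite [RHS]e; apply: eq_bigr => a _.
by rewrite /W (negbTE kD) [RHS]hornerM [X in _ = X * _]hornerC h1 mul1r.
Qed.

Let integral_lagr (c : {ffun K -> 'I_5}) :
  P.-integrable setT (fun w => (\prod_k (lagr R (c k)).[xw w k])%:E) /\
  (\int[P]_w (\prod_k (lagr R (c k)).[xw w k])%:E = (\prod_k W k (c k))%:E)%E.
Proof.
have split_prod (f g : K -> R) : (forall k, k \notin D -> f k = g k) ->
    \prod_k f k = (\prod_(k in ~: D) g k) * \prod_(k in D) f k.
  move=> fg; rewrite (bigID [in D]) /= mulrC; congr (_ * _).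
  by apply: eq_big => k; [rewrite finset.in_setC | exact: fg].
pose s := \prod_(k in ~: D) (lagr R (c k)).[0].
have e w : \prod_k (lagr R (c k)).[xw w k] =
    s * \prod_(k in D) (lagr R (c k)).[X k w].
  rewrite (split_prod _ (fun k => (lagr R (c k)).[0])); last first.
    by move=> k kD; rewrite /xw (negbTE kD).
  by congr (_ * _); apply: eq_bigr => k kD; rewrite /xw kD.
have [XQ ind] := X_iid.
have mom k : k \in D -> P.-integrable setT (fun w => ((lagr R (c k)).[X k w])%:E) /\
   (\int[P]_w ((lagr R (c k)).[X k w])%:E = (poly_moment Q (lagr R (c k)))%:E)%E.
  by move=> kD; apply: (expectation_horner Q_fourth) => [|A mA]; [rewrite size_lagr | exact: XQ].
have [i I] := integrable_prod ind (subxx D) (fun k => measurable_horner (lagr R (c k)))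
  (fun k kD => (mom k kD).1) (fun k kD => (mom k kD).2).
split.
  by under eq_fun do rewrite e EFinM; apply: integrableZl.
under eq_integral => w _ do rewrite e EFinM.
rewrite integralZl // [X in (_ * X)%E]I -EFinM; congr (_%:E).
rewrite (split_prod _ (fun k => (lagr R (c k)).[0])); last first.
  by move=> k kD; rewrite /W (negbTE kD).
by congr (_ * _); apply: eq_bigr => k kD; rewrite /W kD.
Qed.

(** Interpolation writes the product of determinants as a finite sum of products of one-variable
    polynomials in the entries; independence then turns its expectation into [fexp] with the weights
    [W]. *)
Lemma wigner_corrE (mu nu : R) : wigner_corr XRe XIm mu nu =
  (N`!%:R * \sum_(k < N.+1 | (k.*2 <= N)%N)
    (b - 3 / 4) ^+ k / k`!%:R * hermite_kernel mu nu (N - k.*2))%:C.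
Proof.
rewrite -(fexp_charpoly2 DE WD WND (poly_moment0 Q) (poly_moment1 Q_mean)
  (poly_moment2 Q_var) (poly_moment4 Q_fourth)).
pose G (c : {ffun K -> 'I_5}) : R[i] := charpoly2 mu%:C nu%:C (fun k => (c k)%:R).
have ReE (z : R[i]) (x : R) : complex.Re (x%:C * z) = x * complex.Re z.
  by case: z => u v /=; ring.
have ImE (z : R[i]) (x : R) : complex.Im (x%:C * z) = x * complex.Im z.
  by case: z => u v /=; ring.
pose Zw w := wigner_charpoly XRe XIm mu w * wigner_charpoly XRe XIm nu w.
(* Real and imaginary parts are handled together, as additive maps that commute with real
   scalars. *)
have part (f : R[i] -> R) : {morph f : z z' / z + z'} -> f 0 = 0 ->
    (forall (z : R[i]) (x : R), f (x%:C * z) = x * f z) ->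
    fine ('E_P[fun w => f (Zw w)])%E = \sum_(c : {ffun K -> 'I_5}) (\prod_k W k (c k)) * f (G c).
  move=> fD f0 fZ; rewrite unlock.
  have e w : (f (Zw w))%:E =
      (\sum_(c : {ffun K -> 'I_5}) (f (G c))%:E * (\prod_k (lagr R (c k)).[xw w k])%:E)%E.
    rewrite /Zw charpoly2E charpoly2_interp (big_morph f fD f0) -sumEFin; apply: eq_bigr => c _.
    by rewrite fZ mulrC EFinM.
  under eq_integral => w _ do rewrite e.
  rewrite integral_sum //; last by move=> c; apply: integrableZl => //; exact: (integral_lagr c).1.
  rewrite (eq_bigr (fun c : {ffun K -> 'I_5} => ((\prod_k W k (c k)) * f (G c))%:E)) ?sumEFin // => c _.
  by rewrite integralZl ?(integral_lagr c).2 -?EFinM 1?mulrC //; exact: (integral_lagr c).1.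
have ReD : {morph (@complex.Re R) : z z' / z + z'} by case=> ? ? [].
have ImD : {morph (@complex.Im R) : z z' / z + z'} by case=> ? ? [].
have fexpE : fexp (fun k a => (W k a)%:C) G =
    \sum_(c : {ffun K -> 'I_5}) (\prod_k W k (c k))%:C * G c.
  by apply: eq_bigr => c _; rewrite rmorph_prod.
rewrite /wigner_corr /cexpectation part // part // fexpE; apply/eqP; rewrite eq_complex /=.
apply/andP; split; apply/eqP.
  by rewrite (big_morph _ ReD (erefl _)); apply: eq_bigr => c _; rewrite ReE.
by rewrite (big_morph _ ImD (erefl _)); apply: eq_bigr => c _; rewrite ImE.
Qed.

End WignerCorr.

(** * Integrals over the real line *)

Section DominatedByCauchy.
Variable R : realType.
Notation mu := (@lebesgue_measure R).
Implicit Types (f g F : R -> R) (C : R).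

(** A common integrable majorant: Gaussian and exponential bounds are all reduced to a multiple of
    1/(1 + t^2), whose integral comes from the arctangent. *)
Definition cauchy_dominated f :=
  exists C, forall t, `|f t| <= C * (1 + t ^+ 2)^-1.

Lemma integrable_cauchy : mu.-integrable setT (fun t : R => ((1 + t ^+ 2)^-1)%:E).
Proof.
have c1 : continuous (fun t : R => (1 + t ^+ 2)^-1) by exact: continuous_oneDsqrV.
have ge0 (t : R) : 0 <= (1 + t ^+ 2)^-1 by rewrite invr_ge0 addr_ge0 // sqr_ge0.
have mf : measurable_fun [set: R] (fun t : R => ((1 + t ^+ 2)^-1)%:E).
  by apply/measurable_EFinP; exact: continuous_measurable_fun.
apply/integrableP; split => //.
under eq_integral => t _ do rewrite gee0_abs ?lee_fin //.
rewrite ge0_symfun_integralT //; last by move=> t /=; rewrite sqrrN.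
rewrite (_ : [set x | _] = `[0, +oo[%classic); last first.
  by apply/seteqP; split => x /=; rewrite in_itv /= andbT.
by rewrite -[X in (_ * X)%E](_ : (pi / 2)%:E = _) ?ltry // -integral0y_oneDsqr.
Qed.

Lemma cauchy_integrable f : continuous f -> cauchy_dominated f ->
  mu.-integrable setT (EFin \o f).
Proof.
move=> cf [C fC].
apply: (le_integrable measurableT _ _ (integrableZl measurableT C integrable_cauchy)).
  by apply/measurable_EFinP; exact: continuous_measurable_fun.
by move=> t _ /=; rewrite lee_fin (le_trans (fC t)) // ler_norm.
Qed.

Lemma cauchy_dct (f_ : nat -> R -> R) f C :
  (forall n, measurable_fun [set: R] (f_ n)) -> measurable_fun [set: R] f ->
  (forall n t, `|f_ n t| <= C * (1 + t ^+ 2)^-1) ->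
  (forall t, f_ n t @[n --> \oo] --> f t) ->
  (\int[mu]_t f_ n t) @[n --> \oo] --> \int[mu]_t f t.
Proof.
move=> mf_ mf dom lim.
have [||||| iF _ cv] := @dominated_convergence _ _ R mu setT measurableT
  (fun n t => (f_ n t)%:E) (EFin \o f) (fun t => (C * (1 + t ^+ 2)^-1)%:E).
- by move=> n; apply/measurable_EFinP; exact: mf_.
- by apply/measurable_EFinP.
- by apply: aeW => t _; apply/fine_cvgP; split; [exact: nearW | exact: lim].
- by under eq_fun do rewrite EFinM; exact: (integrableZl measurableT C integrable_cauchy).
- by apply: aeW => t n _; rewrite lee_fin.
apply: fine_cvg; rewrite fineK //.
exact: integrable_fin_num.
Qed.

Lemma integral_derive_itv F f (a b : R) : a < b ->
  (forall t : R, is_derive t 1 F (f t)) -> continuous f ->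
  \int[mu]_(t in `[a, b]) f t = F b - F a.
Proof.
move=> ab dF cf.
have cF : continuous F.
  by move=> t; apply: differentiable_continuous; apply/derivable1_diffP; apply: ex_derive.
rewrite /Rintegral (@continuous_FTC2 _ f F) //.
- by apply: continuous_subspaceT.
- split; last 2 first.
  + by apply: cvg_at_right_filter; exact: cF.
  + by apply: cvg_at_left_filter; exact: cF.
  by move=> t _; apply: ex_derive.
- by move=> t _; rewrite derive1E; exact: derive_val.
Qed.

Lemma cvg_integral_symmetric f (u : nat -> R) : continuous f -> cauchy_dominated f ->
  u n @[n --> \oo] --> +oo ->
  (\int[mu]_(t in `[- u n, u n]) f t) @[n --> \oo] --> \int[mu]_t f t.
Proof.
move=> cf [C fC] u_oo.
have mf : measurable_fun [set: R] f by exact: continuous_measurable_fun.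
under eq_fun do rewrite Rintegral_mkcond.
apply: (cauchy_dct (C := C)) => //.
- move=> n; apply/(measurable_restrictT _ (measurable_itv _)).
  exact: measurable_funS mf.
- move=> n t; rewrite patchE; case: ifP => _ //.
  by rewrite normr0 (le_trans _ (fC t)).
- move=> t; apply: cvg_near_cst; near=> n.
  rewrite patchE ifT // inE /= in_itv /= -ler_norml.
  by near: n; move/cvgryPge: u_oo; apply.
Unshelve. all: by end_near. Qed.

Lemma integral_derive_line F f (a b : R) :
  (forall t : R, is_derive t 1 F (f t)) -> continuous f -> cauchy_dominated f ->
  F t @[t --> -oo] --> a -> F t @[t --> +oo] --> b ->
  \int[mu]_t f t = b - a.
Proof.
move=> dF cf domf Fa Fb.
have u_oo : (n.+1%:R : R) @[n --> \oo] --> +oo.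
  by rewrite cvg_shiftS; exact: cvgr_idn.
apply: (cvg_unique _ (cvg_integral_symmetric cf domf u_oo)) => //.
have FTC n : \int[mu]_(t in `[- n.+1%:R, n.+1%:R]) f t = F n.+1%:R - F (- n.+1%:R).
  by apply: integral_derive_itv => //; rewrite (lt_trans (y := 0)) // oppr_lt0.
rewrite (funext FTC).
apply: cvgB; first exact: (cvg_comp _ _ u_oo Fb).
have Fa' : (F \o -%R) t @[t --> +oo] --> a by apply/cvgNy_compNP.
exact: (cvg_comp _ _ u_oo Fa').
Qed.

Lemma is_derive_integral (D : set R) (f g : R -> R -> R) (x0 : R) (G : R -> R) :
  measurable (D : set (measurableTypeR R)) ->
  (forall x : R, x \in `]x0 - 1, x0 + 1[ -> forall t : R, D t -> is_derive x 1 (f^~ t) (g x t)) ->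
  (forall x : R, x \in `]x0 - 1, x0 + 1[ -> mu.-integrable D (EFin \o f x)) ->
  (forall t, 0 <= G t) -> mu.-integrable D (EFin \o G) ->
  (forall x : R, x \in `]x0 - 1, x0 + 1[ -> forall t : R, D t -> `|g x t| <= G t) ->
  is_derive x0 1 (fun x => \int[mu]_(t in D) f x t) (\int[mu]_(t in D) g x0 t).
Proof.
move=> mD dfg intf G0 iG dom.
have x0I : x0 \in `]x0 - 1, x0 + 1[ by rewrite in_itv /= ltrBlDr ltrDl ltr01.
have derf (x t : R) : `]x0 - 1, x0 + 1[%classic x -> D t -> derivable (f^~ t) x 1.
  by move=> /= xI Dt; have := dfg x xI t Dt => /@ex_derive.
have d1 (x t : R) : x \in `]x0 - 1, x0 + 1[ -> D t -> derive1 (f^~ t) x = g x t.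
  by move=> xI Dt; rewrite derive1E; have := dfg x xI t Dt => /@derive_val.
have dom1 (x t : R) : `]x0 - 1, x0 + 1[%classic x -> D t -> `|partial1of2 f x t| <= G t.
  by move=> /= xI Dt; rewrite /partial1of2 d1 //; exact: dom.
have := derivable_under_integral mD x0I intf derf G0 iG dom1.
have := differentiation_under_integral mD x0I intf derf G0 iG dom1.
rewrite derive1E => e d; apply: DeriveDef => //; rewrite e.
by apply: eq_Rintegral => t; rewrite inE => Dt; rewrite /partial1of2 d1.
Qed.

Lemma cauchy_derive (f g : R -> R -> R) (x0 C : R) :
  (forall x : R, x \in `]x0 - 1, x0 + 1[ -> forall t : R, is_derive x 1 (f^~ t) (g x t)) ->
  (forall x : R, x \in `]x0 - 1, x0 + 1[ -> continuous (f x)) ->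
  (forall x : R, x \in `]x0 - 1, x0 + 1[ -> forall t : R,
    `|f x t| <= C * (1 + t ^+ 2)^-1 /\ `|g x t| <= C * (1 + t ^+ 2)^-1) ->
  is_derive x0 1 (fun x => \int[mu]_t f x t) (\int[mu]_t g x0 t).
Proof.
move=> dfg cf dom.
have x0I : x0 \in `]x0 - 1, x0 + 1[ by rewrite in_itv /= ltrBlDr ltrDl ltr01.
apply: (@is_derive_integral _ f g x0 (fun t => C * (1 + t ^+ 2)^-1)) => //.
- by move=> x xI t _; exact: dfg.
- move=> x xI; apply: cauchy_integrable; first exact: cf.
  by exists C => t; have [] := dom x xI t.
- by move=> t; have [+ _] := dom x0 x0I t; apply: le_trans.
- rewrite /comp; under eq_fun do rewrite EFinM.
  exact: (integrableZl measurableT C integrable_cauchy).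
- by move=> x xI t _; have [] := dom x xI t.
Qed.

Lemma poly_exp_dominated (c : R) (m : nat) : 0 < c ->
  exists2 C, 0 < C & forall y, 0 <= y -> (1 + y) ^+ m <= C * expR (c * y).
Proof.
move=> c0; pose k := Num.min 1 (c / m.+1%:R).
have k0 : 0 < k by rewrite lt_min ltr01 divr_gt0.
exists (k^-1 ^+ m); first by rewrite exprn_gt0 // invr_gt0.
move=> y y0; have le1 : 1 + y <= k^-1 * expR (c / m.+1%:R * y).
  rewrite ler_pdivlMl // (le_trans _ (expR_ge1Dx _)) // mulrDr mulr1.
  by rewrite lerD ?ler_wpM2r // ge_min lexx ?orbT.
apply: (le_trans (lerXn2r m _ _ le1)); rewrite ?nnegrE ?addr_ge0 //.
  by rewrite mulr_ge0 ?expR_ge0 // invr_ge0 ltW.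
rewrite exprMn -expRM_natl ler_pM2l ?exprn_gt0 ?invr_gt0 // ler_expR.
have le_m : m%:R / m.+1%:R <= 1 :> R by rewrite ler_pdivrMr // mul1r ler_nat.
have := ler_wpM2r (mulr_ge0 (ltW c0) y0) le_m.
by rewrite mul1r; apply: le_trans; rewrite le_eqVlt; apply/orP; left; apply/eqP; ring.
Qed.

End DominatedByCauchy.

(* [is_derive] as a plain proposition, so that type class resolution does not
   interfere with the syntax-directed tactic [der]. *)
Definition der_at (R : realType) (f : R -> R) (t a : R) : Prop := is_derive t 1 f a.

Section DeriveRules.
Variable R : realType.
Implicit Types (f g : R -> R) (t a b : R).

Lemma der_at_eq f t a b : der_at f t a -> a = b -> is_derive t 1 f b.
Proof. by move=> fa <-. Qed.

Lemma der_at_cst t (c : R) : der_at (fun _ : R => c) t 0.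
Proof. exact: is_derive_cst. Qed.

Lemma der_at_id t : der_at (fun x : R => x) t 1.
Proof. exact: is_derive_id. Qed.

Lemma der_atD f g t a b : der_at f t a -> der_at g t b ->
  der_at (fun x => f x + g x) t (a + b).
Proof. by rewrite /der_at => fa gb; exact: is_deriveD. Qed.

Lemma der_atN f t a : der_at f t a -> der_at (fun x => - f x) t (- a).
Proof. by rewrite /der_at => fa; exact: is_deriveN. Qed.

Lemma der_atM f g t a b : der_at f t a -> der_at g t b ->
  der_at (fun x => f x * g x) t (f t * b + g t * a).
Proof. by rewrite /der_at => fa gb; exact: is_deriveM. Qed.

Lemma der_atX f n t a : der_at f t a ->
  der_at (fun x => f x ^+ n) t (n%:R * f t ^+ n.-1 * a).
Proof.
move=> fa; elim: n => [|n IH].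
  by rewrite !mul0r; under eq_fun do rewrite expr0; exact: der_at_cst.
under eq_fun do rewrite exprS; apply: der_at_eq (der_atM fa IH) _.
by case: n {IH} => [|n]; rewrite /= ?expr0 ?exprS -?[n.+2]addn1 ?natrD; ring.
Qed.

Lemma der_at_exp f t a : der_at f t a ->
  der_at (fun x => expR (f x)) t (expR (f t) * a).
Proof. by rewrite /der_at => fa; exact: (is_derive1_comp (is_derive_expR _) fa). Qed.

Lemma der_at_cos f t a : der_at f t a ->
  der_at (fun x => cos (f x)) t (- sin (f t) * a).
Proof. by rewrite /der_at => fa; exact: (is_derive1_comp (is_derive_cos _) fa). Qed.

Lemma der_at_sin f t a : der_at f t a ->
  der_at (fun x => sin (f x)) t (cos (f t) * a).
Proof. by rewrite /der_at => fa; exact: (is_derive1_comp (is_derive_sin _) fa). Qed.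

Lemma der_at_ln f t a : 0 < f t -> der_at f t a ->
  der_at (fun x => ln (f x)) t ((f t)^-1 * a).
Proof. by rewrite /der_at => f0 fa; exact: (is_derive1_comp (is_derive1_ln f0) fa). Qed.

Lemma der_at_atan f t a : der_at f t a ->
  der_at (fun x => atan (f x)) t ((1 + f t ^+ 2)^-1 * a).
Proof. by rewrite /der_at => fa; exact: (is_derive1_comp (is_derive1_atan _) fa). Qed.

Lemma der_at_inv f t a : f t != 0 -> der_at f t a ->
  der_at (fun x => (f x)^-1) t (- (f t ^- 2) * a).
Proof. by rewrite /der_at => f0 fa; exact: (is_deriveV f0). Qed.

Lemma derive_continuous f (df : R -> R) :
  (forall t, is_derive t 1 f (df t)) -> continuous f.
Proof.
move=> d t; apply: differentiable_continuous; apply/derivable1_diffP.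
by have := d t => /@ex_derive.
Qed.
End DeriveRules.

Ltac der_rec := lazymatch goal with
| |- der_at (fun _ => ?c) _ _ => eapply der_at_cst
| |- der_at (fun x => x) _ _ => eapply der_at_id
| |- der_at (fun x => @?f x + @?g x) _ _ => eapply (@der_atD _ f g); der_rec
| |- der_at (fun x => - @?f x) _ _ => eapply (@der_atN _ f); der_rec
| |- der_at (fun x => @?f x * @?g x) _ _ => eapply (@der_atM _ f g); der_rec
| |- der_at (fun x => @?f x ^+ ?n) _ _ => eapply (@der_atX _ f n); der_rec
| |- der_at (fun x => expR (@?f x)) _ _ => eapply (@der_at_exp _ f); der_rec
| |- der_at (fun x => cos (@?f x)) _ _ => eapply (@der_at_cos _ f); der_rec
| |- der_at (fun x => sin (@?f x)) _ _ => eapply (@der_at_sin _ f); der_rec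
| |- der_at (fun x => atan (@?f x)) _ _ => eapply (@der_at_atan _ f); der_rec
| |- der_at (fun x => ln (@?f x)) _ _ => eapply (@der_at_ln _ f); [cbv beta | der_rec]
| |- der_at (fun x => (@?f x)^-1) _ _ => eapply (@der_at_inv _ f); [cbv beta | der_rec]
| |- _ => unfold der_at; eassumption
end.
Ltac der := eapply der_at_eq; [der_rec | cbv beta].

Section CauchyClosure.
Variable R : realType.
Implicit Types (f g F : R -> R).
Notation mu := (@lebesgue_measure R).

Lemma cauchy_dominatedD f g : cauchy_dominated f -> cauchy_dominated g ->
  cauchy_dominated (fun t => f t + g t).
Proof.
move=> [C fC] [D gD]; exists (C + D) => t.
by rewrite mulrDl (le_trans (ler_normD _ _)) // lerD.
Qed.

Lemma cauchy_dominatedZ (c : R) f : cauchy_dominated f ->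
  cauchy_dominated (fun t => c * f t).
Proof.
move=> [C fC]; exists (`|c| * C) => t.
by rewrite normrM -mulrA ler_wpM2l.
Qed.

Lemma cauchy_dominated_cvgy F : cauchy_dominated F -> F t @[t --> +oo] --> (0 : R).
Proof.
move=> [C FC]; apply/cvgr0Pnorm_lt => e e0; near=> t.
have t1 : 1 <= t by near: t; exact: nbhs_pinfty_ge.
have tC : (`|C| + 1) / e <= t by near: t; exact: (nbhs_pinfty_ge (num_real _)).
apply: le_lt_trans (FC t) _; rewrite ltr_pdivrMr; last by rewrite ltr_pwDl // sqr_ge0.
rewrite ler_pdivrMr // in tC.
have := ler_norm C; have : t <= t ^+ 2 by rewrite expr2 ler_peMl // (le_trans _ t1).
nra.
Unshelve. all: by end_near. Qed.

Lemma cauchy_dominated_cvgNy F : cauchy_dominated F -> F t @[t --> -oo] --> (0 : R).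
Proof.
move=> [C FC]; apply/cvgNy_compNP; apply: cauchy_dominated_cvgy.
by exists C => t /=; rewrite -(sqrrN t).
Qed.

Lemma integral_derive_line0 F f : (forall t : R, is_derive t 1 F (f t)) ->
  continuous f -> cauchy_dominated f -> cauchy_dominated F -> \int[mu]_t f t = 0.
Proof.
move=> dF cf df dF0; rewrite (integral_derive_line dF cf df (a := 0) (b := 0)) ?subrr //.
  exact: cauchy_dominated_cvgNy.
exact: cauchy_dominated_cvgy.
Qed.

Lemma integral_cauchyD f g : continuous f -> continuous g ->
  cauchy_dominated f -> cauchy_dominated g ->
  \int[mu]_t (f t + g t) = \int[mu]_t f t + \int[mu]_t g t.
Proof. by move=> *; rewrite RintegralD //; exact: cauchy_integrable. Qed.

Lemma integral_cauchyZ (c : R) f : continuous f -> cauchy_dominated f ->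
  \int[mu]_t (c * f t) = c * \int[mu]_t f t.
Proof. by move=> *; rewrite RintegralZl //; exact: cauchy_integrable. Qed.

Lemma gauss_dominated (c : R) n f (M : R) : 0 < c ->
  (forall t, `|f t| <= M * ((1 + t ^+ 2) ^+ n * expR (- (c * t ^+ 2)))) ->
  cauchy_dominated f.
Proof.
move=> c0 fM; have [C C0 hC] := poly_exp_dominated n.+1 c0.
have M0 : 0 <= M.
  have := le_trans (normr_ge0 _) (fM 0).
  by rewrite expr0n /= mulr0 oppr0 expR0 addr0 expr1n !mulr1.
exists (M * C) => t; apply: (le_trans (fM t)); rewrite -mulrA ler_wpM2l //.
have t1 : 0 < 1 + t ^+ 2 by rewrite ltr_pwDl // sqr_ge0.
rewrite ler_pdivlMr // mulrAC -exprSr expRN ler_pdivrMr ?expR_gt0 //.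
exact: hC (sqr_ge0 t).
Qed.

End CauchyClosure.

Section GaussianFourier.
Variable R : realType.
Notation mu := (@lebesgue_measure R).
Variable sg : R.
Hypothesis sg0 : 0 < sg.

Let c : R := sg ^+ 2 / 2.

Let c0 : 0 < c. Proof. by rewrite divr_gt0 // exprn_gt0. Qed.

Let E (t : R) : R := expR (- (c * t ^+ 2)).

Let Ege0 t : 0 <= E t. Proof. exact: expR_ge0. Qed.

Lemma integral_gauss_scaled : \int[mu]_t E t = Num.sqrt (2 * pi) / sg.
Proof.
have sgV : sg^-1 != 0 by rewrite invr_neq0 // gt_eqF.
have K0 : 0 < Num.sqrt (2 * pi) / sg by rewrite divr_gt0 // sqrtr_gt0 mulr_gt0 // pi_gt0.
have pdf t : E t = Num.sqrt (2 * pi) / sg * normal_pdf 0 sg^-1 t.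
  rewrite /normal_pdf (negbTE sgV) /normal_peak /normal_fun subr0.
  have -> : sg^-1 ^+ 2 * pi *+ 2 = (sg^-1) ^+ 2 * (2 * pi) by rewrite -mulr_natl; ring.
  have -> : Num.sqrt (sg^-1 ^+ 2 * (2 * pi)) = sg^-1 * Num.sqrt (2 * pi).
    by rewrite sqrtrM ?sqr_ge0 // sqrtr_sqr gtr0_norm ?invr_gt0.
  rewrite mulrA.
  have s0 : Num.sqrt (2 * pi : R) != 0 by rewrite gt_eqF // sqrtr_gt0 mulr_gt0 // pi_gt0.
  have -> : Num.sqrt (2 * pi) / sg * (sg^-1 * Num.sqrt (2 * pi))^-1 = 1.
    by field; rewrite s0 gt_eqF.
  rewrite mul1r /E /c; congr expR; rewrite -mulr_natl.
  by field; rewrite gt_eqF.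
have ip := @integrable_normal_pdf R 0 sg^-1.
under eq_Rintegral => t _ do rewrite pdf.
by rewrite RintegralZl // /Rintegral integral_normal_pdf //= mulr1.
Qed.

Let abs_le (t : R) : `|t| <= 1 + t ^+ 2.
Proof. by rewrite -real_normK ?num_real //; have := normr_ge0 t; nra. Qed.

(** Fourier transform of a Gaussian: differentiation under the integral and integration by parts
    give h' = - (b / sg^2) h, so h(b) exp (b^2 / (2 sg^2)) is constant. *)
Lemma integral_gauss_cos (b : R) : \int[mu]_t (E t * cos (b * t)) =
  Num.sqrt (2 * pi) / sg * expR (- (b ^+ 2 / (2 * sg ^+ 2))).
Proof.
have sgn0 : sg != 0 by rewrite gt_eqF.
pose h b := \int[mu]_t (E t * cos (b * t)).
pose k b t := - (t * (E t * sin (b * t))).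
have cE : continuous E.
  by apply: (derive_continuous (df := fun t => E t * - (c * (2 * t)))) => t;
    rewrite /E; der; ring.
have cb x : continuous (fun t : R => E t * cos (x * t)).
  apply: (derive_continuous (df := fun t => E t * (- sin (x * t) * x) + cos (x * t) * (E t * - (c * (2 * t))))) => t.
  by rewrite /E; der; ring.
have cs x : continuous (fun t : R => t * (E t * sin (x * t))).
  apply: (derive_continuous (df := fun t => t * (E t * (cos (x * t) * x) + sin (x * t) * (E t * - (c * (2 * t)))) + E t * sin (x * t))) => t.
  by rewrite /E; der; ring.
have [M M0 hM] := poly_exp_dominated 2 c0.
have dom0 t : (1 + t ^+ 2) * E t <= M * (1 + t ^+ 2)^-1.
  have t1 : 0 < 1 + t ^+ 2 by rewrite ltr_pwDl // sqr_ge0.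
  rewrite ler_pdivlMr // mulrAC -expr2 /E expRN ler_pdivrMr ?expR_gt0 //.
  exact: hM (sqr_ge0 t).
have domc x t : `|E t * cos (x * t)| <= M * (1 + t ^+ 2)^-1.
  apply: le_trans (dom0 t); rewrite normrM ger0_norm // mulrC ler_wpM2r //.
  by rewrite (le_trans (cos_max _)) // lerDl sqr_ge0.
have doms x t : `|t * (E t * sin (x * t))| <= M * (1 + t ^+ 2)^-1.
  apply: le_trans (dom0 t); rewrite normrM normrM (ger0_norm (Ege0 t)) mulrCA mulrC.
  rewrite ler_wpM2r // (le_trans _ (abs_le t)) // ler_piMr //; exact: sin_max.
have dh (x : R) : is_derive x 1 h (\int[mu]_t k x t).
  apply: (@cauchy_derive R (fun x t => E t * cos (x * t)) k x M).
  - move=> y _ t; by rewrite /k /E; der; ring.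
  - by move=> y _; exact: cb.
  - by move=> y _ t; split; [exact: domc | rewrite /k normrN; exact: doms].
have parts (x : R) : \int[mu]_t k x t = - (x / sg ^+ 2) * h x.
  have dF (t : R) : is_derive t 1 (fun t => E t * sin (x * t))
      (x * (E t * cos (x * t)) + (- (2 * c)) * (t * (E t * sin (x * t)))).
    by rewrite /E; der; ring.
  have d1 : cauchy_dominated (fun t => E t * cos (x * t)) by exists M; exact: domc.
  have d2 : cauchy_dominated (fun t => t * (E t * sin (x * t))) by exists M; exact: doms.
  have c1 : continuous (fun t : R => x * (E t * cos (x * t))).
    by move=> t; apply: cvgM; [exact: cvg_cst | exact: cb].
  have c2 : continuous (fun t : R => (- (2 * c)) * (t * (E t * sin (x * t)))).
    by move=> t; apply: cvgM; [exact: cvg_cst | exact: cs].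
  have := @integral_derive_line0 R _ _ dF.
  rewrite integral_cauchyD //; [|exact: cauchy_dominatedZ..].
  rewrite !integral_cauchyZ // -/(h x) => /(_ _ _ _) I0.
  have {I0} : x * h x + - (2 * c) * \int[mu]_t (t * (E t * sin (x * t))) = 0.
    apply: I0.
    - by move=> t; apply: cvgD; [exact: c1 | exact: c2].
    - by apply: cauchy_dominatedD; exact: cauchy_dominatedZ.
    - exists M => t; apply: le_trans (dom0 t); rewrite normrM ger0_norm // mulrC ler_wpM2r //.
      by rewrite (le_trans (sin_max _)) // lerDl sqr_ge0.
  have -> : \int[mu]_t k x t = - 1 * \int[mu]_t (t * (E t * sin (x * t))).
    rewrite -integral_cauchyZ //; apply: eq_Rintegral => t _.
    by rewrite /k mulN1r.
  have -> : - (2 * c) = - sg ^+ 2 by rewrite /c; field.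
  set I := \int[mu]_t _; move=> e.
  have -> : I = x * h x / sg ^+ 2.
    by apply/eqP; rewrite eq_sym (can2_eq (divfK _) (mulfK _)) ?expf_neq0 //; apply/eqP; lra.
  by ring.
pose q b := h b * expR (b ^+ 2 / (2 * sg ^+ 2)).
have dq (x : R) : is_derive x 1 q 0.
  have dhx := dh x; rewrite parts in dhx.
  by rewrite /q; der; field.
have := is_derive_0_is_cst b 0 dq; rewrite /q expr0n /= mul0r expR0 mulr1 => e.
rewrite -/(h b) expRN -[LHS](mulfK (x := expR (b ^+ 2 / (2 * sg ^+ 2)))) ?e; last first.
  by rewrite gt_eqF ?expR_gt0.
congr (_ / _); rewrite -integral_gauss_scaled; apply: eq_Rintegral => t _.
by rewrite mul0r cos0 mulr1.
Qed.

End GaussianFourier.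

(** * Integral representations of Hermite polynomials and the Airy function *)

Section HermiteIntegral.
Variable R : realType.
Notation mu := (@lebesgue_measure R).
Variables sg p a : R.
Hypothesis sg0 : 0 < sg.

(* The real and imaginary parts of [(p + i sg t)^n exp (- (sg t + i a)^2 / 2)]. *)
Fixpoint herm_wave (n : nat) (t : R) : R * R :=
  if n is m.+1 then
    let z := herm_wave m t in (p * z.1 - sg * t * z.2, p * z.2 + sg * t * z.1)
  else (expR (a ^+ 2 / 2) * (expR (- (sg ^+ 2 / 2 * t ^+ 2)) * cos (a * sg * t)),
        - (expR (a ^+ 2 / 2) * (expR (- (sg ^+ 2 / 2 * t ^+ 2)) * sin (a * sg * t)))).

Let u n t := (herm_wave n t).1.
Let v n t := (herm_wave n t).2.

(** In complex form W_n' = i sg (n W_{n-1} + W_{n+1} - (p + a) W_n), because - (sg t + i a) = i ((p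
    + i sg t) - (p + a)). Integrated over the line this is the Hermite recurrence. For n = 0 the
    junk index [n.-1] has coefficient 0. *)
Lemma herm_wave_derive (n : nat) (t : R) :
  is_derive t 1 (u n) (- sg * (n%:R * v n.-1 t + v n.+1 t - (p + a) * v n t)) /\
  is_derive t 1 (v n) (sg * (n%:R * u n.-1 t + u n.+1 t - (p + a) * u n t)).
Proof.
elim: n => [|n [IHu IHv]].
  by split; rewrite /u /v /=; der; field.
have uE : u n.+1 = fun t => p * u n t - sg * t * v n t by [].
have vE : v n.+1 = fun t => p * v n t + sg * t * u n t by [].
split; [rewrite uE | rewrite vE]; der.
  by case: n {IHu IHv uE vE} => [|n]; rewrite /u /v /= -?(natr1 n.+1); ring.
by case: n {IHu IHv uE vE} => [|n]; rewrite /u /v /= -?(natr1 n.+1); ring.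
Qed.

Lemma herm_wave_continuous n : continuous (u n) /\ continuous (v n).
Proof.
split.
  exact: (derive_continuous (fun t => (herm_wave_derive n t).1)).
exact: (derive_continuous (fun t => (herm_wave_derive n t).2)).
Qed.

Lemma herm_wave_bound n t : `|u n t| + `|v n t| <=
  2 * expR (a ^+ 2 / 2) * (`|p| + sg) ^+ n *
    ((1 + t ^+ 2) ^+ n * expR (- (sg ^+ 2 / 2 * t ^+ 2))).
Proof.
elim: n => [|n IH].
  rewrite /u /v /= !expr0 mulr1 mul1r normrN !normrM !(ger0_norm (expR_ge0 _)).
  set A := expR (a ^+ 2 / 2); set E := expR (- _).
  have A0 : 0 <= A by exact: expR_ge0.
  have E0 : 0 <= E by exact: expR_ge0.
  have AE : 0 <= A * E by exact: mulr_ge0.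
  have := cos_max (a * sg * t); have := sin_max (a * sg * t).
  move=> /(ler_wpM2l AE) h1 /(ler_wpM2l AE) h2.
  by lra.
have tt : `|t| <= 1 + t ^+ 2.
  by rewrite -real_normK ?num_real //; have := normr_ge0 t; nra.
have t0 : 0 <= 1 + t ^+ 2 by rewrite addr_ge0 // sqr_ge0.
have step : `|u n.+1 t| + `|v n.+1 t| <= (`|p| + sg * `|t|) * (`|u n t| + `|v n t|).
  have h1 := ler_normB (p * u n t) (sg * t * v n t).
  have h2 := ler_normD (p * v n t) (sg * t * u n t).
  rewrite !normrM (gtr0_norm sg0) in h1 h2.
  by apply: le_trans (lerD h1 h2) _; rewrite le_eqVlt; apply/orP; left; apply/eqP; ring.
apply: (le_trans step).
have le1 : `|p| + sg * `|t| <= (`|p| + sg) * (1 + t ^+ 2).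
  by have := normr_ge0 p; have := sqr_ge0 t; move: tt sg0; nra.
apply: le_trans (ler_pM _ _ le1 IH) _; rewrite ?addr_ge0 ?mulr_ge0 ?(ltW sg0) //.
by rewrite !exprS le_eqVlt; apply/orP; left; apply/eqP; ring.
Qed.

Lemma herm_wave_dominated n : cauchy_dominated (u n) /\ cauchy_dominated (v n).
Proof.
have c0 : 0 < sg ^+ 2 / 2 by rewrite divr_gt0 // exprn_gt0.
split; apply: (gauss_dominated (n := n) c0) => t;
  apply: le_trans (herm_wave_bound n t).
  by rewrite lerDl.
by rewrite lerDr.
Qed.

Lemma herm_wave_integral_rec n :
  \int[mu]_t u n.+1 t = (p + a) * \int[mu]_t u n t - n%:R * \int[mu]_t u n.-1 t.
Proof.
have [c0 _] := herm_wave_continuous n.-1; have [c1 _] := herm_wave_continuous n.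
have [c2 _] := herm_wave_continuous n.+1.
have [d0 _] := herm_wave_dominated n.-1; have [d1 dv] := herm_wave_dominated n.
have [d2 _] := herm_wave_dominated n.+1.
have cZ (c : R) f : continuous f -> continuous (fun t : R => c * f t).
  by move=> cf t; apply: cvgM; [exact: cvg_cst | exact: cf].
have cD (f g : R -> R) : continuous f -> continuous g -> continuous (fun t : R => f t + g t).
  by move=> cf cg t; apply: cvgD; [exact: cf | exact: cg].
pose w t := sg * n%:R * u n.-1 t + (sg * u n.+1 t + - (sg * (p + a)) * u n t).
have dF (t : R) : is_derive t 1 (v n) (w t).
  by have := (herm_wave_derive n t).2; rewrite /w => h; apply: is_derive_eq; ring.
have cw : continuous w by apply: (cD); [exact: cZ | apply: (cD); exact: cZ].
have dw : cauchy_dominated w.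
  apply: cauchy_dominatedD; first exact: cauchy_dominatedZ.
  by apply: cauchy_dominatedD; exact: cauchy_dominatedZ.
have := integral_derive_line0 dF cw dw dv.
have cc : continuous (fun t => sg * u n.+1 t + - (sg * (p + a)) * u n t).
  by apply: (cD); exact: cZ.
have dd : cauchy_dominated (fun t => sg * u n.+1 t + - (sg * (p + a)) * u n t).
  by apply: cauchy_dominatedD; exact: cauchy_dominatedZ.
rewrite /w integral_cauchyD //; [|exact: cZ|exact: cauchy_dominatedZ].
rewrite integral_cauchyD //; [|exact: cZ..|exact: cauchy_dominatedZ|exact: cauchy_dominatedZ].
rewrite !integral_cauchyZ // => e.
have sgn0 : sg != 0 by rewrite gt_eqF.
apply: (mulfI sgn0).
set I2 := \int[mu]_t u n.+1 t in e *.
by apply/eqP; rewrite -subr_eq0 -e; apply/eqP; ring.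
Qed.

(** Formally, v = sg t + i a turns the integrand into (p + a + i v)^n exp (- v^2 / 2), the Gaussian
    average representing He_n(p + a); the splitting p + a fixes the height of the contour. The proof
    compares recurrences and initial values instead of moving a contour. *)
Lemma hermite_integral n : \int[mu]_t u n t =
  Num.sqrt (2 * pi) / sg * (hermite R n).[p + a].
Proof.
have I0 : \int[mu]_t u 0 t = Num.sqrt (2 * pi) / sg.
  have sgn0 : sg != 0 by rewrite gt_eqF.
  rewrite /u /= RintegralZl //; last first.
    apply: cauchy_integrable.
      apply: (derive_continuous (df := fun t => _)) => t; der; reflexivity.
    apply: (gauss_dominated (n := 0) (c := sg ^+ 2 / 2) (M := 1)) => [|t].
      by rewrite divr_gt0 // exprn_gt0.
    rewrite expr0 !mul1r normrM ger0_norm ?expR_ge0 // ler_piMr ?expR_ge0 //.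
    exact: cos_max.
  rewrite integral_gauss_cos // mulrCA -expRD.
  have -> : a ^+ 2 / 2 + - ((a * sg) ^+ 2 / (2 * sg ^+ 2)) = 0 by field.
  by rewrite expR0 mulr1.
suff: \int[mu]_t u n t = Num.sqrt (2 * pi) / sg * (hermite R n).[p + a] /\
  \int[mu]_t u n.+1 t = Num.sqrt (2 * pi) / sg * (hermite R n.+1).[p + a] by case.
elim: n => [|n [IH1 IH2]].
  rewrite hermite0 hermite1 hornerC hornerX mulr1 I0; split => //.
  by rewrite herm_wave_integral_rec mul0r subr0 I0 mulrC.
split=> //; rewrite herm_wave_integral_rec IH2 /= IH1 hermiteSS.
by rewrite hornerD hornerN hornerM hornerX hornerZ; ring.
Qed.

End HermiteIntegral.

Section EdgeFunctions.
Variable R : realType.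
Implicit Types (e s t : R).
Notation mu := (@lebesgue_measure R).

(** The mean value theorem in place of Taylor's formula: order n for the derivative gives order n +
    1 for the function, at the price of the factor 1/(n + 1). *)
Lemma segment_remainder (f df : R -> R) (x K : R) n : 0 <= x -> 0 <= K -> f 0 = 0 ->
  (forall y : R, 0 <= y <= x -> is_derive y 1 f (df y)) ->
  (forall y, 0 <= y <= x -> `|df y| <= K * y ^+ n) ->
  `|f x| <= K * x ^+ n.+1.
Proof.
move=> x0 K0 f0 dfx dK.
have [|||c] := @MVT_segment R f df 0 x => //.
- by move=> y; rewrite in_itv /= => /andP[/ltW y0 /ltW yx]; apply: dfx; rewrite y0.
- apply: derivable_within_continuous => y; rewrite in_itv /= => yI.
  by have := dfx y yI => /@ex_derive.
rewrite in_itv /= => cI; rewrite f0 !subr0 => ->.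
have /andP[c0 cx] := cI.
rewrite normrM (ger0_norm x0) exprSr mulrA ler_wpM2r //.
by rewrite (le_trans (dK c cI)) // ler_wpM2l // lerXn2r ?nnegrE.
Qed.

Let D e t := (1 + e) ^+ 2 + e ^+ 2 * t ^+ 2.

(* [edge_log e t + i * edge_arg e t = ln (1 + e w) - e w + (e w)^2 / 2] with [w = 1 + i t];
   it equals [(e w)^3 / 3] up to [O(e^4)]. *)
Definition edge_log e t : R := 2^-1 * ln (D e t) - e + e ^+ 2 * (1 - t ^+ 2) / 2.
Definition edge_arg e t : R := atan (e * t * (1 + e)^-1) - e * t + e ^+ 2 * t.

Let D_ge1 e t : 0 <= e -> 1 <= D e t.
Proof.
move=> e0; rewrite /D; have : 0 <= e ^+ 2 * t ^+ 2 by rewrite mulr_ge0 // sqr_ge0.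
by nra.
Qed.

Let D_gt0 e t : 0 <= e -> 0 < D e t.
Proof. by move=> /D_ge1 h; exact: lt_le_trans (h t). Qed.

Let ratio_bound e d a b : 0 <= e <= 1 -> 1 <= d ->
  `|- e ^+ 3 * (a + e * b) / d| <= (`|a| + `|b|) * e ^+ 3.
Proof.
move=> /andP[e0 e1] d1; have d0 : 0 < d by exact: lt_le_trans d1.
rewrite normrM normfV (gtr0_norm d0) ler_pdivrMr //.
rewrite normrM normrN (ger0_norm (exprn_ge0 _ e0)) mulrC.
have e30 : 0 <= e ^+ 3 by exact: exprn_ge0.
have h : `|a + e * b| <= `|a| + `|b|.
  by rewrite (le_trans (ler_normD _ _)) // lerD2l normrM (ger0_norm e0) ler_piMl.
apply: le_trans (ler_wpM2r e30 h) _.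
by rewrite ler_peMr // mulr_ge0 // addr_ge0.
Qed.

Lemma edge_log_remainder t : exists K, forall e, 0 <= e <= 1 ->
  `|edge_log e t - e ^+ 3 * (1 / 3 - t ^+ 2)| <= K * e ^+ 4.
Proof.
exists (`|1 - 6 * t ^+ 2 + t ^+ 4| + `|(1 + t ^+ 2) * (1 - 3 * t ^+ 2)|) => e /andP[e0 e1].
(* The e-derivative of ln (1 + e w) - e w + (e w)^2 / 2 - (e w)^3 / 3 is - e^3 w^4 / (1 + e w). The
   second function is its real part, with denominator [D e t] = |1 + e w|^2. *)
apply: (@segment_remainder (fun e => edge_log e t - e ^+ 3 * (1 / 3 - t ^+ 2))
  (fun e => - e ^+ 3 * ((1 - 6 * t ^+ 2 + t ^+ 4) + e * ((1 + t ^+ 2) * (1 - 3 * t ^+ 2))) / D e t)).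
- exact: e0.
- by rewrite addr_ge0.
- rewrite /edge_log /D.
  have -> : (1 + 0) ^+ 2 + 0 ^+ 2 * t ^+ 2 = 1 :> R by ring.
  by rewrite ln1; ring.
- move=> y /andP[y0 y1]; have D0 := D_gt0 t y0; rewrite /edge_log.
  rewrite /D in D0 *; der; first exact: D0.
  by field; rewrite gt_eqF // exprMn.
- by move=> y /andP[y0 y1]; apply: ratio_bound; rewrite ?y0 ?(le_trans y1) // D_ge1.
Qed.

Lemma edge_arg_remainder t : exists K, forall e, 0 <= e <= 1 ->
  `|edge_arg e t - e ^+ 3 * (t - t ^+ 3 / 3)| <= K * e ^+ 4.
Proof.
exists (`|4 * t - 4 * t ^+ 3| + `|(1 + t ^+ 2) * (3 * t - t ^+ 3)|) => e /andP[e0 e1].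
(* Here the second function is the imaginary part of - e^3 w^4 / (1 + e w). *)
apply: (@segment_remainder (fun e => edge_arg e t - e ^+ 3 * (t - t ^+ 3 / 3))
  (fun e => - e ^+ 3 * ((4 * t - 4 * t ^+ 3) + e * ((1 + t ^+ 2) * (3 * t - t ^+ 3))) / D e t)).
- exact: e0.
- by rewrite addr_ge0.
- by rewrite /edge_arg !mul0r atan0; ring.
- move=> y /andP[y0 y1]; have D0 := D_gt0 t y0; rewrite /edge_arg.
  have y1n : 1 + y != 0 by rewrite gt_eqF // ltr_pwDl.
  rewrite /D in D0 *; der => //; field.
  by rewrite y1n exprMn gt_eqF.
- by move=> y /andP[y0 y1]; apply: ratio_bound; rewrite ?y0 ?(le_trans y1) // D_ge1.
Qed.

(** For N = e^-3 these are modulus and argument of (1 + e w)^N exp (- w / e^2 + w^2 / (2 e) - s w),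
    except that the real factor exp (- s) is kept apart. *)
Definition edge_rho e t := expR (edge_log e t / e ^+ 3).
Definition edge_phase e s t := edge_arg e t / e ^+ 3 - s * t.

(** A Gaussian bound uniform in e, for dominated convergence. |1 + e w|^2 factors as (1 + e)^2 (1 +
    q); the logarithm is bounded by its cubic Taylor polynomial in the first factor and by q in the
    second. *)
Lemma edge_rho_le e t : 0 < e <= 1 -> edge_rho e t <= expR (1 / 3) * expR (- (3 / 8 * t ^+ 2)).
Proof.
move=> /andP[e0 e1]; rewrite -expRD ler_expR ler_pdivrMr ?exprn_gt0 //.
have ln1e : ln (1 + e) <= e - e ^+ 2 / 2 + e ^+ 3 / 3.
  have [|||c] := @MVT_segment R (fun x => ln (1 + x) - x + x ^+ 2 / 2 - x ^+ 3 / 3)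
    (fun x => - x ^+ 3 / (1 + x)) 0 e => //.
  - exact: ltW.
  - move=> y; rewrite in_itv /= => /andP[y0 y1].
    have y1n : 0 < 1 + y by rewrite ltr_pwDl // ltW.
    der; [exact: y1n | by field; rewrite gt_eqF].
  - apply: derivable_within_continuous => y; rewrite in_itv /= => /andP[y0 _].
    have y1n : 0 < 1 + y by rewrite ltr_pwDl.
    have : is_derive y 1 (fun x => ln (1 + x) - x + x ^+ 2 / 2 - x ^+ 3 / 3) (- y ^+ 3 / (1 + y)).
      by der => //; field; rewrite gt_eqF.
    by move=> /@ex_derive.
  rewrite in_itv /= => /andP[c0 c1]; rewrite addr0 ln1 !expr0n /= !mul0r !subr0 addr0.
  move=> h; have : - c ^+ 3 / (1 + c) * e <= 0.
    by rewrite mulNr mulNr oppr_le0 mulr_ge0 ?(ltW e0) // divr_ge0 ?exprn_ge0 // addr_ge0.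
  by rewrite -h; lra.
have e1n : 0 < 1 + e by rewrite ltr_pwDl // ltW.
pose q := e ^+ 2 * t ^+ 2 / (1 + e) ^+ 2.
have q0 : 0 <= q by apply: divr_ge0; [apply: mulr_ge0|]; exact: sqr_ge0.
have DE : ln (D e t) = 2 * ln (1 + e) + ln (1 + q).
  have -> : D e t = (1 + e) ^+ 2 * (1 + q) by rewrite /D /q; field; rewrite gt_eqF.
  have q1 : 0 < 1 + q by rewrite ltr_pwDl.
  by rewrite lnM ?posrE ?exprn_gt0 ?e1n // lnXn // mulr_natl.
have lnq : ln (1 + q) <= q by apply: le_ln1Dx; lra.
(* On [0, 1] the convex function (1 + e)^-2 lies below its chord 1 - 3 e / 4; halved, this is the
   source of the constant 3/8. *)
have qle : q <= t ^+ 2 * (e ^+ 2 - 3 / 4 * e ^+ 3).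
  rewrite /q ler_pdivrMr ?exprn_gt0 //.
  have -> : t ^+ 2 * (e ^+ 2 - 3 / 4 * e ^+ 3) * (1 + e) ^+ 2 = e ^+ 2 * t ^+ 2 +
     e ^+ 3 * t ^+ 2 * (5 - 2 * e - 3 * e ^+ 2) / 4 by field.
  rewrite lerDl divr_ge0 // mulr_ge0 //; last by nra.
  by rewrite mulr_ge0 ?sqr_ge0 // exprn_ge0 // ltW.
rewrite /edge_log DE; have := lerD (lerD ln1e ln1e) (le_trans lnq qle); lra.
Qed.

Let edge_rho_continuous e : 0 <= e -> continuous (edge_rho e).
Proof.
move=> e0; apply: (derive_continuous (df := fun t => _)) => t; rewrite /edge_rho /edge_log.
by have D0 := D_gt0 t e0; rewrite /D in D0 *; der => //; reflexivity.
Qed.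

Let edge_phase_continuous e s : continuous (edge_phase e s).
Proof.
by rewrite /edge_phase /edge_arg; apply: (derive_continuous (df := fun t => _)).
Qed.

Lemma scaled_cvg (k : nat) (F : R -> R) (l K : R) (e_ : nat -> R) :
  (forall n, 0 < e_ n <= 1) -> e_ n @[n --> \oo] --> (0 : R) ->
  (forall e, 0 <= e <= 1 -> `|F e - e ^+ k * l| <= K * e ^+ k.+1) ->
  F (e_ n) / e_ n ^+ k @[n --> \oo] --> l.
Proof.
move=> eI e_0 FK; apply/cvgrPdist_le => d d0; near=> n.
have /andP[n0 n1] := eI n.
have h := FK (e_ n); rewrite ltW ?n0 //= in h; have {}h := h n1.
have e30 : 0 < e_ n ^+ k by rewrite exprn_gt0.
have -> : l - F (e_ n) / e_ n ^+ k = - ((F (e_ n) - e_ n ^+ k * l) / e_ n ^+ k).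
  by field; rewrite gt_eqF.
rewrite normrN normrM normfV (gtr0_norm e30) ler_pdivrMr // (le_trans h) //.
rewrite exprS mulrA ler_wpM2r ?(ltW e30) //.
have K1 : 0 < `|K| + 1 by rewrite ltr_wpDl.
have : `|e_ n| <= d / (`|K| + 1).
  by near: n; move/cvgr0Pnorm_le: e_0; apply; rewrite divr_gt0.
rewrite ler_pdivlMr // (gtr0_norm n0) => h2; apply: le_trans h2.
by rewrite mulrC ler_wpM2l ?(ltW n0) // (le_trans (ler_norm K)) // lerDl.
Unshelve. all: by end_near. Qed.

(** Real parts of rescaled contour integrals; the integrand of [edgeB] carries the additional factor
    w = 1 + i t. *)
Definition edgeA e s := \int[mu]_t (expR (- s) * (edge_rho e t * cos (edge_phase e s t))).
Definition edgeB e s := \int[mu]_t (expR (- s) *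
  (edge_rho e t * (cos (edge_phase e s t) - t * sin (edge_phase e s t)))).

(** The phase is minus the imaginary part of w^3 / 3 - s w, and the weight is the modulus of its
    exponential. It turns out that [airyA] is 2 pi Ai and [airyB] is - 2 pi Ai'. *)
Definition airy_phase s t : R := t ^+ 3 / 3 + (s - 1) * t.
Definition airy_weight s t : R := expR (1 / 3 - s - t ^+ 2).
Definition airyA s := \int[mu]_t (airy_weight s t * cos (airy_phase s t)).
Definition airyB s := \int[mu]_t (airy_weight s t *
  (cos (airy_phase s t) + t * sin (airy_phase s t))).

Lemma abs_le_oneDsqr t : `|t| <= 1 + t ^+ 2.
Proof. by rewrite -real_normK ?num_real //; have := normr_ge0 t; nra. Qed.

Lemma trig_poly_le (a b c : R) t : `|a| + `|b| <= c * (1 + t ^+ 2) ->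
  forall x, `|a * cos x + b * sin x| <= c * (1 + t ^+ 2).
Proof.
move=> h x; apply: le_trans (ler_normD _ _) (le_trans _ h).
by rewrite !normrM lerD // ler_piMr // ?cos_max ?sin_max.
Qed.

Lemma continuous_cos_comp (f : R -> R) : continuous f -> continuous (fun t => cos (f t)).
Proof. by move=> cf t; apply: (@continuous_comp _ _ _ f cos); [exact: cf|exact: continuous_cos]. Qed.

Lemma continuous_sin_comp (f : R -> R) : continuous f -> continuous (fun t => sin (f t)).
Proof. by move=> cf t; apply: (@continuous_comp _ _ _ f sin); [exact: cf|exact: continuous_sin]. Qed.

Section Limit.
Variables (e_ : nat -> R) (s : R).
Hypothesis e_I : forall n, 0 < e_ n <= 1.
Hypothesis e_0 : e_ n @[n --> \oo] --> (0 : R).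

(** Both integrals are treated at once: [g t x] is cos x for [edgeA] and cos x - t sin x for
    [edgeB]. *)
Lemma edge_dct (g : R -> R -> R) :
  (forall n, continuous (fun t => g t (edge_phase (e_ n) s t))) ->
  (forall t, continuous (g t)) ->
  (forall x t, `|g t x| <= 2 * (1 + t ^+ 2)) ->
  continuous (fun t => g t (- airy_phase s t)) ->
  (\int[mu]_t (expR (- s) * (edge_rho (e_ n) t * g t (edge_phase (e_ n) s t)))) @[n --> \oo]
   --> \int[mu]_t (airy_weight s t * g t (- airy_phase s t)).
Proof.
move=> cgn cg gb cga.
pose c : R := 3 / 8; have c0 : 0 < c by rewrite /c; lra.
have [C hC] : cauchy_dominated (fun t : R => (1 + t ^+ 2) ^+ 1 * expR (- (c * t ^+ 2))).
  apply: (@gauss_dominated _ c 1 _ 1) => // t; rewrite mul1r ger0_norm //.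
  by rewrite mulr_ge0 ?expR_ge0 // exprn_ge0 // addr_ge0 // sqr_ge0.
pose M := expR (- s) * (2 * expR (1 / 3)).
have M0 : 0 <= M by rewrite !mulr_ge0 ?expR_ge0.
have dom n t : `|expR (- s) * (edge_rho (e_ n) t * g t (edge_phase (e_ n) s t))|
    <= M * C * (1 + t ^+ 2)^-1.
  rewrite normrM ger0_norm ?expR_ge0 // normrM (ger0_norm (expR_ge0 _)).
  have {}hC := le_trans (ler_norm _) (hC t); rewrite expr1 in hC.
  rewrite -mulrA; apply: le_trans (ler_wpM2l M0 hC).
  rewrite /M -mulrA ler_wpM2l ?expR_ge0 //.
  apply: le_trans (ler_pM (expR_ge0 _) (normr_ge0 _) (edge_rho_le t (e_I n)) (gb _ _)) _.
  by rewrite le_eqVlt; apply/orP; left; apply/eqP; rewrite /c; ring.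
apply: (cauchy_dct (C := M * C)) => //.
- move=> n; apply: continuous_measurable_fun => t.
  have /andP[/ltW n0 _] := e_I n.
  apply: cvgM; first exact: cvg_cst.
  by apply: cvgM; [exact: edge_rho_continuous | exact: cgn].
- apply: continuous_measurable_fun => t; apply: cvgM; last exact: cga.
  apply: (derive_continuous (df := fun t => _)) => {}t; rewrite /airy_weight.
  by der.
move=> t; have -> : airy_weight s t = expR (- s) * expR (1 / 3 - t ^+ 2).
  by rewrite /airy_weight -expRD; congr expR; ring.
rewrite -mulrA; apply: cvgM; first exact: cvg_cst.
have [K hK] := edge_log_remainder t; have [K' hK'] := edge_arg_remainder t.
apply: cvgM.
  apply: continuous_cvg; first exact: continuous_expR.
  exact: (scaled_cvg e_I e_0 hK).
apply: continuous_cvg; first exact: cg.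
have -> : - airy_phase s t = t - t ^+ 3 / 3 - s * t by rewrite /airy_phase; ring.
by apply: cvgB; [exact: (scaled_cvg e_I e_0 hK') | exact: cvg_cst].
Qed.

Lemma edgeA_cvg : edgeA (e_ n) s @[n --> \oo] --> airyA s.
Proof.
have -> : airyA s = \int[mu]_t (airy_weight s t * cos (- airy_phase s t)).
  by apply: eq_Rintegral => t _; rewrite cosN.
apply: (edge_dct (g := fun _ => cos)).
- by move=> n; apply: continuous_cos_comp; exact: edge_phase_continuous.
- by move=> _; exact: continuous_cos.
- by move=> x t; rewrite (le_trans (cos_max _)) //; have := sqr_ge0 t; lra.
- by apply: (derive_continuous (df := fun t => _)) => t; rewrite /airy_phase; der.
Qed.

Lemma edgeB_cvg : edgeB (e_ n) s @[n --> \oo] --> airyB s.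
Proof.
have -> : airyB s = \int[mu]_t (airy_weight s t * (cos (- airy_phase s t) - t * sin (- airy_phase s t))).
  by apply: eq_Rintegral => t _; rewrite cosN sinN mulrN opprK.
apply: (edge_dct (g := fun t x => cos x - t * sin x)).
- move=> n t; apply: cvgB.
    by apply: continuous_cos_comp; exact: edge_phase_continuous.
  apply: cvgM; first exact: cvg_id.
  by apply: continuous_sin_comp; exact: edge_phase_continuous.
- move=> t x; apply: cvgB; first exact: continuous_cos.
  by apply: cvgM; [exact: cvg_cst | exact: continuous_sin].
- move=> x t; rewrite -[cos x]mul1r -mulNr; apply: trig_poly_le.
  by rewrite normr1 normrN; have := abs_le_oneDsqr t; have := sqr_ge0 t; lra.
- by apply: (derive_continuous (df := fun t => _)) => t; rewrite /airy_phase; der.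
Qed.

End Limit.

(** As p > 0, the argument of p + i sg t is an arctangent, without a choice of branch; powers then
    follow from the addition formulas. *)
Lemma herm_wave_polar (sg p a t : R) n : 0 < p ->
  let phi := atan (sg * t / p) in
  let r := expR (2^-1 * ln (p ^+ 2 + sg ^+ 2 * t ^+ 2)) in
  let X := expR (a ^+ 2 / 2) * expR (- (sg ^+ 2 / 2 * t ^+ 2)) * r ^+ n in
  herm_wave sg p a n t =
    (X * cos (n%:R * phi - a * sg * t), X * sin (n%:R * phi - a * sg * t)).
Proof.
move=> p0 phi r X.
have c0 : 0 < cos phi by rewrite cos_atan invr_gt0 sqrtr_gt0 ltr_pwDl // sqr_ge0.
have D0 : 0 < p ^+ 2 + sg ^+ 2 * t ^+ 2.
  by rewrite ltr_pwDl ?exprn_gt0 // -exprMn sqr_ge0.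
have r2 : r ^+ 2 = p ^+ 2 + sg ^+ 2 * t ^+ 2.
  by rewrite /r -expRM_natl mulrA divff // mul1r lnK.
have rc : r * cos phi = p.
  apply/eqP; rewrite -(@eqrXn2 _ 2) ?(ltW p0) //; last by rewrite mulr_ge0 ?expR_ge0 ?ltW.
  rewrite exprMn r2 cos_atan exprVn sqr_sqrtr ?addr_ge0 ?sqr_ge0 //.
  apply/eqP; field; rewrite gt_eqF //= gt_eqF //.
  by move: D0; rewrite exprMn.
have rs : r * sin phi = sg * t.
  have tE : sin phi / cos phi = sg * t / p by rewrite -/(tan phi) atanK.
  have -> : r * sin phi = r * cos phi * (sin phi / cos phi) by field; rewrite gt_eqF.
  by rewrite tE rc mulrC divfK // gt_eqF.
rewrite /X {X}; elim: n => [|n IH].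
  by rewrite /= mul0r sub0r cosN sinN expr0 mulr1 !mulrA mulrN.
have -> : n.+1%:R * phi - a * sg * t = (n%:R * phi - a * sg * t) + phi.
  by rewrite -(natr1 n); ring.
rewrite /= IH /=; set y := n%:R * phi - a * sg * t.
by rewrite (cosD y) (sinD y) (exprSr r) -rs -rc; congr (_, _); ring.
Qed.

Definition edge_factor (m : R) N s := m / Num.sqrt (2 * pi) * (m ^+ 3) ^+ N *
  expR (m ^+ 6 / 2 + s * m ^+ 2 + s ^+ 2 / (2 * m ^+ 2)).

Section HermiteEdge.
Variables (m s : R) (N : nat).
Hypotheses (m1 : 1 <= m) (Nm : N%:R = m ^+ 6 :> R).
Let e := (m ^+ 2)^-1.
Let sg := m.
Let p := m ^+ 3 + m.
Let a := m ^+ 3 - m + s / m.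

Let m0 : 0 < m. Proof. exact: lt_le_trans m1. Qed.
Let mn0 : m != 0. Proof. by rewrite gt_eqF. Qed.

(** At x = 2 sqrt N the exponent N ln z + (z - x)^2 / 2 has a double saddle at z = sqrt N = m^3. The
    contour is placed at p = m^3 + m and scaled by sg = m, so that p + i sg t = m^3 (1 + e w) with e
    = m^-2. *)
Lemma herm_wave_edge t : herm_wave sg p a N t =
  let F := (m ^+ 3) ^+ N * expR (m ^+ 6 / 2 + s * m ^+ 2 + s ^+ 2 / (2 * m ^+ 2)) in
  (F * (expR (- s) * (edge_rho e t * cos (edge_phase e s t))),
   F * (expR (- s) * (edge_rho e t * sin (edge_phase e s t)))).
Proof.
have p0 : 0 < p by rewrite addr_gt0 // exprn_gt0.
have e0 : 0 < e by rewrite invr_gt0 exprn_gt0.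
rewrite herm_wave_polar //.
have -> : N%:R * atan (sg * t / p) - a * sg * t = edge_phase e s t.
  rewrite /edge_phase /edge_arg Nm.
  have -> : sg * t / p = e * t * (1 + e)^-1.
    rewrite /e /sg /p; field; rewrite mn0 /=.
    by rewrite !gt_eqF // ?addr_gt0 ?exprn_gt0.
  by rewrite /e /a /sg; field.
have -> : expR (a ^+ 2 / 2) * expR (- (sg ^+ 2 / 2 * t ^+ 2)) *
     expR (2^-1 * ln (p ^+ 2 + sg ^+ 2 * t ^+ 2)) ^+ N =
   (m ^+ 3) ^+ N * expR (m ^+ 6 / 2 + s * m ^+ 2 + s ^+ 2 / (2 * m ^+ 2)) *
     (expR (- s) * edge_rho e t).
  have -> : p ^+ 2 + sg ^+ 2 * t ^+ 2 = (m ^+ 3) ^+ 2 * D e t.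
    by rewrite /p /sg /D /e; field.
  have -> : expR (2^-1 * ln ((m ^+ 3) ^+ 2 * D e t)) = m ^+ 3 * expR (2^-1 * ln (D e t)).
    have De := D_gt0 t (ltW e0); have m3 : 0 < m ^+ 3 by rewrite exprn_gt0.
    rewrite lnM ?posrE ?(exprn_gt0 2 m3) // lnXn // mulr2n.
    have -> (y z : R) : 2^-1 * (y + y + z) = y + 2^-1 * z by field.
    by rewrite expRD lnK.
  rewrite exprMn.
  rewrite -expRM_natl Nm mulrCA -!mulrA; congr (_ * _).
  rewrite -!expRD /edge_rho /edge_log; congr expR.
  by rewrite /a /sg /e; field.
by rewrite /= -!mulrA.
Qed.

Let x : R := 2 * m ^+ 3 + s / m.
Let pax : p + a = x. Proof. by rewrite /p /a /x; ring. Qed.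

Let sqrt2pi : 0 < Num.sqrt (2 * pi) :> R.
Proof. by rewrite sqrtr_gt0 mulr_gt0 // pi_gt0. Qed.

Let K := (m ^+ 3) ^+ N * expR (m ^+ 6 / 2 + s * m ^+ 2 + s ^+ 2 / (2 * m ^+ 2)).

Let K0 : K != 0.
Proof. by rewrite mulf_neq0 // ?gt_eqF ?expR_gt0 // !exprn_gt0. Qed.

Lemma hermite_edgeA : (hermite R N).[x] = edge_factor m N s * edgeA e s.
Proof.
have h := hermite_integral p a m0 N; rewrite pax in h.
have [cu _] := herm_wave_continuous m p a N; have [du _] := herm_wave_dominated p a m0 N.
have -> : edgeA e s = K^-1 * \int[mu]_t (herm_wave sg p a N t).1.
  rewrite -integral_cauchyZ //; apply: eq_Rintegral => t _.
  by rewrite herm_wave_edge /= -/K mulKf.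
rewrite h /edge_factor -[_ * _ * expR _]mulrA -/K; field.
by rewrite K0 mn0 gt_eqF.
Qed.

(** The extra factor p + i sg t - m^3 of this combination is m w, which turns the integrand of
    [edgeA] into that of [edgeB]. *)
Lemma hermite_edgeB : (hermite R N.+1).[x] - m ^+ 3 * (hermite R N).[x] =
  edge_factor m N s * (m * edgeB e s).
Proof.
have h := hermite_integral p a m0 N; rewrite pax in h.
have h1 := hermite_integral p a m0 N.+1; rewrite pax in h1.
have [cu _] := herm_wave_continuous m p a N; have [du _] := herm_wave_dominated p a m0 N.
have [cu1 _] := herm_wave_continuous m p a N.+1.
have [du1 _] := herm_wave_dominated p a m0 N.+1.
have cuZ : continuous (fun t : R => - m ^+ 3 * (herm_wave m p a N t).1).
  by move=> t; apply: cvgM; [exact: cvg_cst | exact: cu].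
have -> : edgeB e s = (K * m)^-1 *
    \int[mu]_t ((herm_wave sg p a N.+1 t).1 + - m ^+ 3 * (herm_wave sg p a N t).1).
  rewrite -integral_cauchyZ.
  - apply: eq_Rintegral => t _.
    rewrite /= herm_wave_edge /= -/K /p /sg; field.
    by rewrite mn0 K0.
  - by move=> t; apply: cvgD; [exact: cu1 | exact: cuZ].
  - by apply: cauchy_dominatedD => //; exact: cauchy_dominatedZ.
rewrite integral_cauchyD //; last exact: cauchy_dominatedZ.
rewrite integral_cauchyZ // h h1 /edge_factor -[_ * _ * expR _]mulrA -/K; field.
by rewrite K0 mn0 gt_eqF.
Qed.

End HermiteEdge.

End EdgeFunctions.

(** * The Airy function and its kernel as absolutely convergent integrals *)

Section AiryRepresentation.
Variable R : realType.
Implicit Types (s t : R).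
Notation mu := (@lebesgue_measure R).

Let airyW s t a b : R := airy_weight s t * (a * cos (airy_phase s t) + b * sin (airy_phase s t)).

(** The integrand carries the factor w^2, produced by differentiating twice in s. *)
Let airyC s := \int[mu]_t (airy_weight s t *
  ((1 - t ^+ 2) * cos (airy_phase s t) + 2 * t * sin (airy_phase s t))).

Let airy_bound (s0 : R) : exists C, forall s, s \in `]s0 - 1, s0 + 1[ -> forall t a b,
  `|a| + `|b| <= 4 * (1 + t ^+ 2) -> `|airyW s t a b| <= C * (1 + t ^+ 2)^-1.
Proof.
have [C hC] : cauchy_dominated (fun t : R => (1 + t ^+ 2) ^+ 1 * expR (- (1 * t ^+ 2))).
  apply: (@gauss_dominated _ 1 1 _ 1) => // t; rewrite !mul1r ger0_norm //.
  by rewrite mulr_ge0 ?expR_ge0 // exprn_ge0 // addr_ge0 // sqr_ge0.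
pose M : R := 4 * expR (4 / 3 - s0).
have M0 : 0 <= M by rewrite /M mulr_ge0 ?expR_ge0.
exists (M * C) => s; rewrite in_itv /= => /andP[s1 s2] t a b h.
have {}hC := le_trans (ler_norm _) (hC t); rewrite expr1 mul1r in hC.
rewrite -mulrA; apply: le_trans (ler_wpM2l M0 hC).
rewrite /airyW normrM ger0_norm ?expR_ge0 //.
have hw : airy_weight s t <= expR (4 / 3 - s0) * expR (- t ^+ 2).
  by rewrite -expRD ler_expR; lra.
apply: le_trans (ler_pM (expR_ge0 _) (normr_ge0 _) hw (trig_poly_le h _)) _.
by rewrite le_eqVlt; apply/orP; left; apply/eqP; rewrite /M; ring.
Qed.

Let airyW_continuous s (a b : R -> R) : continuous a -> continuous b ->
  continuous (fun t => airyW s t (a t) (b t)).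
Proof.
move=> ca cb.
have cp : continuous (airy_phase s).
  by rewrite /airy_phase; apply: (derive_continuous (df := fun t => _)) => t; der.
have cw : continuous (airy_weight s).
  by rewrite /airy_weight; apply: (derive_continuous (df := fun t => _)) => t; der.
move=> t; apply: cvgM; first exact: cw.
apply: cvgD; apply: cvgM; [exact: ca | exact: continuous_cos_comp |exact: cb | ].
exact: continuous_sin_comp.
Qed.

Let polyD1 t : `|1 : R| + `|t| <= 4 * (1 + t ^+ 2).
Proof. by rewrite normr1; have := abs_le_oneDsqr t; have := sqr_ge0 t; lra. Qed.

Let polyD2 t : `|1 - t ^+ 2| + `|2 * t| <= 4 * (1 + t ^+ 2).
Proof.
have := ler_normB 1 (t ^+ 2); rewrite normr1 (ger0_norm (sqr_ge0 t)).
have := abs_le_oneDsqr t; have := sqr_ge0 t; rewrite normrM normr_nat; lra.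
Qed.

Let cst_le t : `|1 : R| + `|0 : R| <= 4 * (1 + t ^+ 2).
Proof. by rewrite normr1 normr0; have := sqr_ge0 t; lra. Qed.

Let in_itv1 s : s \in `]s - 1, s + 1[.
Proof. by rewrite in_itv /= ltrBlDr ltrDl ltr01. Qed.

Let airyA_W s : airyA s = \int[mu]_t airyW s t 1 0.
Proof. by apply: eq_Rintegral => t _; rewrite /airyW; ring. Qed.

Let airyB_W s : airyB s = \int[mu]_t airyW s t 1 t.
Proof. by apply: eq_Rintegral => t _; rewrite /airyW; ring. Qed.

Let ct0 : continuous (fun _ : R => 1 : R). Proof. by move=> ?; exact: cvg_cst. Qed.
Let ct1 : continuous (fun _ : R => 0 : R). Proof. by move=> ?; exact: cvg_cst. Qed.
Let ctid : continuous (fun t : R => t). Proof. by move=> ?; exact: cvg_id. Qed.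
Let ct2 : continuous (fun t : R => 1 - t ^+ 2).
Proof. by apply: (derive_continuous (df := fun t => _)) => t; der. Qed.
Let ct3 : continuous (fun t : R => 2 * t).
Proof. by apply: (derive_continuous (df := fun t => _)) => t; der. Qed.

Lemma airyA_derive s : is_derive s 1 (@airyA R) (- airyB s).
Proof.
have [C hC] := airy_bound s.
have -> : - airyB s = \int[mu]_t airyW s t (- 1) (- t).
  rewrite -[- airyB s]mulN1r airyB_W -integral_cauchyZ.
  - by apply: eq_Rintegral => t _; rewrite /airyW; ring.
  - exact: airyW_continuous.
  - by exists C => t; apply: hC.
rewrite (funext airyA_W).
apply: (@cauchy_derive _ (fun s t => airyW s t 1 0) (fun s t => airyW s t (- 1) (- t)) s C).
- by move=> x _ t; rewrite /airyW /airy_weight /airy_phase; der; ring.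
- by move=> x _; exact: airyW_continuous.
- by move=> x xI t; split; apply: hC; rewrite ?normrN.
Qed.

Let airyB_derive_C s : is_derive s 1 (@airyB R) (- airyC s).
Proof.
have [C hC] := airy_bound s.
have -> : - airyC s = \int[mu]_t airyW s t (- (1 - t ^+ 2)) (- (2 * t)).
  rewrite -[- airyC s]mulN1r /airyC -integral_cauchyZ.
  - by apply: eq_Rintegral => t _; rewrite /airyW; ring.
  - exact: airyW_continuous.
  - by exists C => t; apply: hC.
rewrite (funext airyB_W).
apply: (@cauchy_derive _ (fun s t => airyW s t 1 t)
  (fun s t => airyW s t (- (1 - t ^+ 2)) (- (2 * t))) s C).
- by move=> x _ t; rewrite /airyW /airy_weight /airy_phase; der; ring.
- by move=> x _; exact: airyW_continuous.
- by move=> x xI t; split; apply: hC; rewrite ?normrN.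
Qed.

(** Airy's equation: w^2 - s is the derivative of w^3 / 3 - s w, so the difference of the two
    integrands is a t-derivative and integrates to zero. *)
Let airyC_eq s : airyC s = s * airyA s.
Proof.
have [C hC] := airy_bound s.
have dF (t : R) : is_derive t 1 (fun t => airyW s t 0 1)
    (s * airyW s t 1 0 + - 1 * airyW s t (1 - t ^+ 2) (2 * t)).
  by rewrite /airyW /airy_weight /airy_phase; der; field.
have c1 : continuous (fun t => airyW s t 1 0) by exact: airyW_continuous.
have c2 : continuous (fun t => airyW s t (1 - t ^+ 2) (2 * t)) by exact: airyW_continuous.
have d1 : cauchy_dominated (fun t => airyW s t 1 0) by exists C => t; apply: hC.
have d2 : cauchy_dominated (fun t => airyW s t (1 - t ^+ 2) (2 * t)).
  by exists C => t; apply: hC.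
have d3 : cauchy_dominated (fun t => airyW s t 0 1).
  by exists C => t; apply: hC => //; rewrite addrC.
have cZ (c : R) f : continuous f -> continuous (fun t : R => c * f t).
  by move=> cf t; apply: cvgM; [exact: cvg_cst | exact: cf].
have cc : continuous (fun t => s * airyW s t 1 0 + - 1 * airyW s t (1 - t ^+ 2) (2 * t)).
  have cD (p q : R -> R) : continuous p -> continuous q -> continuous (fun t : R => p t + q t).
    by move=> cp cq t; apply: cvgD; [exact: cp | exact: cq].
  by apply: cD; exact: cZ.
have dd : cauchy_dominated (fun t => s * airyW s t 1 0 + - 1 * airyW s t (1 - t ^+ 2) (2 * t)).
  by apply: cauchy_dominatedD; exact: cauchy_dominatedZ.
have := integral_derive_line0 dF cc dd d3.
rewrite integral_cauchyD; [|exact: cZ|exact: cZ|exact: cauchy_dominatedZ|exact: cauchy_dominatedZ].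
rewrite !integral_cauchyZ // -airyA_W => e.
have -> : airyC s = \int[mu]_t airyW s t (1 - t ^+ 2) (2 * t) by [].
by apply/esym/eqP; rewrite -subr_eq0 -e; apply/eqP; ring.
Qed.

Lemma airyB_derive s : is_derive s 1 (@airyB R) (- (s * airyA s)).
Proof. by rewrite -airyC_eq; exact: airyB_derive_C. Qed.

Section ContourShift.
Variables (s B : R).
Hypothesis B0 : 0 < B.

Let w (h t : R) := expR (- (t ^+ 2 * h - h ^+ 3 / 3 + s * h)).
Let om (h t : R) := t ^+ 3 / 3 - t * h ^+ 2 + s * t.
Let f h t := w h t * cos (om h t).
Let g h t := w h t * ((h ^+ 2 - t ^+ 2 - s) * cos (om h t) + 2 * t * h * sin (om h t)).
Let Phi h := \int[mu]_(t in `[0, B]) f h t.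
Let dPhi h := - (w h B * sin (om h B)).

(* Cauchy-Riemann: [f] and [- w sin om] are the real part and minus the imaginary part of
   [exp (i (z^3 / 3 + s z))] at [z = t + i h], so the [h]-derivative of [f] is a [t]-derivative. *)
Let Phi_derive (h : R) : 0 <= h <= 1 -> is_derive h 1 Phi (dPhi h).
Proof.
move=> /andP[h0 h1].
have -> : dPhi h = \int[mu]_(t in `[0, B]) g h t.
  have dg (t : R) : is_derive t 1 (fun t => - (w h t * sin (om h t))) (g h t).
    by rewrite /g /w /om; der; field.
  have cg : continuous (g h).
    by rewrite /g /w /om; apply: (derive_continuous (df := fun t => _)) => t; der.
  rewrite (integral_derive_itv B0 dg cg).
  have -> : om h 0 = 0 by rewrite /om; ring.
  by rewrite sin0 mulr0 oppr0 subr0.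
have cf (x : R) : continuous (f x).
  by rewrite /f /w /om; apply: (derive_continuous (df := fun t => _)) => t; der.
(* For h in [0, 1] its unit neighbourhood stays within [-2, 2]; the two factors of [G] bound the
   exponential and the trigonometric part for |x| <= 2 and 0 <= t <= B. *)
pose G : R := expR (2 * B ^+ 2 + 8 / 3 + 2 * `|s|) * (4 + B ^+ 2 + `|s| + 4 * B).
have cint (k : R -> R) : continuous k -> mu.-integrable `[0, B] (EFin \o k).
  move=> ck; apply: continuous_compact_integrable; first exact: segment_compact.
  exact: continuous_subspaceT.
apply: (@is_derive_integral _ _ f g h (fun=> G)).
- exact: measurable_itv.
- by move=> x _ t _; rewrite /f /g /w /om; der; field.
- by move=> x _; apply: cint.
- by move=> t; rewrite mulr_ge0 ?expR_ge0 // !addr_ge0 ?sqr_ge0 // mulr_ge0 // ltW.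
- by apply: cint => t; exact: cvg_cst.
move=> x; rewrite in_itv /= => /andP[x1 x2] t; rewrite in_itv /= => /andP[t0 tB].
have x3 : - 2 <= x by lra.
have x4 : x <= 2 by lra.
have xabs : `|x| <= 2 by rewrite ler_norml x3.
have t2 : t ^+ 2 <= B ^+ 2 by rewrite lerXn2r ?nnegrE // ltW.
rewrite /g normrM ger0_norm ?expR_ge0 //; apply: ler_pM; rewrite ?expR_ge0 //.
  rewrite ler_expR.
  have : - (s * x) <= 2 * `|s|.
    by rewrite -normrN in xabs; rewrite -mulrN (le_trans (ler_norm _)) // normrM mulrC ler_wpM2r.
  have : - (t ^+ 2 * x) <= 2 * B ^+ 2 by have := sqr_ge0 t; nra.
  have : x ^+ 3 <= 8.
    have : 0 <= (2 - x) * (4 + 2 * x + x ^+ 2) by rewrite mulr_ge0 //; nra.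
    by nra.
  lra.
apply: le_trans (ler_normD _ _) _; rewrite !normrM.
apply: lerD.
  rewrite -[leRHS]mulr1; apply: ler_pM => //; last exact: cos_max.
  apply: le_trans (ler_normB _ _) _; rewrite lerD2r.
  apply: le_trans (ler_normB _ _) _; rewrite (ger0_norm (sqr_ge0 t)) lerD //.
  by rewrite normrX; have := normr_ge0 x; nra.
rewrite -[leRHS]mulr1; apply: ler_pM => //; last exact: sin_max.
rewrite (ger0_norm t0) normr_nat.
have := normr_ge0 x; nra.
Qed.

Let K := expR (1 / 3 + `|s|).

Let dPhi_le h : 0 <= h <= 1 -> `|dPhi h| <= K * expR (- (B ^+ 2 * h)).
Proof.
move=> /andP[h0 h1]; rewrite normrN normrM (ger0_norm (expR_ge0 _)).
apply: le_trans (ler_piMr (expR_ge0 _) (sin_max _)) _.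
rewrite /w /K -expRD ler_expR.
have : - (s * h) <= `|s|.
  by rewrite (le_trans (ler_norm _)) // normrN normrM (ger0_norm h0) ler_piMr.
have : h ^+ 3 <= 1 by rewrite exprn_ile1.
lra.
Qed.

(** The derivative bound K exp (- B^2 h) integrates to at most K / B^2 over [0, 1]. To avoid that
    integral, [q] adds to c Phi a term whose derivative offsets the bound, so [q] does not increase.
    The signs c = 1 and c = -1 together give an absolute value. *)
Let Phi_diff (c : R) : `|c| = 1 -> c * (Phi 1 - Phi 0) <= K / B ^+ 2.
Proof.
move=> c1; have B20 : 0 < B ^+ 2 by rewrite exprn_gt0.
pose q (h : R) := c * Phi h + K / B ^+ 2 * expR (- (B ^+ 2 * h)).
pose dq (h : R) := c * dPhi h - K * expR (- (B ^+ 2 * h)).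
have dq_der (h : R) : 0 <= h <= 1 -> is_derive h 1 q (dq h).
  move=> hI; have hP := Phi_derive hI; rewrite /q /dq.
  by der; field; rewrite gt_eqF.
have [|||h] := @MVT_segment R q dq 0 1 => //.
- by move=> y; rewrite in_itv /= => /andP[/ltW y0 /ltW y1]; apply: dq_der; rewrite y0.
- apply: derivable_within_continuous => y; rewrite in_itv /= => yI.
  by have := dq_der y yI => /@ex_derive.
rewrite in_itv /= => hI; rewrite subr0 mulr1 => e.
have : dq h <= 0.
  rewrite /dq subr_le0 (le_trans _ (dPhi_le hI)) //.
  by rewrite (le_trans (ler_norm _)) // normrM c1 mul1r.
rewrite -e /q mulr0 oppr0 expR0 !mulr1.
have : 0 <= K / B ^+ 2 * expR (- B ^+ 2).
  by rewrite !mulr_ge0 ?expR_ge0 // invr_ge0 ltW.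
lra.
Qed.

Lemma airy_contour_shift :
  `|\int[mu]_(t in `[0, B]) cos (t ^+ 3 / 3 + s * t) -
    \int[mu]_(t in `[0, B]) (airy_weight s t * cos (airy_phase s t))|
   <= expR (1 / 3 + `|s|) / B ^+ 2.
Proof.
have -> : \int[mu]_(t in `[0, B]) cos (t ^+ 3 / 3 + s * t) = Phi 0.
  apply: eq_Rintegral => t _; rewrite /f /w /om.
  have -> : - (t ^+ 2 * 0 - 0 ^+ 3 / 3 + s * 0) = 0 by field.
  by rewrite expR0 mul1r; congr cos; ring.
have -> : \int[mu]_(t in `[0, B]) (airy_weight s t * cos (airy_phase s t)) = Phi 1.
  apply: eq_Rintegral => t _; rewrite /f /w /om /airy_weight /airy_phase.
  by congr (expR _ * cos _); ring.
rewrite distrC ler_norml; apply/andP; split.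
  by have := Phi_diff (c := -1); rewrite normrN1 => /(_ erefl); rewrite /K; lra.
by have := Phi_diff (c := 1); rewrite normr1 => /(_ erefl); rewrite /K; lra.
Qed.

End ContourShift.

(** By [airy_contour_shift] the oscillatory integral over [0, B] is within O(B^-2) of an absolutely
    convergent one, so its limit exists. The shifted integrand is even, hence the half-line gives
    half of [airyA s]. *)
Lemma airyE s : airy s = airyA s / (2 * pi).
Proof.
have [C hC] := airy_bound s.
pose h t := airy_weight s t * cos (airy_phase s t).
have hW t : h t = airyW s t 1 0 by rewrite /h /airyW; ring.
have ch : continuous h by rewrite (funext hW); exact: airyW_continuous.
have dh : cauchy_dominated h.
  by rewrite (funext hW); exists C => t; apply: hC.
have heven t : h (- t) = h t.
  rewrite /h /airy_weight /airy_phase sqrrN -cosN.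
  by congr (_ * cos _); ring.
have half (B : R) : 0 < B -> \int[mu]_(t in `[0, B]) h t = 2^-1 * \int[mu]_(t in `[- B, B]) h t.
  move=> B0.
  have cint (a b : R) : mu.-integrable `[a, b] (EFin \o h).
    apply: continuous_compact_integrable; first exact: segment_compact.
    exact: continuous_subspaceT.
  have := @Rintegral_itvB R h (BLeft (- B)) (BRight B) 0 (cint _ _).
  rewrite !bnd_simp oppr_le0 (ltW B0) => /(_ isT isT).
  rewrite Rintegral_itv_obnd_cbnd; last first.
    by apply: integrableS (cint 0 B) => //; exact: subset_itv_oc_cc.
  have <- : \int[mu]_(t in `[0, B]) h t = \int[mu]_(t in `[- B, 0]) h t.
    rewrite /Rintegral; congr fine.
    have := @integration_by_substitution_oppr R h 0 B (ltW B0).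
    rewrite oppr0 => ->; last exact: continuous_subspaceT.
    by apply: eq_integral => t _ /=; rewrite heven.
  by lra.
have B_oo (u : nat -> R) : u n @[n --> \oo] --> +oo ->
    (\int[mu]_(t in `[0, u n]) h t) @[n --> \oo] --> 2^-1 * airyA s.
  move=> u_oo.
  have : (2^-1 * \int[mu]_(t in `[- u n, u n]) h t) @[n --> \oo] --> 2^-1 * airyA s.
    by apply: cvgM; [exact: cvg_cst | exact: cvg_integral_symmetric].
  apply: cvg_trans; apply: near_eq_cvg; near=> n.
  rewrite /= half //; near: n; move/cvgryPgt: u_oo; exact.
have cvA : (\int[mu]_(t in `[0, B]) h t) @[B --> +oo] --> 2^-1 * airyA s.
  by apply/cvg_pinftyP.
have cvI : (\int[mu]_(t in `[0, B]) cos (t ^+ 3 / 3 + s * t)) @[B --> +oo] --> 2^-1 * airyA s.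
  have -> : 2^-1 * airyA s = 2^-1 * airyA s + 0 by rewrite addr0.
  have cv0 : (\int[mu]_(t in `[0, B]) cos (t ^+ 3 / 3 + s * t) -
      \int[mu]_(t in `[0, B]) h t) @[B --> +oo] --> (0 : R).
    apply/cvgr0Pnorm_le => e e0; near=> B.
    have B1 : 1 <= B by near: B; exact: nbhs_pinfty_ge.
    have B0 : 0 < B by exact: lt_le_trans B1.
    apply: le_trans (airy_contour_shift s B0) _.
    have : expR (1 / 3 + `|s|) / e <= B by near: B; exact: (nbhs_pinfty_ge (num_real _)).
    rewrite !ler_pdivrMr ?exprn_gt0 // => /le_trans; apply.
    by rewrite mulrC ler_wpM2l ?(ltW e0) // expr2 ler_peMl // ltW.
  have E (B : R) : \int[mu]_(t in `[0, B]) cos (t ^+ 3 / 3 + s * t) =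
      \int[mu]_(t in `[0, B]) h t + (\int[mu]_(t in `[0, B]) cos (t ^+ 3 / 3 + s * t) -
      \int[mu]_(t in `[0, B]) h t) by rewrite addrC subrK.
  by rewrite (funext E); exact: cvgD.
have pi0 : pi != 0 :> R by rewrite gt_eqF // pi_gt0.
by rewrite /airy (cvg_lim _ cvI) //; move: (pi : R) pi0 => q q0; field.
Unshelve. all: by end_near. Qed.

Lemma derive1_airy s : derive1 (@airy R) s = - airyB s / (2 * pi).
Proof.
have -> : @airy R = fun s => airyA s * (2 * pi)^-1 by apply/funext => x; rewrite airyE.
have dA := airyA_derive s.
have : is_derive s 1 (fun s => airyA s * (2 * pi)^-1 : R) (- airyB s / (2 * pi)).
  by der; ring.
by move=> /@derive_val; rewrite derive1E.
Qed.

Lemma airy_quotientE (a b : R) : airy_quotient a b =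
  (airyB a * airyA b - airyA a * airyB b) / (4 * pi ^+ 2 * (a - b)).
Proof.
rewrite /airy_quotient !airyE !derive1_airy.
(* On the diagonal both sides are 0, the inverse of 0 being 0. *)
have [->|ne] := eqVneq a b; first by rewrite subrr !mulr0 invr0 !mulr0.
have pi0 : pi != 0 :> R by rewrite gt_eqF // pi_gt0.
by move: (pi : R) pi0 => q q0; field; rewrite subr_eq0 ne q0.
Qed.

(** For the diagonal, the numerator of the quotient vanishes when its arguments agree, and Airy's
    equation expresses its derivative in the first one by [k]. The mean value theorem then makes the
    quotient a nearby value of the continuous [k], up to the constant. *)
Lemma airy_kernelE (a b : R) : airy_kernel a b =
  if a == b then (airyB a ^+ 2 - a * airyA a ^+ 2) / (4 * pi ^+ 2)
  else (airyB a * airyA b - airyA a * airyB b) / (4 * pi ^+ 2 * (a - b)).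
Proof.
rewrite /airy_kernel airy_quotientE; case: ifP => // /eqP <- {b}.
pose k (p : R * R) := airyB p.1 * airyB p.2 - p.1 * (airyA p.1 * airyA p.2).
pose L := (airyB a ^+ 2 - a * airyA a ^+ 2) / (4 * pi ^+ 2).
have pi20 : 0 < 4 * pi ^+ 2 :> R by rewrite mulr_gt0 // exprn_gt0 // pi_gt0.
have cA : continuous (@airyA R) by exact: (derive_continuous airyA_derive).
have cB : continuous (@airyB R) by exact: (derive_continuous airyB_derive).
have quot (x y : R) : x != y -> exists2 c : R,
    Num.min x y <= c <= Num.max x y & airy_quotient x y = k (c, y) / (4 * pi ^+ 2).
  move=> ne.
  pose q (c : R) := airyA c * airyB y - airyB c * airyA y.
  have dq (c : R) : is_derive c 1 q (- k (c, y)).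
    have dA := airyA_derive c; have dB := airyB_derive c.
    by rewrite /q /k /=; der; ring.
  have cq : continuous q by exact: derive_continuous dq.
  have xy : Num.min x y <= Num.max x y by rewrite ge_min le_max lexx.
  have [|c cI e] := @MVT_segment R q (fun c => - k (c, y)) _ _ xy (fun c _ => dq c).
    exact: continuous_subspaceT.
  exists c; first by move: cI; rewrite in_itv.
  have e2 : q x - q y = - k (c, y) * (x - y).
    move: e; case: (ltgtP x y) ne => // lt _ e.
    by rewrite -[LHS]opprB e; ring.
  have -> : k (c, y) = - (q x - q y) / (x - y).
    by rewrite e2; field; rewrite subr_eq0.
  have pi0 : pi != 0 :> R by rewrite gt_eqF // pi_gt0.
  rewrite airy_quotientE /q; move: (pi : R) pi0 => r r0; field.
  by rewrite subr_eq0 ne r0.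
have ck : k p @[p --> (a, a)] --> k (a, a).
  have c1 : (p.1 : R) @[p --> (a, a)] --> a by exact: cvg_fst.
  have c2 : (p.2 : R) @[p --> (a, a)] --> a by exact: cvg_snd.
  apply: cvgB; first by apply: cvgM; [exact: (cvg_comp _ _ c1 (cB _)) | exact: (cvg_comp _ _ c2 (cB _))].
  apply: cvgM; first exact: c1.
  by apply: cvgM; [exact: (cvg_comp _ _ c1 (cA _)) | exact: (cvg_comp _ _ c2 (cA _))].
(* Uniqueness of the limit in [airy_kernel] needs a proper filter: the off-diagonal point (a + e/2,
   a) lies in the ball of radius e. *)
have pf : ProperFilter (within [set p : R * R | p.1 != p.2] (nbhs (a, a))).
  apply: within_nbhs_proper; rewrite /infer => U /nbhs_ballP[e /= e0 eU].
  exists (a + e / 2, a); split => /=; first by rewrite gt_eqF // ltrDl divr_gt0.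
  apply: eU; split => /=; rewrite /ball /= ?subrr ?normr0 //.
  rewrite opprD addNKr normrN gtr0_norm ?divr_gt0 //; lra.
suff cvL : airy_quotient p.1 p.2
    @[p --> within [set p : R * R | p.1 != p.2] (nbhs (a, a))] --> L.
  by rewrite (cvg_lim _ cvL).
apply/cvgrPdist_le => e e0.
have : 0 < e * (4 * pi ^+ 2) by rewrite mulr_gt0.
move/cvgrPdist_le: ck => /[apply] /nbhs_ballP[d /= d0 dk].
rewrite near_withinE; near=> p => ne.
have [c /andP[c1 c2] ->] := quot p.1 p.2 ne.
have : ball ((a, a) : R * R) d p by near: p; exact: nbhsx_ballx.
move=> [/= p1 p2].
have pd : ball ((a, a) : R * R) d (c, p.2).
  split => //=; move: p1 p2; rewrite /ball /= !ltr_distlC => /andP[u1 u2] /andP[v1 v2].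
  by rewrite (lt_le_trans _ c1) ?lt_min ?u1 //= (le_lt_trans c2) // gt_max u2.
have := dk _ pd.
have -> : L = k (a, a) / (4 * pi ^+ 2) by rewrite /L /k /=; congr (_ / _); ring.
rewrite -mulrBl normrM (gtr0_norm (x := (4 * pi ^+ 2)^-1)) ?invr_gt0 // => h.
by rewrite ler_pdivrMr.
Unshelve. all: by end_near. Qed.

End AiryRepresentation.

(** * Asymptotics *)

Section Stirling.
Variable R : realType.
Implicit Types (t e c q : R).
Notation mu := (@lebesgue_measure R).

(** The Gamma integrand u^n exp (- c u) after the substitution u = exp (t / q), up to the factor q
    of du. *)
Let gam q c n t : R := expR (n.+1%:R * (t / q) - c * expR (t / q)).

Let abs_exp_dominated (k : R) : 0 < k ->
  cauchy_dominated (fun t : R => expR (- (k * `|t|))).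
Proof.
move=> k0; have [C C0 hC] := poly_exp_dominated 2 k0.
exists C => t; rewrite ger0_norm ?expR_ge0 // expRN.
have t1 : 0 < 1 + t ^+ 2 by rewrite ltr_pwDl // sqr_ge0.
rewrite ler_pdivlMr // mulrC ler_pdivrMr ?expR_gt0 //.
apply: le_trans (hC `|t| (normr_ge0 t)).
by rewrite sqrrD expr1n mul1r real_normK ?num_real // lerD2r lerDl mulrn_wge0.
Qed.

Let sqr_le_expR (v : R) : - 2 <= v -> 1 + v + v ^+ 2 / 4 <= expR v.
Proof.
move=> v2; have -> : v = 2%:R * (v / 2) by field.
rewrite expRM_natl; have h := expR_ge1Dx (v / 2).
have -> : 1 + 2%:R * (v / 2) + (2%:R * (v / 2)) ^+ 2 / 4 = (1 + v / 2) ^+ 2 by field.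
by rewrite lerXn2r ?nnegrE ?expR_ge0 //; lra.
Qed.

Let gam_dominated q c n : 0 < q -> 0 < c -> cauchy_dominated (gam q c n).
Proof.
move=> q0 c0; have q1 : 0 < q^-1 by rewrite invr_gt0.
(* The constant comes from completing the square in (n + 2) v - c v^2 / 4, where c v^2 / 4 bounds c
   exp v from below for v >= 0. *)
have [C hC] := abs_exp_dominated q1; pose K : R := expR (n.+2%:R ^+ 2 / c).
exists (K * C) => t; rewrite ger0_norm ?expR_ge0 //.
have {}hC := le_trans (ler_norm _) (hC t).
rewrite -mulrA; apply: le_trans (ler_wpM2l (expR_ge0 _) hC).
rewrite /gam /K -expRD ler_expR.
have -> : q^-1 * `|t| = `|t / q| by rewrite normrM (gtr0_norm q1) mulrC.
set v := t / q; have nE : n.+2%:R = n.+1%:R + 1 :> R by rewrite natr1.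
have n1 : 1 <= n.+1%:R :> R by rewrite ler1n.
have s0 : 0 <= n.+2%:R ^+ 2 / c by rewrite divr_ge0 ?sqr_ge0 // ltW.
case: (lerP 0 v) => v0; last first.
  rewrite ltr0_norm // opprK.
  have : 0 <= c * expR v by rewrite mulr_ge0 ?expR_ge0 // ltW.
  have : n.+1%:R * v <= v by rewrite -[leRHS]mul1r ler_wnM2r // ltW.
  lra.
rewrite ger0_norm //.
have h1 : c * (v ^+ 2 / 4) <= c * expR v.
  rewrite ler_wpM2l ?(ltW c0) //; apply: le_trans (sqr_le_expR _); lra.
have h2 : n.+2%:R * v <= n.+2%:R ^+ 2 / c + c * (v ^+ 2 / 4).
  rewrite -subr_ge0.
  have -> : n.+2%:R ^+ 2 / c + c * (v ^+ 2 / 4) - n.+2%:R * v =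
    (n.+2%:R - c * v / 2) ^+ 2 / c by field; rewrite gt_eqF.
  by rewrite divr_ge0 ?sqr_ge0 // ltW.
by rewrite nE in h2 *; lra.
Qed.

Let gam_derive q c n t : q != 0 -> is_derive t 1 (gam q c n)
  (n.+1%:R / q * gam q c n t + - (c / q) * gam q c n.+1 t).
Proof.
move=> q0; rewrite /gam.
have -> : expR (n.+2%:R * (t / q) - c * expR (t / q)) =
    expR (n.+1%:R * (t / q) - c * expR (t / q)) * expR (t / q).
  by rewrite -expRD -[n.+2%:R]natr1; congr expR; ring.
by der; ring.
Qed.

Let gam_continuous q c n : q != 0 -> continuous (gam q c n).
Proof. by move=> q0; apply: derive_continuous => t; exact: gam_derive. Qed.

Lemma factorial_integral q c n : 0 < q -> 0 < c ->
  \int[mu]_t gam q c n t = q * n`!%:R / c ^+ n.+1.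
Proof.
move=> q0 c0; have qn0 : q != 0 by rewrite gt_eqF.
have cn0 : c != 0 by rewrite gt_eqF.
elim: n => [|n IH].
  have dF (t : R) : is_derive t 1 (fun t => - (q / c * expR (- (c * expR (t / q))))) (gam q c 0 t).
    rewrite /gam mul1r expRD; der; field.
    by rewrite qn0 cn0.
  have q1 : 0 < q^-1 by rewrite invr_gt0.
  have expNy : expR (t / q) @[t --> -oo] --> (0 : R).
    have := cauchy_dominated_cvgNy (abs_exp_dominated q1).
    apply: cvg_trans; apply: near_eq_cvg; near=> t; congr expR.
    have t0 : t < 0 by near: t; exact: (nbhs_ninfty_lt (num_real _)).
    by rewrite ltr0_norm // mulrN opprK mulrC.
  have expy : expR (- (t / q)) @[t --> +oo] --> (0 : R).
    have := cauchy_dominated_cvgy (abs_exp_dominated q1).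
    apply: cvg_trans; apply: near_eq_cvg; near=> t; congr expR.
    have t0 : 0 < t by near: t; exact: (nbhs_pinfty_gt (num_real _)).
    by rewrite gtr0_norm // mulrC.
  rewrite (integral_derive_line dF (@gam_continuous q c 0 qn0) (gam_dominated 0 q0 c0)
    (a := - (q / c)) (b := 0)).
  - by rewrite fact0 expr1 mulr1 sub0r opprK.
  - have -> : - (q / c) = - (q / c * expR (- (c * 0))) by rewrite mulr0 oppr0 expR0 mulr1.
    apply: cvgN; apply: cvgM; first exact: cvg_cst.
    apply: continuous_cvg; first exact: continuous_expR.
    by apply: cvgN; apply: cvgM; [exact: cvg_cst | exact: expNy].
  - have -> : 0 = - (q / c * (0 * 0)) :> R by rewrite !mulr0 oppr0.
    apply: cvgN; apply: cvgM; first exact: cvg_cst.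
    have E (t : R) : expR (- (c * expR (t / q))) = gam q c 0 t * expR (- (t / q)).
      by rewrite /gam -expRD; congr expR; ring.
    rewrite (funext E); apply: cvgM => //.
    exact: cauchy_dominated_cvgy (gam_dominated 0 q0 c0).
have [d0 d1] := (gam_dominated n q0 c0, gam_dominated n.+1 q0 c0).
have [c0' c1'] := (@gam_continuous q c n qn0, @gam_continuous q c n.+1 qn0).
have cZ (a : R) f : continuous f -> continuous (fun t : R => a * f t).
  by move=> cf t; apply: cvgM; [exact: cvg_cst | exact: cf].
have cD (p r : R -> R) : continuous p -> continuous r -> continuous (fun t : R => p t + r t).
  by move=> cp cr t; apply: cvgD; [exact: cp | exact: cr].
have := integral_derive_line0 (fun t => @gam_derive q c n t qn0) _ _ d0.
rewrite integral_cauchyD; [|exact: cZ|exact: cZ|exact: cauchy_dominatedZ|exact: cauchy_dominatedZ].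
rewrite !integral_cauchyZ // IH => /(_ _ _) h.
have {}h : n.+1%:R / q * (q * n`!%:R / c ^+ n.+1) + - (c / q) * \int[mu]_t gam q c n.+1 t = 0.
  apply: h; first by apply: cD; exact: cZ.
  by apply: cauchy_dominatedD; exact: cauchy_dominatedZ.
have -> : \int[mu]_t gam q c n.+1 t = q / c * (c / q * \int[mu]_t gam q c n.+1 t).
  by field; rewrite qn0 cn0.
have -> : c / q * \int[mu]_t gam q c n.+1 t = n.+1%:R / q * (q * n`!%:R / c ^+ n.+1) by lra.
by rewrite factS natrM (exprS c n.+1); field; rewrite qn0 cn0 expf_neq0.
Unshelve. all: by end_near. Qed.

(** The integrand of n! rescaled at its maximum, with e = n^(-1/2); it tends to exp (- t^2 / 2). *)
Definition stirling_integral e := \int[mu]_t expR (e * t - (expR (e * t) - 1 - e * t) / e ^+ 2).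

Lemma factorial_stirling q n : 0 < q -> n%:R = q ^+ 2 :> R ->
  n`!%:R = n%:R ^+ n.+1 * expR (- n%:R) / q * stirling_integral q^-1.
Proof.
move=> q0 nq; have qn0 : q != 0 by rewrite gt_eqF.
have n0 : 0 < n%:R :> R by rewrite nq exprn_gt0.
have h := factorial_integral n q0 n0.
have -> : stirling_integral q^-1 = expR n%:R * \int[mu]_t gam q n%:R n t.
  rewrite -integral_cauchyZ; last 2 first.
  - exact: gam_continuous.
  - exact: gam_dominated.
  apply: eq_Rintegral => t _; rewrite /gam -expRD; congr expR.
  rewrite [q^-1 * t]mulrC; set v := t / q.
  by rewrite exprVn invrK -nq -[n.+1%:R]natr1; ring.
have xn0 : n%:R ^+ n.+1 != 0 :> R by rewrite expf_neq0 // gt_eqF.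
rewrite h expRN; move: (n%:R ^+ n.+1) (expR n%:R) (expR_gt0 (n%:R : R)) xn0 => x y y0 x0.
by field; rewrite x0 qn0 gt_eqF.
Qed.

(** For e t >= -2 the bound exp v >= 1 + v + v^2 / 4 leaves |t| - t^2 / 4, which falls short of 9/4
    - |t| / 2 by the square of |t| / 2 - 3/2. For e t < -2, positivity of exp suffices. *)
Let stirling_le e t : 0 < e <= 1 ->
  e * t - (expR (e * t) - 1 - e * t) / e ^+ 2 <= 9 / 4 - 2^-1 * `|t|.
Proof.
move=> /andP[e0 e1]; have e20 : 0 < e ^+ 2 by rewrite exprn_gt0.
case: (lerP (- 2) (e * t)) => v2.
  have h := sqr_le_expR v2.
  have : t ^+ 2 / 4 <= (expR (e * t) - 1 - e * t) / e ^+ 2.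
    rewrite ler_pdivlMr //.
    have -> : t ^+ 2 / 4 * e ^+ 2 = (e * t) ^+ 2 / 4 by field.
    lra.
  have : e * t <= `|t|.
    by rewrite (le_trans (ler_norm _)) // normrM (gtr0_norm e0) ler_piMl.
  have : 0 <= (`|t| / 2 - 3 / 2) ^+ 2 by exact: sqr_ge0.
  have -> : (`|t| / 2 - 3 / 2) ^+ 2 = `|t| ^+ 2 / 4 - 3 / 2 * `|t| + 9 / 4 by field.
  rewrite real_normK ?num_real //; lra.
have t0 : t < 0 by rewrite -(pmulr_rlt0 _ e0); lra.
rewrite ltr0_norm //.
have h := expR_ge0 (e * t).
have : - (t / 2) <= (expR (e * t) - 1 - e * t) / e ^+ 2.
  rewrite ler_pdivlMr //; have : - (t / 2) * e ^+ 2 <= - (t / 2) * e.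
    rewrite ler_wpM2l //; first lra.
    by rewrite expr2 ler_piMl // ltW.
  lra.
have : e * t <= 0 by lra.
lra.
Qed.

Let expR_remainder t : exists K, forall e, 0 <= e <= 1 ->
  `|expR (e * t) - 1 - e * t - e ^+ 2 * (t ^+ 2 / 2)| <= K * e ^+ 3.
Proof.
pose K := `|t| * expR `|t|; have K0 : 0 <= K by rewrite mulr_ge0 ?expR_ge0.
have r0 e : 0 <= e <= 1 -> `|expR (e * t) - 1| <= K * e ^+ 1.
  move=> /andP[e0 e1].
  apply: (@segment_remainder _ (fun e => expR (e * t) - 1) (fun e => t * expR (e * t))) => //.
  - by rewrite mul0r expR0 subrr.
  - by move=> y _; der; ring.
  move=> y /andP[y0 y1]; rewrite expr0 mulr1 normrM (ger0_norm (expR_ge0 _)) ler_wpM2l //.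
  rewrite ler_expR (le_trans (ler_norm _)) // normrM (ger0_norm y0) ler_piMl //.
  exact: le_trans e1.
have r1 e : 0 <= e <= 1 -> `|expR (e * t) - 1 - e * t| <= `|t| * K * e ^+ 2.
  move=> /andP[e0 e1].
  apply: (@segment_remainder _ (fun e => expR (e * t) - 1 - e * t)
    (fun e => t * (expR (e * t) - 1))) => //.
  - by rewrite mulr_ge0.
  - by rewrite !mul0r expR0 !subrr.
  - by move=> y _; der; ring.
  by move=> y /andP[y0 y1]; rewrite normrM -mulrA ler_wpM2l // r0 // y0 (le_trans y1).
exists (`|t| * (`|t| * K)) => e /andP[e0 e1].
apply: (@segment_remainder _ (fun e => expR (e * t) - 1 - e * t - e ^+ 2 * (t ^+ 2 / 2))
  (fun e => t * (expR (e * t) - 1 - e * t))) => //.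
- by rewrite !mulr_ge0.
- by rewrite expr0n !mul0r expR0 !subrr.
- by move=> y _; der; field.
by move=> y /andP[y0 y1]; rewrite normrM -mulrA ler_wpM2l // r1 // y0 (le_trans y1).
Qed.

Lemma stirling_integral_cvg (e_ : nat -> R) :
  (forall n, 0 < e_ n <= 1) -> e_ n @[n --> \oo] --> (0 : R) ->
  stirling_integral (e_ n) @[n --> \oo] --> (Num.sqrt (2 * pi) : R).
Proof.
move=> eI e_0.
have -> : Num.sqrt (2 * pi) = \int[mu]_t expR (- (t ^+ 2 / 2)) :> R.
  have := @integral_gauss_scaled R 1 ltr01; rewrite divr1 => <-.
  by apply: eq_Rintegral => t _; congr expR; field.
have half0 : 0 < 2^-1 :> R by rewrite invr_gt0.
have [C hC] := abs_exp_dominated half0.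
apply: (cauchy_dct (C := expR (9 / 4) * C)).
- move=> n; apply: continuous_measurable_fun.
  by apply: (derive_continuous (df := fun t => _)) => t; der.
- apply: continuous_measurable_fun.
  by apply: (derive_continuous (df := fun t => _)) => t; der.
- move=> n t; rewrite ger0_norm ?expR_ge0 // -mulrA.
  have {}hC := le_trans (ler_norm _) (hC t).
  apply: le_trans (ler_wpM2l (expR_ge0 _) hC).
  by rewrite -expRD ler_expR stirling_le.
move=> t; apply: continuous_cvg; first exact: continuous_expR.
have -> : - (t ^+ 2 / 2) = 0 * t - t ^+ 2 / 2 by rewrite mul0r sub0r.
apply: cvgB; first by apply: cvgM; [exact: e_0 | exact: cvg_cst].
have [K hK] := expR_remainder t.
exact: (scaled_cvg (k := 2) eI e_0 hK).
Qed.

End Stirling.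

(** * Tannery's theorem with exponential coefficients *)

Section ExponentialTannery.
Variable R : realType.

Lemma cvg_sum_ord K (f : nat -> nat -> R) (l : nat -> R) :
  (forall k, f k N @[N --> \oo] --> l k) ->
  (\sum_(k < K) f k N) @[N --> \oo] --> \sum_(k < K) l k.
Proof.
move=> fl; elim: K => [|K IH].
  by under eq_fun do rewrite big_ord0; rewrite big_ord0; exact: cvg_cst.
under eq_fun do rewrite big_ord_recr; rewrite big_ord_recr.
by apply: cvgD; [exact: IH | exact: fl].
Qed.

Lemma exp_tannery (a : nat -> nat -> R) (b M L : R) :
  (\forall N \near \oo, forall k, (k.*2 <= N)%N -> `|a k N| <= M) ->
  (forall k, a k N @[N --> \oo] --> L) ->
  (\sum_(k < N.+1 | (k.*2 <= N)%N) b ^+ k / k`!%:R * a k N) @[N --> \oo] --> expR b * L.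
Proof.
move=> aM aL; apply/cvgrPdist_le => e e0.
pose S x := series (exp_coeff x) : nat -> R.
have cS x : S x @ \oo --> (expR x : R) by exact: is_cvg_series_exp_coeff.
have S_le n : S `|b| n <= expR `|b|.
  have := nondecreasing_cvgn_le _ (is_cvg_series_exp_coeff `|b|) n; apply.
  apply/nondecreasing_seqP => k; rewrite /S seriesEnat /= big_nat_recr //= lerDl.
  by rewrite /exp_coeff divr_ge0 ?exprn_ge0.
(* [M'] dominates both the bound [M] and the limit [L]; [K] is chosen to make the exponential tails
   at most e / (3 M'), so that each of three errors is at most e / 3. *)
pose M' := `|M| + `|L| + 1.
have M'0 : 0 < M' by rewrite ltr_wpDl // addr_ge0.
have e30 : 0 < e / 3 / M' by rewrite !divr_gt0.
have [K KS KS'] : exists2 K, expR `|b| - S `|b| K <= e / 3 / M' & `|expR b - S b K| <= e / 3 / M'.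
  have h1 : \forall K \near \oo, `|expR `|b| - S `|b| K| <= e / 3 / M'.
    by have := cS `|b| => /cvgrPdist_le; apply.
  have h2 : \forall K \near \oo, `|expR b - S b K| <= e / 3 / M'.
    by have := cS b => /cvgrPdist_le; apply.
  near \oo => K; exists K; last by near: K.
  by apply: le_trans (ler_norm _) _; near: K.
have SE x n : S x n = \sum_(k < n) x ^+ k / k`!%:R.
  by rewrite /S seriesEnat /= big_mkord; apply: eq_bigr.
have cvK : (\sum_(k < K) b ^+ k / k`!%:R * (a k N - L)) @[N --> \oo] --> (0 : R).
  have h := @cvg_sum_ord K (fun k N => b ^+ k / k`!%:R * (a k N - L))
    (fun k => b ^+ k / k`!%:R * 0) _.
  rewrite [X in _ --> X]big1 in h; last by move=> i _; rewrite mulr0.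
  by apply: h => i; apply: cvgM; [exact: cvg_cst | apply/subr_cvg0].
near=> N.
have KN : (K.*2 <= N)%N by near: N; exact: nbhs_infty_ge.
have aN : forall k, (k.*2 <= N)%N -> `|a k N| <= M by near: N.
have small : `|\sum_(k < K) b ^+ k / k`!%:R * (a k N - L)| <= e / 3.
  by near: N; move/cvgr0Pnorm_le: cvK; apply; rewrite divr_gt0.
pose T := \sum_(K <= k < N.+1 | (k.*2 <= N)%N) b ^+ k / k`!%:R * a k N.
have split_sum : \sum_(k < N.+1 | (k.*2 <= N)%N) b ^+ k / k`!%:R * a k N =
    \sum_(k < K) b ^+ k / k`!%:R * a k N + T.
  rewrite -(big_mkord (fun k => (k.*2 <= N)%N) (fun k => b ^+ k / k`!%:R * a k N)).
  rewrite (big_cat_nat (n := K)) //=; last by lia.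
  congr (_ + _); rewrite big_mkord; apply: eq_bigl => i.
  by have := ltn_ord i; lia.
have Tle : `|T| <= M' * (e / 3 / M').
  apply: le_trans (ler_norm_sum _ _ _) _.
  have M0 : 0 <= M by apply: le_trans (aN 0 _); rewrite ?normr_ge0.
  apply: (@le_trans _ _ (M * \sum_(K <= k < N.+1) `|b| ^+ k / k`!%:R)).
    rewrite mulr_sumr [leRHS](bigID (fun k => (k.*2 <= N)%N)) /=.
    apply: ler_wpDr.
      by apply: sumr_ge0 => k _; rewrite mulr_ge0 // divr_ge0 ?exprn_ge0.
    apply: ler_sum => k kN; rewrite normrM mulrC; apply: ler_pM => //; first exact: aN.
    by rewrite normrM normrX normfV normr_nat.
  have -> : \sum_(K <= k < N.+1) `|b| ^+ k / k`!%:R = S `|b| N.+1 - S `|b| K.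
    rewrite !SE -!(big_mkord xpredT (fun k => `|b| ^+ k / k`!%:R)).
    by rewrite (@big_cat_nat _ _ _ K 0 N.+1) //=; [rewrite [RHS]addrC addKr | lia].
  apply: ler_pM => //.
  - rewrite subr_ge0 !SE -!(big_mkord xpredT (fun k => `|b| ^+ k / k`!%:R)).
    rewrite (@big_cat_nat _ _ _ K 0 N.+1) //=; last by lia.
    by rewrite lerDl; apply: sumr_ge0 => k _; rewrite divr_ge0 ?exprn_ge0.
  - by rewrite /M'; have := normr_ge0 L; have := ler_norm M; lra.
  - by have := S_le N.+1; lra.
rewrite mulrC divfK ?gt_eqF // in Tle.
have -> : expR b * L - \sum_(k < N.+1 | (k.*2 <= N)%N) b ^+ k / k`!%:R * a k N =
    L * (expR b - S b K) - \sum_(k < K) b ^+ k / k`!%:R * (a k N - L) - T.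
  rewrite split_sum SE.
  have -> : \sum_(k < K) b ^+ k / k`!%:R * (a k N - L) =
     \sum_(k < K) b ^+ k / k`!%:R * a k N - L * \sum_(k < K) b ^+ k / k`!%:R.
    by rewrite mulr_sumr -sumrB; apply: eq_bigr => i _; ring.
  by ring.
have hL : `|L * (expR b - S b K)| <= e / 3.
  rewrite normrM; apply: le_trans (ler_wpM2l (normr_ge0 L) KS') _.
  have -> : `|L| * (e / 3 / M') = e / 3 * (`|L| / M') by ring.
  rewrite ler_piMr ?divr_ge0 ?(ltW e0) // ler_pdivrMr // mul1r /M'.
  by have := normr_ge0 M; lra.
apply: le_trans (ler_normB _ _) _.
have := ler_normB (L * (expR b - S b K)) (\sum_(k < K) b ^+ k / k`!%:R * (a k N - L)).
lra.
Unshelve. all: by end_near. Qed.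

End ExponentialTannery.

(** * Hermite kernels at the spectral edge for a fixed size *)

Section KernelAsymptotics.
Variable R : realType.
Implicit Types (s t x y : R) (n i j : nat).

Lemma hermite_kernel_recr x y j : hermite_kernel x y j.+1 =
  hermite_kernel x y j + (hermite R j.+1).[x] * (hermite R j.+1).[y] / j.+1`!%:R.
Proof. by rewrite /hermite_kernel big_ord_recr. Qed.

Let hermite_step j x : (hermite R j.+2).[x] = x * (hermite R j.+1).[x] - j.+1%:R * (hermite R j).[x].
Proof. by rewrite hermiteSS hornerD hornerN hornerM hornerX hornerZ. Qed.

Let hermite_at0 x : (hermite R 0).[x] = 1. Proof. by rewrite hermite0 hornerC. Qed.
Let hermite_at1 x : (hermite R 1).[x] = x. Proof. by rewrite hermite1 hornerX. Qed.

Let fact_neq0 j : j`!%:R != 0 :> R.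
Proof. by rewrite pnatr_eq0 -lt0n fact_gt0. Qed.

Let factS_R j : j.+1`!%:R = j.+1%:R * j`!%:R :> R.
Proof. by rewrite factS natrM. Qed.

Lemma hermite_kernel_offdiag x y j : x != y -> hermite_kernel x y j =
  ((hermite R j.+1).[x] * (hermite R j).[y] - (hermite R j).[x] * (hermite R j.+1).[y])
    / (j`!%:R * (x - y)).
Proof.
rewrite -subr_eq0 => ne; elim: j => [|j IH].
  rewrite /hermite_kernel big_ord1 !hermite_at0 !hermite_at1 fact0.
  by field.
rewrite hermite_kernel_recr IH !(hermite_step j) factS_R.
have j1 : j.+1%:R != 0 :> R by rewrite pnatr_eq0.
move: (j.+1%:R) j1 => c c0; field.
by rewrite ne fact_neq0 c0.
Qed.

(** The confluent Christoffel-Darboux formula, with derivatives eliminated through He_j' = j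
    He_{j-1} and the recurrence, so that only He_j and He_{j+1} occur and induction applies. *)
Lemma hermite_kernel_diag x j : hermite_kernel x x j =
  ((hermite R j.+1).[x] ^+ 2 - x * (hermite R j).[x] * (hermite R j.+1).[x]
    + j.+1%:R * (hermite R j).[x] ^+ 2) / j`!%:R.
Proof.
elim: j => [|j IH].
  rewrite /hermite_kernel big_ord1 !hermite_at0 !hermite_at1 fact0.
  by field.
rewrite hermite_kernel_recr IH !(hermite_step j) factS_R -[j.+2%:R]natr1.
have j1 : j.+1%:R != 0 :> R by rewrite pnatr_eq0.
move: (j.+1%:R) j1 => c c0; field.
by rewrite fact_neq0 c0.
Qed.

Section FixedSize.
Variables (m : R) (N : nat).
Hypotheses (m1 : 1 <= m) (Nm : N%:R = m ^+ 6 :> R).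
Let m0 : 0 < m. Proof. exact: lt_le_trans m1. Qed.
Let mn0 : m != 0. Proof. by rewrite gt_eqF. Qed.
Let X s := 2 * m ^+ 3 + s / m.
Let e := (m ^+ 2)^-1.
Let F s := edge_factor m N s.
Let q : R := Num.sqrt (2 * pi).
Let q0 : 0 < q. Proof. by rewrite sqrtr_gt0 mulr_gt0 // pi_gt0. Qed.

Definition kernel_norm s t := (q * m * expR (2 * m ^+ 6 + (s + t) * m ^+ 2))^-1.
(** What Stirling's formula leaves of the prefactors; it tends to (2 pi)^-2, which converts [airyA]
    and [airyB] into Ai and Ai'. *)
Definition kernel_weight s t :=
  expR ((s ^+ 2 + t ^+ 2) / 2 * e) / (q ^+ 3 * stirling_integral (m ^+ 3)^-1).

Hypothesis I0 : 0 < stirling_integral (m ^+ 3)^-1.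

(** Stirling's formula for N = m^6 cancels the powers m^(6 N) and the large exponentials of the two
    edge factors against N! and the normalisation. *)
Lemma kernel_weightE s t :
  kernel_norm s t * (F s * F t * m ^+ 2 / N`!%:R) = kernel_weight s t.
Proof.
have m30 : 0 < m ^+ 3 by rewrite exprn_gt0.
have N32 : N%:R = (m ^+ 3) ^+ 2 :> R by rewrite Nm -exprM.
rewrite (factorial_stirling m30 N32) Nm /kernel_norm /kernel_weight /F /edge_factor -/q.
have := I0; move: (stirling_integral _) => I i0.
have mN : (m ^+ 6) ^+ N.+1 = m ^+ 6 * (m ^+ 3) ^+ N * (m ^+ 3) ^+ N.
  by rewrite exprS -mulrA -exprMn -exprD.
rewrite mN; have := expf_neq0 N (lt0r_neq0 m30); move: ((m ^+ 3) ^+ N) => P P0.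
have e1 : expR (m ^+ 6 / 2 + s * m ^+ 2 + s ^+ 2 / (2 * m ^+ 2)) *
   expR (m ^+ 6 / 2 + t * m ^+ 2 + t ^+ 2 / (2 * m ^+ 2)) =
   expR (2 * m ^+ 6 + (s + t) * m ^+ 2) * expR (- m ^+ 6) *
   expR ((s ^+ 2 + t ^+ 2) / 2 * e).
  by rewrite -!expRD /e; congr expR; field.
move: (expR_gt0 (2 * m ^+ 6 + (s + t) * m ^+ 2)) (expR_gt0 (- m ^+ 6)) e1.
move: (expR (m ^+ 6 / 2 + s * m ^+ 2 + _)) (expR (m ^+ 6 / 2 + t * m ^+ 2 + _)).
move: (expR (2 * m ^+ 6 + _)) (expR (- m ^+ 6)) (expR ((s ^+ 2 + t ^+ 2) / 2 * e)).
move=> a b c u v a0 b0 uv.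
move: (q) q0 => r r0.
have -> : m / r * P * u * (m / r * P * v) * m ^+ 2 =
  m ^+ 4 / r ^+ 2 * P ^+ 2 * (u * v) by field; rewrite gt_eqF.
rewrite uv; field.
by rewrite P0 mn0 !gt_eqF.
Qed.

Let A s := edgeA e s.
Let B s := edgeB e s.

Let HN s : (hermite R N).[X s] = F s * A s.
Proof. exact: hermite_edgeA. Qed.

Let HN1 s : (hermite R N.+1).[X s] = F s * (m ^+ 3 * A s + m * B s).
Proof.
rewrite -[LHS](subrK (m ^+ 3 * (hermite R N).[X s])) hermite_edgeB // HN -/e -/(F s) -/(B s).
by ring.
Qed.

(** He_{N+1} is the edge factor times m^3 A + m B. By antisymmetry the m^3 parts cancel, and m
    divided by X s - X t = (s - t) / m gives the m^2 absorbed in the weight. *)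
Lemma kernel_offdiag s t : s != t ->
  kernel_norm s t * hermite_kernel (X s) (X t) N =
  kernel_weight s t * ((B s * A t - A s * B t) / (s - t)).
Proof.
rewrite -subr_eq0 => ne.
have Xst : X s - X t = (s - t) / m by rewrite /X; field.
have Xne : X s != X t by rewrite -subr_eq0 Xst mulf_neq0 // invr_neq0.
rewrite hermite_kernel_offdiag // Xst !HN !HN1 -kernel_weightE.
move: (fact_neq0 N); move: (N`!%:R) (kernel_norm s t) (F s) (F t) => c d u v c0.
by field; rewrite c0 ne mn0.
Qed.

(** The terms of order m^6 and m^4 cancel; order m^2 gives the limit, and the remainder carries
    [e]. *)
Lemma kernel_diag s : kernel_norm s s * hermite_kernel (X s) (X s) N =
  kernel_weight s s * (B s ^+ 2 - s * A s ^+ 2 + e * (A s ^+ 2 - s * (A s * B s))).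
Proof.
rewrite hermite_kernel_diag !HN !HN1 -kernel_weightE -natr1 Nm /e /X.
move: (fact_neq0 N); move: (N`!%:R) (kernel_norm s s) (F s) (A s) (B s) => c d u a b c0.
by field; rewrite c0 mn0.
Qed.

(* AM-GM on each summand, since [kernel_norm s t] is multiplicatively separated. *)
Lemma kernel_le s t j : (j <= N)%N ->
  `|kernel_norm s t * hermite_kernel (X s) (X t) j| <=
  2^-1 * (kernel_norm s s * hermite_kernel (X s) (X s) N
          + kernel_norm t t * hermite_kernel (X t) (X t) N).
Proof.
move=> jN; pose E s := expR (- (m ^+ 6 + s * m ^+ 2)).
have nE u v : kernel_norm u v = (q * m)^-1 * (E u * E v).
  rewrite /kernel_norm invfM; congr (_ * _); rewrite -expRN -expRD; congr expR; ring.
have qm : 0 <= (q * m)^-1 by rewrite invr_ge0 mulr_ge0 ?(ltW q0) ?(ltW m0).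
pose h i u := E u * (hermite R i).[X u].
have kE u v i : kernel_norm u v * hermite_kernel (X u) (X v) i =
    (q * m)^-1 * \sum_(k < i.+1) h k u * h k v / k`!%:R.
  rewrite nE -mulrA; congr (_ * _); rewrite /hermite_kernel mulr_sumr.
  by apply: eq_bigr => k _; rewrite /h; ring.
rewrite !kE normrM (ger0_norm qm) -mulrDr mulrCA ler_wpM2l // -big_split /= mulr_sumr.
apply: le_trans (ler_norm_sum _ _ _) _.
pose G k := 2^-1 * (h k s * h k s / k`!%:R + h k t * h k t / k`!%:R).
have G0 k : 0 <= G k.
  by rewrite mulr_ge0 // addr_ge0 // divr_ge0 // -expr2 sqr_ge0.
apply: (@le_trans _ _ (\sum_(k < j.+1) G k)); last first.
  rewrite -!(big_mkord xpredT G) [leRHS](@big_cat_nat _ _ _ j.+1) //=.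
  by rewrite lerDl sumr_ge0.
apply: ler_sum => k _.
have -> : G k = 2^-1 * (`|h k s| ^+ 2 + `|h k t| ^+ 2) / k`!%:R.
  by rewrite /G !real_normK ?num_real //; ring.
rewrite normrM normfV normr_nat ler_wpM2r ?invr_ge0 // normrM.
have := sqr_ge0 (`|h k s| - `|h k t|); nra.
Qed.

(** Relative to the edge factor, He_{N-i} loses about N^(i/2) = (m^3)^i, which the power of m^3
    compensates. *)
Definition hermite_ratio i s := (m ^+ 3) ^+ i * (hermite R (N - i)).[X s] / F s.

Let F0 s : F s != 0.
Proof.
by rewrite gt_eqF // /F /edge_factor !mulr_gt0 ?expR_gt0 ?invr_gt0 ?exprn_gt0.
Qed.

Lemma hermite_ratio0 s : hermite_ratio 0 s = A s.
Proof. by rewrite /hermite_ratio expr0 mul1r subn0 HN mulrC mulKf. Qed.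

Lemma hermite_ratio1 s : (0 < N)%N ->
  hermite_ratio 1 s = A s * (1 + s * e ^+ 2) - B s * e.
Proof.
move=> N0; rewrite /hermite_ratio expr1 subn1.
have h := hermite_step N.-1 (X s).
rewrite prednK // HN HN1 Nm in h.
have -> : (hermite R N.-1).[X s] = (X s * (F s * A s) - F s * (m ^+ 3 * A s + m * B s)) / m ^+ 6.
  by rewrite h; field.
by rewrite /e /X; move: (F s) (F0 s) => f f0; field; rewrite mn0 f0.
Qed.

(** The three-term recurrence read downwards; 1 - (i + 1) e^3 is (N - i - 1) / N. *)
Lemma hermite_ratioSS i s : (i.+2 <= N)%N ->
  hermite_ratio i.+2 s = (1 - i.+1%:R * e ^+ 3)^-1 *
    ((2 + s * e ^+ 2) * hermite_ratio i.+1 s - hermite_ratio i s).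
Proof.
move=> iN; rewrite /hermite_ratio.
have -> : (N - i = (N - i.+2).+2)%N by lia.
have -> : (N - i.+1 = (N - i.+2).+1)%N by lia.
set j := (N - i.+2)%N.
have jE : j.+1%:R = m ^+ 6 - i.+1%:R :> R.
  by rewrite -Nm -natrB ?(ltnW iN) //; congr (_%:R); rewrite /j; lia.
have j0 : m ^+ 6 - i.+1%:R != 0 by rewrite -jE pnatr_eq0.
rewrite hermite_step jE !(exprS _ i.+1) !(exprS _ i) /e /X.
move: (i.+1%:R) (F0 s) j0 ((m ^+ 3) ^+ i) => c f0 c0 P.
field.
by rewrite f0 mn0 -exprM c0.
Qed.

(** A single summand lacks the factor m^2 = 1/e built into [kernel_weight], hence the small [e] on
    the right. The falling factorial N!/(N - i)! is at most N^i, which absorbs the powers in the two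
    ratios. *)
Lemma hermite_term_le i s t : (i <= N)%N ->
  `|kernel_norm s t * ((hermite R (N - i)).[X s] * (hermite R (N - i)).[X t] / (N - i)`!%:R)|
  <= `|kernel_weight s t * e * (hermite_ratio i s * hermite_ratio i t)|.
Proof.
move=> iN; have N0 : 0 < N%:R :> R by rewrite Nm exprn_gt0.
have le1 : (N ^_ i)%:R / N%:R ^+ i <= 1 :> R.
  rewrite ler_pdivrMr ?exprn_gt0 // mul1r -natrX ler_nat.
  by elim: (i) => [|k IH]; rewrite ?ffactn0 // ffactnSr expnSr leq_mul // leq_subr.
have ge0 : 0 <= (N ^_ i)%:R / N%:R ^+ i :> R by rewrite divr_ge0 // exprn_ge0.
have fE : N`!%:R = (N ^_ i)%:R * (N - i)`!%:R :> R by rewrite -natrM ffact_fact.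
have ff0 : (N ^_ i)%:R != 0 :> R.
  by apply: contraTneq (fact_neq0 N) => h; rewrite fE h mul0r eqxx.
have -> : kernel_norm s t * ((hermite R (N - i)).[X s] * (hermite R (N - i)).[X t] / (N - i)`!%:R)
  = kernel_weight s t * e * (hermite_ratio i s * hermite_ratio i t) *
    ((N ^_ i)%:R / N%:R ^+ i).
  rewrite -kernel_weightE fE /hermite_ratio /e Nm.
  have -> : (m ^+ 6) ^+ i = (m ^+ 3) ^+ i * (m ^+ 3) ^+ i by rewrite -exprMn -exprD.
  have := expf_neq0 i (expf_neq0 3 mn0); move: ((m ^+ 3) ^+ i) => P P0.
  move: (fact_neq0 (N - i)) (F0 s) (F0 t) ff0; move: (N - i)`!%:R (N ^_ i)%:R.
  move: (F s) (F t) (kernel_norm s t) => u v k a b a0 u0 v0 b0.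
  by field; rewrite a0 b0 u0 v0 P0 mn0.
by rewrite normrM ler_piMr // ger0_norm.
Qed.

End FixedSize.
End KernelAsymptotics.

(** * Passage to the limit in the size *)

Section EdgeLimit.
Variable R : realType.
Implicit Types (s t : R) (n i j : nat).

Definition root6 n : R := n%:R `^ 6^-1.
(** Sequences are indexed by n + 1 so that [m n] is at least 1 and [e n] lies in ]0, 1]. *)
Let m n := root6 n.+1.
Let e n := (m n ^+ 2)^-1.

Lemma root6X n k : root6 n ^+ k = n%:R `^ (k%:R / 6).
Proof. by rewrite /root6 -powR_mulrn ?powR_ge0 // -powRrM mulrC. Qed.

Lemma root6_pow6 n : n%:R = root6 n ^+ 6.
Proof. by rewrite root6X divff // powRr1. Qed.

Lemma root6_pow3 n : root6 n ^+ 3 = Num.sqrt n%:R.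
Proof. by rewrite root6X -powR12_sqrt //; congr (_ `^ _); field. Qed.

Lemma root6_pow2 n : root6 n ^+ 2 = n%:R `^ 3^-1.
Proof. by rewrite root6X; congr (_ `^ _); field. Qed.

Let m_ge1 n : 1 <= m n.
Proof.
rewrite /m /root6 -[leLHS](powRr0 n.+1%:R) ler_powR ?ler1n //.
Qed.

Let m_gt0 n : 0 < m n. Proof. exact: lt_le_trans (m_ge1 n). Qed.

Let m6 n : n.+1%:R = m n ^+ 6 :> R. Proof. exact: root6_pow6. Qed.

Let e_I n : 0 < e n <= 1.
Proof. by rewrite invr_gt0 exprn_gt0 //= invf_le1 ?exprn_gt0 // exprn_ege1. Qed.

Let e_0 : e n @[n --> \oo] --> (0 : R).
Proof.
apply/cvgr0Pnorm_le => d d0; near=> n.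
have /andP[e0 e1] := e_I n; rewrite gtr0_norm //.
have e3 : e n ^+ 3 = n.+1%:R^-1 by rewrite m6 /e exprVn -exprM.
have h : n.+1%:R^-1 < d ^+ 3.
  near: n; have := near_infty_natSinv_lt (PosNum (exprn_gt0 3 d0)).
  by apply: filterS.
rewrite leNgt; apply/negP => de.
have : d ^+ 3 < e n ^+ 3 by rewrite ltrXn2r // ?nnegrE ltW.
by rewrite e3 ltNge (ltW h).
Unshelve. all: by end_near. Qed.

Let i3_I n : 0 < (m n ^+ 3)^-1 <= 1.
Proof. by rewrite invr_gt0 exprn_gt0 //= invf_le1 ?exprn_gt0 // exprn_ege1. Qed.

Let i3_0 : (m n ^+ 3)^-1 @[n --> \oo] --> (0 : R).
Proof.
apply: (@squeeze_cvgr _ _ _ _ (fun=> 0) e); last 2 first.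
- exact: cvg_cst.
- exact: e_0.
apply: nearW => n; have /andP[/ltW -> _] := i3_I n.
by rewrite /= lef_pV2 ?posrE ?exprn_gt0 // ler_weXn2l.
Qed.

Let stir_gt0 n : 0 < stirling_integral (m n ^+ 3)^-1.
Proof.
have m30 : 0 < m n ^+ 3 by rewrite exprn_gt0.
have N32 : n.+1%:R = (m n ^+ 3) ^+ 2 :> R by rewrite m6 -exprM.
have := factorial_stirling m30 N32; set c := _ / _ => h.
have c0 : 0 < c.
  by apply: divr_gt0 => //; rewrite mulr_gt0 ?expR_gt0 // exprn_gt0 // ltr0n.
by rewrite -(pmulr_rgt0 _ c0) -h ltr0n fact_gt0.
Qed.

Let q : R := Num.sqrt (2 * pi).
Let q2 : q ^+ 2 = 2 * pi.
Proof. by rewrite sqr_sqrtr // mulr_ge0 // pi_ge0. Qed.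

Let A_cvg s : edgeA (e n) s @[n --> \oo] --> airyA s.
Proof. exact: edgeA_cvg. Qed.
Let B_cvg s : edgeB (e n) s @[n --> \oo] --> airyB s.
Proof. exact: edgeB_cvg. Qed.

Let weight_cvg s t : kernel_weight (m n) s t @[n --> \oo] --> (4 * pi ^+ 2)^-1.
Proof.
have q0 : 0 < q by rewrite sqrtr_gt0 mulr_gt0 // pi_gt0.
have -> : (4 * pi ^+ 2)^-1 = expR ((s ^+ 2 + t ^+ 2) / 2 * 0) / (q ^+ 3 * q).
  rewrite mulr0 expR0 -exprSr (exprM q 2 2) q2 mul1r; congr (_^-1).
  by rewrite exprMn -natrX.
apply: cvgM.
  apply: continuous_cvg; first exact: continuous_expR.
  by apply: cvgM; [exact: cvg_cst | exact: e_0].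
apply: cvgV; first by rewrite mulf_neq0 // ?expf_neq0 // gt_eqF.
by apply: cvgM; [exact: cvg_cst | exact: stirling_integral_cvg].
Qed.

Let X n s := edge_scaling n s.
Let XE n s : X n.+1 s = 2 * m n ^+ 3 + s / m n.
Proof. by rewrite /X /edge_scaling root6_pow3. Qed.

Definition scaled_kernel n s t j : R :=
  kernel_norm (root6 n) s t * hermite_kernel (edge_scaling n s) (edge_scaling n t) j.

Lemma scaled_kernel_top_cvg s t :
  scaled_kernel n.+1 s t n.+1 @[n --> \oo] --> airy_kernel s t.
Proof.
rewrite airy_kernelE; have [<-|ne] := eqVneq s t.
  have E n : scaled_kernel n.+1 s s n.+1 = kernel_weight (m n) s s *
     (edgeB (e n) s ^+ 2 - s * edgeA (e n) s ^+ 2 +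
      e n * (edgeA (e n) s ^+ 2 - s * (edgeA (e n) s * edgeB (e n) s))).
    rewrite /scaled_kernel -/(X n.+1 s) XE.
    exact: (kernel_diag (m_ge1 n) (m6 n) (stir_gt0 n)).
  rewrite (funext E).
  have -> : (airyB s ^+ 2 - s * airyA s ^+ 2) / (4 * pi ^+ 2) = (4 * pi ^+ 2)^-1 *
    (airyB s ^+ 2 - s * airyA s ^+ 2 + 0 * (airyA s ^+ 2 - s * (airyA s * airyB s))).
    by rewrite mul0r addr0 mulrC.
  apply: cvgM; first exact: weight_cvg.
  have AA : edgeA (e n) s ^+ 2 @[n --> \oo] --> airyA s ^+ 2 by apply: cvgM; exact: A_cvg.
  have BB : edgeB (e n) s ^+ 2 @[n --> \oo] --> airyB s ^+ 2 by apply: cvgM; exact: B_cvg.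
  apply: cvgD; first by apply: cvgB => //; apply: cvgM => //; exact: cvg_cst.
  apply: cvgM; first exact: e_0.
  apply: cvgB => //; apply: cvgM; first exact: cvg_cst.
  by apply: cvgM; [exact: A_cvg | exact: B_cvg].
have E n : scaled_kernel n.+1 s t n.+1 = kernel_weight (m n) s t *
   ((edgeB (e n) s * edgeA (e n) t - edgeA (e n) s * edgeB (e n) t) / (s - t)).
  rewrite /scaled_kernel -/(X n.+1 s) -/(X n.+1 t) !XE.
  exact: (kernel_offdiag (m_ge1 n) (m6 n) (stir_gt0 n)).
rewrite (funext E) invfM mulrCA.
apply: cvgM; first exact: weight_cvg.
apply: cvgM; last exact: cvg_cst.
apply: cvgB.
  by apply: cvgM; [exact: B_cvg | exact: A_cvg].
by apply: cvgM; [exact: A_cvg | exact: B_cvg].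
Qed.

(** In the limit the recurrence becomes x_{i+2} = 2 x_{i+1} - x_i, so the common limit of the first
    two ratios persists for every i. *)
Let ratio_cvg i s : hermite_ratio (m n) n.+1 i s @[n --> \oo] --> airyA s.
Proof.
have cs : s * e n ^+ 2 @[n --> \oo] --> s * (0 * 0).
  by apply: cvgM; [exact: cvg_cst | apply: cvgM; exact: e_0].
have r0 : hermite_ratio (m n) n.+1 0 s @[n --> \oo] --> airyA s.
  have E n : hermite_ratio (m n) n.+1 0 s = edgeA (e n) s by exact: (hermite_ratio0 (m_ge1 n) (m6 n)).
  by rewrite (funext E); exact: A_cvg.
have r1 : hermite_ratio (m n) n.+1 1 s @[n --> \oo] --> airyA s.
  have E n : hermite_ratio (m n) n.+1 1 s =
      edgeA (e n) s * (1 + s * e n ^+ 2) - edgeB (e n) s * e n by exact: (hermite_ratio1 (m_ge1 n) (m6 n)).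
  rewrite (funext E).
  have -> : airyA s = airyA s * (1 + s * (0 * 0)) - airyB s * 0 by ring.
  apply: cvgB; apply: cvgM; [exact: A_cvg | | exact: B_cvg | exact: e_0].
  by apply: cvgD => //; exact: cvg_cst.
suff: (hermite_ratio (m n) n.+1 i s @[n --> \oo] --> airyA s) /\
  (hermite_ratio (m n) n.+1 i.+1 s @[n --> \oo] --> airyA s) by case.
elim: i => [//|i [IH0 IH1]]; split=> //.
pose G n := (1 - i.+1%:R * e n ^+ 3)^-1 *
    ((2 + s * e n ^+ 2) * hermite_ratio (m n) n.+1 i.+1 s - hermite_ratio (m n) n.+1 i s).
have cG : G n @[n --> \oo] --> airyA s.
  have -> : airyA s = (1 - i.+1%:R * (0 * (0 * 0)))^-1 * ((2 + s * (0 * 0)) * airyA s - airyA s).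
    by field.
  apply: cvgM.
    apply: cvgV; first by rewrite !mulr0 subr0 oner_eq0.
    apply: cvgB; first exact: cvg_cst.
    apply: cvgM; first exact: cvg_cst.
    by apply: cvgM; [exact: e_0 | apply: cvgM; exact: e_0].
  apply: cvgB => //; apply: cvgM => //.
  by apply: cvgD => //; exact: cvg_cst.
apply: cvg_trans cG; apply: near_eq_cvg; near=> n.
rewrite /G (hermite_ratioSS (m_ge1 n) (m6 n)) //.
by near: n; exists i.+1 => // n /=; rewrite ltnS.
Unshelve. all: by end_near. Qed.

Let term_cvg i s t : kernel_norm (m n) s t *
  ((hermite R (n.+1 - i)).[X n.+1 s] * (hermite R (n.+1 - i)).[X n.+1 t] / (n.+1 - i)`!%:R)
  @[n --> \oo] --> (0 : R).
Proof.
apply: norm_cvg0.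
have cb : `|kernel_weight (m n) s t * e n *
    (hermite_ratio (m n) n.+1 i s * hermite_ratio (m n) n.+1 i t)| @[n --> \oo] --> (0 : R).
  rewrite -(@normr0 _ R).
  have -> : 0 = (4 * pi ^+ 2)^-1 * 0 * (airyA s * airyA t) :> R by rewrite mulr0 mul0r.
  apply: cvg_norm; apply: cvgM; first by apply: cvgM; [exact: weight_cvg | exact: e_0].
  by apply: cvgM; exact: ratio_cvg.
apply: (@squeeze_cvgr _ _ _ _ (fun=> 0) _ _ _ _ _ cb); last exact: cvg_cst.
near=> n; rewrite normr_ge0 /= !XE (hermite_term_le (m_ge1 n) (m6 n) (stir_gt0 n)) //.
by near: n; exists i => // n /=; exact: leqW.
Unshelve. all: by end_near. Qed.

(** Lowering the index by one removes one summand, negligible by [term_cvg]; a fixed number of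
    removals keeps the limit. *)
Lemma scaled_kernel_cvg j s t :
  scaled_kernel n.+1 s t (n.+1 - j) @[n --> \oo] --> airy_kernel s t.
Proof.
elim: j => [|j IH]; first by under eq_fun do rewrite subn0; exact: scaled_kernel_top_cvg.
pose T n := kernel_norm (m n) s t * ((hermite R (n.+1 - j)).[X n.+1 s] *
  (hermite R (n.+1 - j)).[X n.+1 t] / (n.+1 - j)`!%:R).
have cG : scaled_kernel n.+1 s t (n.+1 - j) - T n @[n --> \oo] --> airy_kernel s t.
  by rewrite -[X in _ --> X]subr0; apply: cvgB; [exact: IH | exact: term_cvg].
apply: cvg_trans cG; apply: near_eq_cvg; near=> n.
have jn : (j <= n)%N by near: n; exists j.
rewrite /T subSn // subSS /scaled_kernel hermite_kernel_recr mulrDr.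
by rewrite addrK.
Unshelve. all: by end_near. Qed.

(** [kernel_le] bounds the kernels of all lower indices at once by the convergent diagonal ones at
    full size; this is the domination used in [exp_tannery]. *)
Lemma scaled_kernel_bounded s t : exists M, \forall n \near \oo,
  forall j, (j <= n.+1)%N -> `|scaled_kernel n.+1 s t j| <= M.
Proof.
pose L := 2^-1 * (airy_kernel s s + airy_kernel t t).
have cL : 2^-1 * (scaled_kernel n.+1 s s n.+1 + scaled_kernel n.+1 t t n.+1) @[n --> \oo] --> L.
  apply: cvgM; first exact: cvg_cst.
  by apply: cvgD; exact: scaled_kernel_top_cvg.
exists (`|L| + 1); near=> n => j jn.
have h : `|L - 2^-1 * (scaled_kernel n.+1 s s n.+1 + scaled_kernel n.+1 t t n.+1)| <= 1.
  by near: n; move/cvgrPdist_le: cL; apply.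
have := kernel_le (m_ge1 n) s t jn; rewrite -!XE => h1.
apply: (le_trans h1); rewrite ler_norml in h; have /andP[h2 _] := h.
have := ler_norm L; move: h2; rewrite /scaled_kernel -/(m n) -/(X n.+1 s) -/(X n.+1 t).
lra.
Unshelve. all: by end_near. Qed.

Lemma scaled_kernel_sum_cvg (b : R) s t :
  (\sum_(k < N.+1 | (k.*2 <= N)%N) b ^+ k / k`!%:R * scaled_kernel N s t (N - k.*2))
    @[N --> \oo] --> expR b * airy_kernel s t.
Proof.
have [M hM] := scaled_kernel_bounded s t.
apply: (exp_tannery (a := fun k N => scaled_kernel N s t (N - k.*2)) (M := M)).
  case: hM => N0 _ h; exists N0.+1 => // -[//|n] /= N0n k _.
  by apply: h => //; exact: leq_subr.
by move=> k; rewrite -cvg_shiftS; exact: scaled_kernel_cvg.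
Qed.

Lemma edge_norm_kernel_norm N s t : (0 < N)%N ->
  edge_norm N s t * N`!%:R = kernel_norm (root6 N) s t.
Proof.
move=> N0; rewrite /edge_norm /kernel_norm -root6_pow2 -root6_pow6 -/(root6 N) !invfM.
have f0 : N`!%:R != 0 :> R by rewrite pnatr_eq0 -lt0n fact_gt0.
have := f0; move: (N`!%:R) (root6 N)^-1 (expR _)^-1 (Num.sqrt _)^-1 => a x y z a0.
by field.
Qed.

End EdgeLimit.

Local Open Scope complex_scope.

(** In the order of [R[i]] every positive epsilon is real, so the estimate reduces to its real
    part. *)
Lemma cvg_real_complex (R : realType) (u : nat -> R) (l : R) :
  u n @[n --> \oo] --> l -> ((u n)%:C : R[i]^o) @[n --> \oo] --> (l%:C : R[i]^o).
Proof.
move=> ul; apply/cvgrPdist_le => eps eps0.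
have e0 : 0 < complex.Re eps by move: eps0; rewrite ltcE => /andP[].
have h : \forall n \near \oo, `|l - u n| <= complex.Re eps.
  by move/cvgrPdist_le: ul; apply.
apply: filterS h => n h.
rewrite -rmorphB normc_def /= expr0n addr0 sqrtr_sqr lecE /= h andbT.
by move: eps0; rewrite ltcE /= => /andP[].
Qed.

Theorem theorem1p1 (R : realType) (Q : probability (measurableTypeR R) R) (b : R)
  (Q_mean : (\int[Q]_x x%:E = 0)%E)
  (Q_var : (\int[Q]_x (x ^+ 2)%:E = (2^-1)%:E)%E)
  (Q_fourth : (\int[Q]_x (x ^+ 4)%:E = b%:E)%E)
  (d : nat -> measure_display) (T : forall N : nat, measurableType (d N))
  (P : forall N : nat, probability (T N) R)
  (XRe XIm : forall N : nat, 'I_N -> 'I_N -> {RV (P N) >-> R})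
  (X_iid : forall N : nat, (0 < N)%N -> iid_wigner_entries Q (@XRe N) (@XIm N))
  (mu nu : R) :
  ((edge_norm N mu nu)%:C *
     wigner_corr (@XRe N) (@XIm N) (edge_scaling N mu) (edge_scaling N nu)
     : R[i]^o) @[N --> \oo]
  --> ((expR (b - 3 / 4) * airy_kernel mu nu)%:C : R[i]^o).
Proof.
have cv := cvg_real_complex (@scaled_kernel_sum_cvg R (b - 3 / 4) mu nu).
(* The two sequences are compared for N > 0 only, the range in which [X_iid] and
   [edge_norm_kernel_norm] apply. *)
apply: cvg_trans cv; apply: near_eq_cvg; near=> N.
have N0 : (0 < N)%N by near: N; exact: nbhs_infty_gt.
rewrite (wigner_corrE Q_mean Q_var Q_fourth (X_iid N N0)) -rmorphM; congr (_%:C).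
rewrite mulrA edge_norm_kernel_norm // mulr_sumr; apply: eq_bigr => k _.
by rewrite /scaled_kernel mulrCA.
Unshelve. all: by end_near. Qed.
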